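(* Let $\mathcal{N}\in\mathrm{Ch}(A'B',AB)$ and regard $\mathcal N^{\otimes n}$ as a bipartite channel from $A'^nB'^n$ to $A^nB^n$. Then \[ \lim_{\varepsilon\to0^+}\lim_{n\to\infty}\frac1n S^\varepsilon_\infty[A^n|B^n]_{\mathcal{N}^{\otimes n}}\le S(R_AA|R_BB)_{\Phi^{\mathcal N}}-\log|A'|. \] If moreover $\mathcal{N}$ is tele-covariant, then \[ \lim_{\varepsilon\to0^+}\lim_{n\to\infty}\frac1n S^\varepsilon_\infty[A^n|B^n]_{\mathcal{N}^{\otimes n}}\le S[A|B]_{\mathcal N}, \qquad \lim_{n\to\infty}\frac1n S^\varepsilon_\infty[A^n|B^n]_{\mathcal{N}^{\otimes n}}\ge S[A|B]_{\mathcal N}\ \text{ for every }\varepsilon\in(0,1). \]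
   Context: All systems are finite-dimensional; $|X|$ denotes dimension; $\log$ is base 2. $\mathrm{St}(X)$: density operators; $\mathrm{Ch}(X',X)$: quantum channels. Maximally entangled state $\Phi_{RX}:=\frac1d\sum_{i,j}|ii\rangle\langle jj|$, $d=|X|$; Choi state of $\mathcal N\in\mathrm{Ch}(A'B',AB)$: $\Phi^{\mathcal N}_{R_AAR_BB}:=(\mathrm{id}\otimes\mathcal N)(\Phi_{R_AA'}\otimes\Phi_{R_BB'})$. $\mathcal R^{\mathbb 1}_{A'\to A}(X):=\operatorname{tr}(X)\mathbb 1_A$. $D(\rho\|\sigma)=\operatorname{tr}\rho(\log\rho-\log\sigma)$ (quantum relative entropy), $D_\infty(\rho\|\sigma):=\log\inf\{\lambda:\rho\le\lambda\sigma\}$; channel versions $\mathbf D[\mathcal M\|\mathcal M']:=\sup_{\rho\in\mathrm{St}(RX')}\mathbf D((\mathrm{id}_R\otimes\mathcal M)(\rho)\|(\mathrm{id}_R\otimes\mathcal M')(\rho))$. Von Neumann conditional channel entropy: $S[A|B]_{\mathcal N}:=-\inf_{\mathcal Q\in\mathrm{Ch}(B',B)}D[\mathcal N\|\mathcal R^{\mathbb1}_{A'\to A}\otimes\mathcal Q]$. For states, $S(X|Y)_\rho:=S(XY)_\rho-S(Y)_\rho$. Purified distance of channels: $P[\mathcal M_1,\mathcal M_2]:=\sup_{\rho}\sqrt{1-F((\mathrm{id}\otimes\mathcal M_1)(\rho),(\mathrm{id}\otimes\mathcal M_2)(\rho))}$ with $F(\rho,\sigma)=\|\sqrt\rho\sqrt\sigma\|_1^2$.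 Smoothed conditional channel min-entropy: $S^\varepsilon_\infty[A|B]_{\mathcal N}:=-\inf_{\mathcal Q\in\mathrm{Ch}(B',B)}\inf\{D_\infty[\widetilde{\mathcal N}\|\mathcal R^{\mathbb 1}_{A'\to A}\otimes\mathcal Q]:\widetilde{\mathcal N}\in\mathrm{Ch}(A'B',AB),\ P[\mathcal N,\widetilde{\mathcal N}]\le\varepsilon\}$. Tele-covariance: $\mathcal N$ is tele-covariant if there are finite groups $G,H$ and unitary representations $g\mapsto U^{(g)}$ on $A'$, $h\mapsto V^{(h)}$ on $B'$, $(g,h)\mapsto W^{(g,h)}$ on $A$, $(g,h)\mapsto Z^{(g,h)}$ on $B$ such that for all states $\rho_{A'B'}$ and all $g,h$: $\mathcal N((U^{(g)}\otimes V^{(h)})\rho(U^{(g)}\otimes V^{(h)})^\dagger)=(W^{(g,h)}\otimes Z^{(g,h)})\mathcal N(\rho)(W^{(g,h)}\otimes Z^{(g,h)})^\dagger$, and $\frac1{|G|}\sum_g U^{(g)}\rho_{A'}U^{(g)\dagger}=\mathbb 1_{A'}/|A'|$, $\frac1{|H|}\sum_h V^{(h)}\rho_{B'}V^{(h)\dagger}=\mathbb 1_{B'}/|B'|$ for all states $\rho_{A'},\rho_{B'}$. *)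

(* Defs.v *)
From HB Require Import structures.
From mathcomp Require Import all_boot all_order all_algebra all_fingroup.
From mathcomp Require Import complex.
From mathcomp Require Import boolp classical_sets reals ereal exp.
From Stdlib Require Import ClassicalEpsilon.

Set Implicit Arguments.
Unset Strict Implicit.
Unset Printing Implicit Defensive.

Import Order.TTheory GRing.Theory Num.Theory.
Local Open Scope ring_scope.

Section QuantumDefs.
Variable R : realType.
Local Notation C := R[i].
Local Notation "x %:C" := (real_complex R x).

(* An operator on the system with orthonormal basis indexed by I is its matrix. *)
Definition Op (I : finType) := I -> I -> C.

Definition opmul (I : finType) (X Y : Op I) : Op I :=
  fun i j => \sum_(k : I) X i k * Y k j.
Definition opadj (I : finType) (X : Op I) : Op I := fun i j => conjc (X j i).
Definition optr (I : finType) (X : Op I) : C := \sum_(i : I) X i i.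
Definition opid (I : finType) : Op I := fun i j => (i == j)%:R.
Definition opsub (I : finType) (X Y : Op I) : Op I := fun i j => X i j - Y i j.
Definition opscale (I : finType) (c : C) (X : Op I) : Op I := fun i j => c * X i j.
Definition opdiag (I : finType) (l : I -> R) : Op I :=
  fun i j => if i == j then (l i)%:C else 0.
Definition opten (I J : finType) (X : Op I) (Y : Op J) : Op (prod I J) :=
  fun p q => X p.1 q.1 * Y p.2 q.2.
Definition relabel (I J : finType) (f : J -> I) (X : Op I) : Op J :=
  fun j j' => X (f j) (f j').
Definition ptr1 (I J : finType) (X : Op (prod I J)) : Op J :=
  fun j j' => \sum_(i : I) X (i, j) (i, j').
Definition opapp (I : finType) (X : Op I) (v : I -> C) : I -> C :=
  fun i => \sum_(j : I) X i j * v j.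
Definition conjop (I : finType) (U X : Op I) : Op I := opmul U (opmul X (opadj U)).

(* positive semidefinite: <v, X v> >= 0 for all v (in C, "0 <= z" means z real, >= 0) *)
Definition psd (I : finType) (X : Op I) : Prop :=
  forall v : I -> C, 0 <= \sum_(i : I) \sum_(j : I) conjc (v i) * X i j * v j.
Definition ople (I : finType) (X Y : Op I) : Prop := psd (opsub Y X).
Definition is_state (I : finType) (X : Op I) : Prop := psd X /\ optr X = 1.
Definition unitary (I : finType) (U : Op I) : Prop := opmul (opadj U) U = (@opid I).

Definition is_spec (I : finType) (X : Op I) (p : (Op I * (I -> R))%type) : Prop :=
  unitary p.1 /\ X = opmul p.1 (opmul (opdiag p.2) (opadj p.1)).
Definition spec (I : finType) (X : Op I) : (Op I * (I -> R))%type :=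
  epsilon (inhabits ((@opid I), fun _ => 0)) (is_spec X).
(* f(X) for Hermitian X (independent of the chosen decomposition) *)
Definition funm (I : finType) (f : R -> R) (X : Op I) : Op I :=
  let p := spec X in opmul p.1 (opmul (opdiag (f \o p.2)) (opadj p.1)).

Definition log2 (x : R) : R := ln x / ln 2.
Definition logm (I : finType) (X : Op I) : Op I :=
  funm (fun x => if 0 < x then log2 x else 0) X.
Definition sqrtm (I : finType) (X : Op I) : Op I := funm Num.sqrt X.

(* supp X ⊆ supp Y  (for psd X, Y)  <=>  ker Y ⊆ ker X *)
Definition supp_le (I : finType) (X Y : Op I) : Prop :=
  forall v : I -> C, opapp Y v = (fun _ => 0) -> opapp X v = (fun _ => 0).

Definition relent (I : finType) (rho sigma : Op I) : \bar R :=
  if `[< supp_le rho sigma >]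
  then (@complex.Re R (optr (opmul rho (opsub (logm rho) (logm sigma)))))%:E
  else +oo%E.

Definition Dmax (I : finType) (rho sigma : Op I) : \bar R :=
  if `[< exists l : R, ople rho (opscale l%:C sigma) >]
  then (log2 (inf [set l : R | ople rho (opscale l%:C sigma)]))%:E
  else +oo%E.

Definition fidelity (I : finType) (rho sigma : Op I) : R :=
  let Y := opmul (sqrtm rho) (sqrtm sigma) in
  (@complex.Re R (optr (sqrtm (opmul (opadj Y) Y)))) ^+ 2.

Definition vN (I : finType) (rho : Op I) : R := - @complex.Re R (optr (opmul rho (logm rho))).
Definition condS (I J : finType) (rho : Op (prod I J)) : R := vN rho - vN (ptr1 rho).

(* M : Op I -> Op J is represented by K with M(X) j j' = sum_{i,i'} K j j' i i' X i i' *)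
Definition kern (I J : finType) := J -> J -> I -> I -> C.
Definition kapp (I J : finType) (K : kern I J) (X : Op I) : Op J :=
  fun j j' => \sum_(i : I) \sum_(i' : I) K j j' i i' * X i i'.
Definition kext (T I J : finType) (K : kern I J) : kern (prod T I) (prod T J) :=
  fun o o' x x' => ((o.1 == x.1) && (o'.1 == x'.1))%:R * K o.2 o'.2 x.2 x'.2.
Definition ktens (I1 I2 J1 J2 : finType) (K1 : kern I1 J1) (K2 : kern I2 J2)
  : kern (prod I1 I2) (prod J1 J2) :=
  fun o o' x x' => K1 o.1 o'.1 x.1 x'.1 * K2 o.2 o'.2 x.2 x'.2.
Definition is_channel (I J : finType) (K : kern I J) : Prop :=
  (forall (k : nat) (X : Op (prod 'I_k I)), psd X -> psd (kapp (@kext 'I_k _ _ K) X))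
  /\ (forall X : Op I, optr (kapp K X) = optr X).
(* R^1_{I -> J}(X) = tr(X) 1_J *)
Definition Rone (I J : finType) : kern I J :=
  fun o o' x x' => ((o == o') && (x == x'))%:R.
Definition kpow (A' B' A B : finType) (n : nat) (K : kern (prod A' B') (prod A B))
  : kern (prod {ffun 'I_n -> A'} {ffun 'I_n -> B'}) (prod {ffun 'I_n -> A} {ffun 'I_n -> B}) :=
  fun o o' x x' => \prod_(t < n) K (o.1 t, o.2 t) (o'.1 t, o'.2 t) (x.1 t, x.2 t) (x'.1 t, x'.2 t).

Definition chan_div (div : forall T : finType, Op T -> Op T -> \bar R)
  (I J : finType) (M M' : kern I J) : \bar R :=
  ereal_sup [set d | exists (k : nat) (rho : Op (prod 'I_k I)),
     is_state rho /\ d = div _ (kapp (@kext 'I_k _ _ M) rho) (kapp (@kext 'I_k _ _ M') rho)].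

Definition Pdist (I J : finType) (M1 M2 : kern I J) : \bar R :=
  ereal_sup [set d | exists (k : nat) (rho : Op (prod 'I_k I)),
     is_state rho /\
     d = (Num.sqrt (1 - fidelity (kapp (@kext 'I_k _ _ M1) rho) (kapp (@kext 'I_k _ _ M2) rho)))%:E].

Definition condS_ch (A' B' A B : finType) (N : kern (prod A' B') (prod A B)) : \bar R :=
  (- ereal_inf [set d | exists Q : kern B' B,
      is_channel Q /\ d = chan_div relent N (ktens (@Rone A' A) Q)])%E.

Definition Smin_eps (A' B' A B : finType) (eps : R) (N : kern (prod A' B') (prod A B)) : \bar R :=
  (- ereal_inf [set d | exists (Q : kern B' B) (Nt : kern (prod A' B') (prod A B)),
      [/\ is_channel Q, is_channel Nt, (Pdist N Nt <= eps%:E)%E &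
          d = chan_div Dmax Nt (ktens (@Rone A' A) Q)]])%E.

Definition maxent (X : finType) : Op (prod X X) :=
  fun p q => ((p.1 == p.2) && (q.1 == q.2))%:R / #|X|%:R.

(* Choi state Phi^N on (R_A A)(R_B B), with R_A = A', R_B = B' *)
Definition choi (A' B' A B : finType) (N : kern (prod A' B') (prod A B))
  : Op (prod (prod A' A) (prod B' B)) :=
  let Phi0 : Op (prod (prod A' A') (prod B' B')) := opten (@maxent A') (@maxent B') in
  let f : prod (prod A' B') (prod A' B') -> prod (prod A' A') (prod B' B') :=
      fun p => ((p.1.1, p.2.1), (p.1.2, p.2.2)) in
  let g : prod (prod A' A) (prod B' B) -> prod (prod A' B') (prod A B) :=
      fun p => ((p.1.1, p.2.1), (p.1.2, p.2.2)) in
  relabel g (kapp (@kext (prod A' B') _ _ N) (relabel f Phi0)).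

Definition telecov (A' B' A B : finType) (N : kern (prod A' B') (prod A B)) : Prop :=
  exists (gT hT : finGroupType) (U : gT -> Op A') (V : hT -> Op B')
         (W : gT -> hT -> Op A) (Z : gT -> hT -> Op B),
  [/\
      ((forall g, unitary (U g)) /\ U 1%g = (@opid A') /\
        (forall g g', U (g * g')%g = opmul (U g) (U g'))) /\
      ((forall h, unitary (V h)) /\ V 1%g = (@opid B') /\
        (forall h h', V (h * h')%g = opmul (V h) (V h'))),
      (forall g h, unitary (W g h)) /\ W 1%g 1%g = (@opid A) /\
        (forall g g' h h', W (g * g')%g (h * h')%g = opmul (W g h) (W g' h')),
      (forall g h, unitary (Z g h)) /\ Z 1%g 1%g = (@opid B) /\
        (forall g g' h h', Z (g * g')%g (h * h')%g = opmul (Z g h) (Z g' h')),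
      (forall g h (rho : Op (prod A' B')), is_state rho ->
         kapp N (conjop (opten (U g) (V h)) rho)
         = conjop (opten (W g h) (Z g h)) (kapp N rho))
    &
      (forall rho : Op A', is_state rho ->
         (fun i j => #|gT|%:R^-1 * \sum_(g : gT) conjop (U g) rho i j)
         = opscale (#|A'|%:R^-1) ((@opid A'))) /\
      (forall rho : Op B', is_state rho ->
         (fun i j => #|hT|%:R^-1 * \sum_(h : hT) conjop (V h) rho i j)
         = opscale (#|B'|%:R^-1) ((@opid B')))].

End QuantumDefs.

Arguments kpow {R A' B' A B} n K.
Arguments Smin_eps {R A' B' A B} eps N.
Arguments condS_ch {R A' B' A B} N.
Arguments choi {R A' B' A B} N.
Arguments telecov {R A' B' A B} N.
Arguments is_channel {R I J} K.
Arguments condS {R I J} rho.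

(* Main.v *)
(*
Everything reduces to typical projectors.  Let rho be the Choi state of N, rho_Y its marginal on
R_B B, and tau = 1 (x) rho_Y / |A'|, the Choi operator of R^1 (x) Q0 where Q0 has Choi state
rho_Y; then D(rho || tau) = log |A'| - S(R_A A|R_B B).

Upper bound: on the maximally entangled input, the test T built from the typical projectors of
rho^n and rho_Y^n accepts every state that is close to rho^n with constant probability (fidelity
is controlled by the Cauchy-Schwarz inequality), whereas
tr T (1 (x) omega) <= 2^(n (S(R_A A|R_B B) + delta)) tr omega for every omega.

Lower bound: with K the product of the typical projectors of tau^n and rho^n, the operator
K rho^n K^+ is dominated by 2^(n (D + delta)) tau^n.  Tele-covariance makes K rho^n K^+
proportional to the Choi state of a channel, and makes the overlap of its output with that of
N^n independent of the input, so the channel is close to N^n in purified distance.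

Finally S[A|B]_N = - D(rho || tau): the inequality >= in D[N || R^1 (x) Q] is Klein's inequality
at the Choi state, and D(N(X) || (R^1 (x) Q0)(X)) <= D(rho || tau) holds for every input X because
a test separating the n-fold outputs with a better exponent would contradict the domination of
the approximating channel.
*)

(* The first obstacle is that smoothing ranges over channels: an operator near the Choi state helps
   only if its marginal on the input reference is exactly maximally mixed, and closeness must hold
   for all inputs and references at once. This is why [K] is made by functional calculus from
   [rho^n] and [tau^n] alone: it inherits every symmetry common to the two, and for an operator with
   that symmetry the orthogonality relations of the input unitaries force the reference marginal.
   Normalising by the trace [t] then costs a factor of at most 2, which the exponent absorbs.

   The second obstacle is the supremum over inputs in [S[A|B]], for which one would usually invoke
   monotonicity of relative entropy under channels. Comparing two exponents replaces it, so that
   Klein's inequality is the only inequality on operator logarithms proved by calculation.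

   A constant acceptance probability suffices for every test. Hence the upper bound holds at each
   fixed smoothing parameter below 1, and the outer limit is taken with threshold 1. *)
Require Import Defs.
From HB Require Import structures.
From mathcomp Require Import all_boot all_order all_algebra all_fingroup.
From mathcomp Require Import complex spectral sesquilinear.
From mathcomp Require Import boolp classical_sets reals ereal sequences exp.
From mathcomp Require Import ring lra.
From Stdlib Require Import ClassicalEpsilon.
Set Implicit Arguments.
Unset Strict Implicit.
Unset Printing Implicit Defensive.
Import Order.TTheory GRing.Theory Num.Theory.
Local Open Scope ring_scope.

(** * Operators, spectral calculus and fidelity *)

Section MatrixAlgebra.
Variable R : realType.
Local Notation C := R[i].
Local Notation "x %:C" := (real_complex R x).
Implicit Types I J K L : finType.

(** Rectangular, so that column vectors ([J = unit]) and purifications (the factor [S] in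
    [mm S (adj S)]) obey the same algebra as operators. [Op R I] is convertible with [mat I I], as
    are [opmul] and [opadj] with [mm] and [adj]. *)
Definition mat I J := I -> J -> C.
Definition mm I J K (X : mat I J) (Y : mat J K) : mat I K :=
  fun i k => \sum_(j : J) X i j * Y j k.
Definition adj I J (X : mat I J) : mat J I := fun j i => conjc (X i j).
Definition rtr I (X : Op R I) : R := complex.Re (optr X).
Definition msub I J (X Y : mat I J) : mat I J := fun i j => X i j - Y i j.
Definition mscale I J (c : C) (X : mat I J) : mat I J := fun i j => c * X i j.

Lemma matP I J (X Y : mat I J) : (forall i j, X i j = Y i j) -> X = Y.
Proof. by move=> h; apply/funext => i; apply/funext => j. Qed.

Lemma mmA I J K L (X : mat I J) (Y : mat J K) (Z : mat K L) :
  mm X (mm Y Z) = mm (mm X Y) Z.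
Proof.
apply: matP => i l; rewrite /mm.
under eq_bigr => j _ do rewrite mulr_sumr.
rewrite exchange_big /=; apply: eq_bigr => k _; rewrite mulr_suml.
by apply: eq_bigr => j _; rewrite mulrA.
Qed.

Lemma adjM I J K (X : mat I J) (Y : mat J K) : adj (mm X Y) = mm (adj Y) (adj X).
Proof.
apply: matP => i k; rewrite /mm /adj rmorph_sum.
by apply: eq_bigr => j _; rewrite rmorphM mulrC.
Qed.

Lemma adjK I J (X : mat I J) : adj (adj X) = X.
Proof. by apply: matP => i j; rewrite /adj conjcK. Qed.

Lemma optrC I J (X : mat I J) (Y : mat J I) : optr (mm X Y) = optr (mm Y X).
Proof.
rewrite /optr /mm exchange_big; apply: eq_bigr => j _.
by apply: eq_bigr => i _; rewrite mulrC.
Qed.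

Lemma optr_adj I (X : Op R I) : optr (adj X) = conjc (optr X).
Proof. by rewrite /optr rmorph_sum. Qed.

Lemma mm1l I J (X : mat I J) : mm (@opid R I) X = X.
Proof.
apply: matP => i j; rewrite /mm (bigD1 i) //= /opid eqxx mul1r big1 ?addr0 //.
by move=> k; rewrite eq_sym => /negbTE ->; rewrite mul0r.
Qed.

Lemma mm1r I J (X : mat I J) : mm X (@opid R J) = X.
Proof.
apply: matP => i j; rewrite /mm (bigD1 j) //= /opid eqxx mulr1 big1 ?addr0 //.
by move=> k /negbTE ->; rewrite mulr0.
Qed.

Lemma adj_opid I : adj (@opid R I) = @opid R I.
Proof. by apply: matP => i j; rewrite /adj /opid conjc_nat eq_sym. Qed.

Lemma mmBl I J K (X Y : mat I J) (Z : mat J K) :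
  mm (msub X Y) Z = msub (mm X Z) (mm Y Z).
Proof.
apply: matP => i k; rewrite /mm /msub -sumrB.
by apply: eq_bigr => j _; rewrite mulrBl.
Qed.

Lemma mmBr I J K (X Y : mat J K) (Z : mat I J) :
  mm Z (msub X Y) = msub (mm Z X) (mm Z Y).
Proof.
apply: matP => i k; rewrite /mm /msub -sumrB.
by apply: eq_bigr => j _; rewrite mulrBr.
Qed.

Lemma mmZl I J K (c : C) (X : mat I J) (Z : mat J K) :
  mm (mscale c X) Z = mscale c (mm X Z).
Proof.
apply: matP => i k; rewrite /mm /mscale mulr_sumr.
by apply: eq_bigr => j _; rewrite mulrA.
Qed.

Lemma mmZr I J K (c : C) (X : mat J K) (Z : mat I J) :
  mm Z (mscale c X) = mscale c (mm Z X).
Proof.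
apply: matP => i k; rewrite /mm /mscale mulr_sumr.
by apply: eq_bigr => j _; rewrite mulrCA.
Qed.

Lemma adjB I J (X Y : mat I J) : adj (msub X Y) = msub (adj X) (adj Y).
Proof. by apply: matP => i j; rewrite /adj /msub rmorphB. Qed.

Lemma adjZ I J (c : C) (X : mat I J) : adj (mscale c X) = mscale (conjc c) (adj X).
Proof. by apply: matP => i j; rewrite /adj /mscale rmorphM. Qed.

Lemma mscaleA I J (a b : C) (X : mat I J) : mscale a (mscale b X) = mscale (a * b) X.
Proof. by apply: matP => i j; rewrite /mscale mulrA. Qed.

Lemma mscale1 I J (X : mat I J) : mscale 1 X = X.
Proof. by apply: matP => i j; rewrite /mscale mul1r. Qed.

Lemma ReD (x y : C) : complex.Re (x + y) = complex.Re x + complex.Re y.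
Proof. by case: x; case: y. Qed.
Lemma ReB (x y : C) : complex.Re (x - y) = complex.Re x - complex.Re y.
Proof. by case: x; case: y. Qed.
Lemma Re_conj (x : C) : complex.Re (conjc x) = complex.Re x.
Proof. by case: x. Qed.
Lemma ReZ (x : R) (y : C) : complex.Re (x%:C * y) = x * complex.Re y.
Proof. by case: y => a b /=; rewrite mul0r subr0. Qed.
Lemma Re_sum I (P : pred I) (F : I -> C) :
  complex.Re (\sum_(i | P i) F i) = \sum_(i | P i) complex.Re (F i).
Proof. by apply: (big_morph _ ReD). Qed.
Lemma Re_ge0 (x : C) : 0 <= x -> 0 <= complex.Re x.
Proof. by rewrite lecE => /andP[]. Qed.
Lemma ge0_ReE (x : C) : 0 <= x -> x = (complex.Re x)%:C.
Proof. by move=> h; rewrite RRe_real // ger0_real. Qed.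
Lemma rtrC I J (X : mat I J) (Y : mat J I) : rtr (mm X Y) = rtr (mm Y X).
Proof. by rewrite /rtr optrC. Qed.
Lemma rtr_adj I (X : Op R I) : rtr (adj X) = rtr X.
Proof. by rewrite /rtr optr_adj Re_conj. Qed.
Lemma optrB I (X Y : Op R I) : optr (msub X Y) = optr X - optr Y.
Proof. by rewrite /optr /msub sumrB. Qed.
Lemma optrZ I (c : C) (X : Op R I) : optr (mscale c X) = c * optr X.
Proof. by rewrite /optr /mscale mulr_sumr. Qed.
Lemma rtrB I (X Y : Op R I) : rtr (msub X Y) = rtr X - rtr Y.
Proof. by rewrite /rtr optrB ReB. Qed.
Lemma rtrZ I (c : R) (X : Op R I) : rtr (mscale c%:C X) = c * rtr X.
Proof. by rewrite /rtr optrZ ReZ. Qed.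

(** The squared Hilbert-Schmidt norm. *)
Definition hs I J (X : mat I J) : R := rtr (mm (adj X) X).

Lemma hsE I J (X : mat I J) :
  hs X = \sum_j \sum_i (complex.Re (X i j) ^+ 2 + complex.Im (X i j) ^+ 2).
Proof.
rewrite /hs /rtr /optr Re_sum; apply: eq_bigr => j _; rewrite /mm Re_sum.
by apply: eq_bigr => i _; rewrite /adj; case: (X i j) => a b /=; rewrite -!expr2; ring.
Qed.

Lemma hs_ge0 I J (X : mat I J) : 0 <= hs X.
Proof.
rewrite hsE; apply: sumr_ge0 => j _; apply: sumr_ge0 => i _.
by rewrite addr_ge0 ?sqr_ge0.
Qed.

Lemma hs_eq0 I J (X : mat I J) : hs X = 0 -> X = fun _ _ => 0.
Proof.
rewrite hsE => /eqP h; apply: matP => i j.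
have p j' i' : 0 <= complex.Re (X i' j') ^+ 2 + complex.Im (X i' j') ^+ 2.
  by rewrite addr_ge0 ?sqr_ge0.
move: h; rewrite psumr_eq0 => [/allP /(_ j)|j' _]; last exact: sumr_ge0.
rewrite mem_index_enum => /(_ isT) /=; rewrite psumr_eq0 // => /allP /(_ i).
rewrite mem_index_enum => /(_ isT) /=; rewrite paddr_eq0 ?sqr_ge0 // !sqrf_eq0.
by case: (X i j) => a b /= /andP[/eqP -> /eqP ->].
Qed.

Lemma hs_adj I J (X : mat I J) : hs (adj X) = hs X.
Proof. by rewrite /hs adjK rtrC. Qed.

(* Expand [0 <= hs (x X - Y)]. *)
Lemma hs_amgm I J (x : R) (X Y : mat I J) :
  2 * x * rtr (mm (adj X) Y) <= x ^+ 2 * hs X + hs Y.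
Proof.
have h := hs_ge0 (msub (mscale x%:C X) Y); rewrite -subr_ge0; apply: le_trans h _.
rewrite /hs !(adjB, mmBl, mmBr, adjZ, mmZl, mmZr, rtrB, conjc_real, rtrZ).
have -> : rtr (mm (adj Y) X) = rtr (mm (adj X) Y).
  by rewrite -rtr_adj adjM adjK.
lra.
Qed.

Definition qf I (X : Op R I) (v : I -> C) : C :=
  \sum_(i : I) \sum_(j : I) conjc (v i) * X i j * v j.

Definition sesq I (X : Op R I) (u v : I -> C) : C :=
  \sum_(i : I) \sum_(j : I) conjc (u i) * X i j * v j.

Lemma sesqDl I (X : Op R I) u u' v :
  sesq X (fun i => u i + u' i) v = sesq X u v + sesq X u' v.
Proof.
rewrite /sesq -big_split; apply: eq_bigr => i _ /=; rewrite -big_split.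
by apply: eq_bigr => j _; rewrite rmorphD /= !mulrDl.
Qed.

Lemma sesqDr I (X : Op R I) u v v' :
  sesq X u (fun i => v i + v' i) = sesq X u v + sesq X u v'.
Proof.
rewrite /sesq -big_split; apply: eq_bigr => i _ /=; rewrite -big_split.
by apply: eq_bigr => j _; rewrite /= !mulrDr.
Qed.

Lemma sesq_delta I (X : Op R I) (a b : C) i j :
  sesq X (fun k => a * (k == i)%:R) (fun k => b * (k == j)%:R) = conjc a * X i j * b.
Proof.
rewrite /sesq (bigD1 i) //= [X in _ + X]big1 => [|k /negbTE ki].
  rewrite addr0 (bigD1 j) //= big1 => [|k /negbTE kj].
    by rewrite !eqxx !mulr1 addr0.
  by rewrite kj !mulr0.
by apply: big1 => l _; rewrite ki mulr0 conjc0 !mul0r.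
Qed.

(** Polarisation: basis vectors give the diagonal, and the vectors [e_i + b e_j] with [b = 1] and
    [b = i] separate [X i j] from [X j i]. *)
Lemma qf_eq0 I (X : Op R I) : (forall v, qf X v = 0) -> X = fun _ _ => 0.
Proof.
move=> h; apply: matP => i j.
have e1 k : X k k = 0.
  have := h (fun l => 1 * (l == k)%:R).
  by rewrite /qf -/(sesq _ _ _) sesq_delta conjc1 mul1r mulr1.
have e2 (b : C) : X i j * b + conjc b * X j i = 0.
  have := h (fun l => 1 * (l == i)%:R + b * (l == j)%:R).
  rewrite /qf -/(sesq _ _ _) sesqDl !sesqDr !sesq_delta !e1 conjc1.
  by rewrite !mulr0 !mul0r add0r addr0 mul1r mulr1.
have := e2 1; have := e2 'i%C; rewrite conjc1 mulr1 mul1r.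
have -> : conjc 'i%C = - 'i%C :> C by apply/eqP; rewrite eq_complex /= oppr0 !eqxx.
rewrite mulNr mulrC -mulrBr => /eqP; rewrite mulf_eq0 => /orP[|/eqP e3 e4].
  by rewrite eq_complex /= oner_eq0 andbF.
have : X i j *+ 2 = 0 by rewrite mulr2n -{1}[X i j](subrK (X j i)) e3 add0r addrC.
by move/eqP; rewrite mulrn_eq0 /= => /eqP.
Qed.

(** Positivity in [C] includes being real, so the quadratic form of [adj X - X] vanishes and
    polarisation applies. *)
Lemma psd_herm I (X : Op R I) : psd X -> adj X = X.
Proof.
move=> pX; apply: matP => i j; apply/eqP; rewrite -subr_eq0; apply/eqP.
rewrite -/(msub (adj X) X i j).
suff -> : msub (adj X) X = fun _ _ => 0 by [].
apply: qf_eq0 => v.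
have -> : qf (msub (adj X) X) v = qf (adj X) v - qf X v.
  rewrite /qf -sumrB; apply: eq_bigr => k _; rewrite -sumrB.
  by apply: eq_bigr => l _; rewrite /msub mulrBr mulrBl.
have -> : qf (adj X) v = conjc (qf X v).
  rewrite /qf rmorph_sum exchange_big; apply: eq_bigr => k _.
  rewrite rmorph_sum; apply: eq_bigr => l _.
  rewrite !rmorphM /= conjcK /adj; ring.
have e : qf X v = (complex.Re (qf X v))%:C := ge0_ReE (pX v).
by rewrite e conjc_real subrr.
Qed.

Lemma psd_gram I J (S : mat I J) : psd (mm S (adj S)).
Proof.
move=> v.
have -> : \sum_i \sum_j conjc (v i) * mm S (adj S) i j * v j =
   \sum_k (\sum_i conjc (v i) * S i k) * conjc (\sum_i conjc (v i) * S i k).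
  transitivity (\sum_i \sum_j \sum_k (conjc (v i) * S i k) * (conjc (S j k) * v j)).
    apply: eq_bigr => i _; apply: eq_bigr => j _.
    by rewrite /mm mulr_sumr mulr_suml; apply: eq_bigr => k _; rewrite /adj !mulrA.
  under eq_bigr => i _ do rewrite exchange_big.
  rewrite exchange_big; apply: eq_bigr => k _ /=.
  rewrite rmorph_sum mulr_suml; apply: eq_bigr => i _; rewrite mulr_sumr.
  by apply: eq_bigr => j _; rewrite rmorphM /= conjcK [_ * v j]mulrC.
by apply: sumr_ge0 => k _; apply: mulcJ_ge0.
Qed.

(** The passage to ordinal-indexed matrices, made for two facts only: a left inverse of a square
    matrix is a right inverse, and the spectral theorem. *)
Definition tomx I J (X : mat I J) : 'M[C]_(#|I|, #|J|) :=
  \matrix_(i, j) X (enum_val i) (enum_val j).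
Definition ofmx I J (X : 'M[C]_(#|I|, #|J|)) : mat I J :=
  fun i j => X (enum_rank i) (enum_rank j).

Lemma tomxK I J (X : mat I J) : ofmx (tomx X) = X.
Proof. by apply: matP => i j; rewrite /ofmx mxE !enum_rankK. Qed.

Lemma sum_enum_val I (V : zmodType) (F : I -> V) :
  \sum_(i < #|I|) F (enum_val i) = \sum_i F i.
Proof.
rewrite (reindex_onto (@enum_rank I) (@enum_val _ _)) /=.
  by apply: eq_big => [i|i _]; rewrite enum_rankK ?eqxx.
by move=> i _; rewrite enum_valK.
Qed.

Lemma tomxM I J K (X : mat I J) (Y : mat J K) : tomx (mm X Y) = tomx X *m tomx Y.
Proof.
apply/matrixP => i k; rewrite !mxE /mm -sum_enum_val.
by apply: eq_bigr => j _; rewrite !mxE.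
Qed.

Lemma tomx1 I : tomx (@opid R I) = 1%:M.
Proof. by apply/matrixP => i j; rewrite !mxE /opid (inj_eq enum_val_inj). Qed.

Lemma tomx_inj I J : injective (@tomx I J).
Proof. exact: can_inj (@tomxK I J). Qed.

Lemma unitaryl I (U : Op R I) : unitary U -> mm (adj U) U = @opid R I.
Proof. by []. Qed.

Lemma unitaryr I (U : Op R I) : unitary U -> mm U (adj U) = @opid R I.
Proof.
move/unitaryl => h; apply: tomx_inj; rewrite tomxM tomx1; apply: mulmx1C.
by rewrite -tomxM h tomx1.
Qed.

Lemma conj_complexE (x : C) : Num.conj x = conjc x.
Proof. by []. Qed.

Definition sd I (V : Op R I) (l : I -> R) : Op R I := mm V (mm (opdiag l) (adj V)).

Lemma herm_sd I (X : Op R I) : adj X = X ->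
  exists V l, unitary V /\ X = sd V l.
Proof.
move=> hX; set A := tomx X.
have trA J (Y : mat J I) : tomx (adj Y) = (map_mx Num.conj (tomx Y))^T.
  by apply/matrixP => i j; rewrite !mxE conj_complexE.
have hA : A \is hermsymmx.
  apply/is_hermitianmxP; rewrite expr0 scale1r.
  by rewrite -map_trmx -trA hX.
have /hermitian_normalmx /orthomx_spectralP := hA.
rewrite invmx_unitary ?spectral_unitarymx // => eA.
have /mxOverP hr := hermitian_spectral_diag_real hA.
set P := spectralmx A in eA *.
have /unitarymxP uP := spectral_unitarymx A; rewrite -/P in uP.
set V := ofmx (map_mx Num.conj P)^T.
set l := fun i => complex.Re (spectral_diag A 0 (enum_rank i)).
have eV : tomx V = (map_mx Num.conj P)^T.
  by apply/matrixP => i j; rewrite !mxE /V /ofmx !enum_valK !mxE.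
have eV' : tomx (adj V) = P.
  by rewrite trA eV map_trmx trmxK -map_mx_comp; apply: map_mx_id => x; rewrite /= conjCK.
have el : tomx (opdiag l) = diag_mx (spectral_diag A).
  apply/matrixP => i j; rewrite !mxE /opdiag (inj_eq enum_val_inj) /l enum_valK.
  by case: eqP => [->|//]; rewrite mulr1n RRe_real.
exists V, l; split; apply: tomx_inj.
  by rewrite tomxM eV' eV tomx1 map_trmx.
by rewrite /sd !tomxM eV' eV el mulmxA map_trmx -eA.
Qed.
End MatrixAlgebra.

(** * Functional calculus, contractions, polar decomposition and fidelity *)

Section Spectral.
Variable R : realType.
Local Notation C := R[i].
Local Notation "x %:C" := (real_complex R x).
Implicit Types I J K L E : finType.

Lemma mm_diagl I J (l : I -> R) (X : mat R I J) i j : mm (opdiag l) X i j = (l i)%:C * X i j.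
Proof.
rewrite /mm (bigD1 i) //= /opdiag eqxx big1 ?addr0 // => k.
by rewrite eq_sym => /negbTE ->; rewrite mul0r.
Qed.

Lemma mm_diagr I J (l : J -> R) (X : mat R I J) i j : mm X (opdiag l) i j = X i j * (l j)%:C.
Proof.
rewrite /mm (bigD1 j) //= /opdiag eqxx big1 ?addr0 // => k.
by move=> /negbTE ->; rewrite mulr0.
Qed.

Lemma adj_diag I (l : I -> R) : adj (opdiag l) = opdiag l.
Proof.
apply: matP => i j; rewrite /adj /opdiag eq_sym.
by case: eqP => [->|_]; rewrite ?conjc_real ?conjc0.
Qed.

Lemma adj_sd I V (l : I -> R) : adj (sd V l) = sd V l.
Proof. by rewrite /sd !adjM adjK adj_diag mmA. Qed.

Lemma sdM I V (l l' : I -> R) : unitary V ->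
  mm (sd V l) (sd V l') = sd V (fun i => l i * l' i).
Proof.
move=> uV; rewrite /sd -!mmA (mmA _ V) (unitaryl uV) mm1l (mmA (opdiag l)).
congr (mm V (mm _ _)); apply: matP => i j; rewrite mm_diagl /opdiag.
by case: eqP => [->|_]; rewrite ?mulr0 ?rmorphM.
Qed.

Lemma sd1 I (V : Op R I) : unitary V -> sd V (fun=> 1) = @opid R I.
Proof.
move=> uV; rewrite /sd -(unitaryr uV); congr mm.
by apply: matP => i j; rewrite mm_diagl mul1r.
Qed.

Lemma sdB I V (l l' : I -> R) : msub (sd V l) (sd V l') = sd V (fun i => l i - l' i).
Proof.
rewrite /sd -mmBr -mmBl; congr (mm V (mm _ _)).
apply: matP => i j; rewrite /msub /opdiag; case: eqP; rewrite ?subr0 //.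
by rewrite rmorphB.
Qed.

Lemma sdZ I V (c : R) (l : I -> R) : mscale c%:C (sd V l) = sd V (fun i => c * l i).
Proof.
rewrite /sd -mmZr -mmZl; congr (mm V (mm _ _)).
by apply: matP => i j; rewrite /mscale /opdiag; case: eqP; rewrite ?mulr0 ?rmorphM.
Qed.

(** In the two eigenbases the hypothesis reads [(l i - a j) * G i j = 0], so wherever [G i j] is
    nonzero [f (l i) = f (a j)]. With [M] the identity this shows that [funm] does not depend on the
    chosen decomposition; with [V = U] and [l = a] it gives commutation with functions of an
    operator. *)
Lemma sd_intertwine I J (V : Op R I) (U : Op R J) (M : mat R I J) l a (f : R -> R) :
  unitary V -> unitary U -> mm (sd V l) M = mm M (sd U a) ->
  mm (sd V (f \o l)) M = mm M (sd U (f \o a)).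
Proof.
move=> uV uU e; set G := mm (adj V) (mm M U).
have eG : mm (opdiag l) G = mm G (opdiag a).
  rewrite /G; have := congr1 (fun Z => mm (adj V) (mm Z U)) e.
  rewrite /sd -!mmA (mmA (adj V) V) (unitaryl uV) mm1l (unitaryl uU) mm1r.
  by rewrite !mmA.
have {}eG : mm (opdiag (f \o l)) G = mm G (opdiag (f \o a)).
  apply: matP => i j; have := congr1 (fun Z => Z i j) eG.
  rewrite !mm_diagl !mm_diagr => /eqP; rewrite mulrC -subr_eq0 -mulrBr mulf_eq0.
  case/orP => [/eqP -> |]; first by rewrite mul0r mulr0.
  by rewrite subr_eq0 => /eqP/complexI /= ->; rewrite mulrC.
have eM : M = mm V (mm G (adj U)).
  by rewrite /G -!mmA (unitaryr uU) mm1r mmA (unitaryr uV) mm1l.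
clearbody G; rewrite eM /sd -!mmA (mmA _ V) (unitaryl uV) mm1l (mmA (adj U) U) (unitaryl uU) mm1l.
by rewrite (mmA (opdiag (f \o l))) eG !mmA.
Qed.

Lemma specP I (X : Op R I) : adj X = X ->
  unitary (spec X).1 /\ X = sd (spec X).1 (spec X).2.
Proof.
move=> /herm_sd[V [l h]].
exact: (@epsilon_spec _ _ (is_spec X) (ex_intro _ (V, l) h)).
Qed.

Lemma funmE I (X V : Op R I) l f : unitary V -> X = sd V l -> funm f X = sd V (f \o l).
Proof.
move=> uV eX; have [|uS eS] := @specP I X; first by rewrite eX adj_sd.
rewrite /funm; move: (spec X).1 (spec X).2 uS eS => U a uS eS.
have := @sd_intertwine I I U V (@opid R I) a l f uS uV.
by rewrite !mm1l !mm1r; apply; rewrite -eS.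
Qed.

Lemma funm_comm I (X G : Op R I) f : adj X = X -> mm X G = mm G X ->
  mm (funm f X) G = mm G (funm f X).
Proof.
move=> /herm_sd[V [l [uV ->]]] e; rewrite (funmE f uV erefl).
exact: sd_intertwine.
Qed.

Lemma psd_sd I V (l : I -> R) : (forall i, 0 <= l i) -> psd (sd V l).
Proof.
move=> l0; suff -> : sd V l = mm (mm V (opdiag (Num.sqrt \o l)))
     (adj (mm V (opdiag (Num.sqrt \o l)))) by apply: psd_gram.
rewrite adjM adj_diag -!mmA /sd; congr mm; rewrite mmA; congr mm.
apply: matP => i j; rewrite mm_diagl /opdiag; case: eqP => [->|]; rewrite ?mulr0 //=.
by rewrite -rmorphM -expr2 sqr_sqrtr.
Qed.

Lemma qfE I (X : Op R I) v :
  qf X v = mm (fun (_ : unit) i => conjc (v i)) (mm X (fun i (_ : unit) => v i)) tt tt.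
Proof.
apply: eq_bigr => i _; rewrite /mm mulr_sumr; apply: eq_bigr => j _.
by rewrite mulrA.
Qed.

Lemma mm_psd_diag I J (X : Op R I) (V : mat R I J) j : psd X ->
  0 <= mm (adj V) (mm X V) j j.
Proof. by move=> pX; have := pX (fun i => V i j); rewrite -/(qf X _) qfE. Qed.

Lemma sd_ge0 I (V : Op R I) l : unitary V -> psd (sd V l) -> forall i, 0 <= l i.
Proof.
move=> uV p i; have := mm_psd_diag V i p.
rewrite /sd -!mmA (unitaryl uV) mm1r mmA (unitaryl uV) mm1l /opdiag eqxx.
by rewrite lecR.
Qed.

Lemma psd_spectral I (X : Op R I) : psd X ->
  exists V l, [/\ unitary V, forall i, 0 <= l i & X = sd V l].
Proof.
move=> p; have [V [l [uV e]]] := herm_sd (psd_herm p).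
by exists V, l; split=> //; apply: (sd_ge0 uV); rewrite -e.
Qed.

Lemma psdP I (X : Op R I) : psd X -> exists S : Op R I, X = mm S (adj S).
Proof.
move=> /psd_spectral[V [l [uV l0 ->]]]; exists (sd V (Num.sqrt \o l)).
rewrite adj_sd sdM //; congr sd; apply/funext => i /=.
by rewrite -expr2 sqr_sqrtr.
Qed.

Lemma psd_congr I J (X : Op R I) (B : mat R J I) : psd X -> psd (mm B (mm X (adj B))).
Proof. by case/psdP => S ->; rewrite -mmA mmA -adjM; apply: psd_gram. Qed.

Lemma psd1 I : psd (@opid R I).
Proof. by rewrite -[@opid R I]mm1l -{2}adj_opid; apply: psd_gram. Qed.

Lemma qfD I (X Y : Op R I) v : qf (fun i j => X i j + Y i j) v = qf X v + qf Y v.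
Proof.
rewrite /qf -big_split; apply: eq_bigr => i _; rewrite -big_split.
by apply: eq_bigr => j _ /=; rewrite mulrDr mulrDl.
Qed.

Lemma psdD I (X Y : Op R I) : psd X -> psd Y -> psd (fun i j => X i j + Y i j).
Proof. by move=> pX pY v; rewrite -/(qf _ v) qfD addr_ge0 ?pX ?pY. Qed.

Lemma psdZ I (X : Op R I) (c : R) : 0 <= c -> psd X -> psd (mscale c%:C X).
Proof.
move=> c0 pX v; rewrite -/(qf _ v).
have -> : qf (mscale c%:C X) v = c%:C * qf X v.
  rewrite /qf mulr_sumr; apply: eq_bigr => i _; rewrite mulr_sumr.
  by apply: eq_bigr => j _; rewrite /mscale; ring.
by rewrite mulr_ge0 ?ler0c ?pX.
Qed.

Lemma ople_trans I (Y X Z : Op R I) : ople X Y -> ople Y Z -> ople X Z.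
Proof.
move=> h h'; have := psdD h h'; rewrite /ople; congr psd.
by apply: matP => i j; rewrite /opsub; ring.
Qed.

Lemma ople_congr I J (X Y : Op R I) (B : mat R J I) : ople X Y ->
  ople (mm B (mm X (adj B))) (mm B (mm Y (adj B))).
Proof. by move=> /(psd_congr B); rewrite mmBl mmBr. Qed.

Lemma opleZ I (X Y : Op R I) (c : R) : 0 <= c -> ople X Y ->
  ople (mscale c%:C X) (mscale c%:C Y).
Proof.
move=> c0 /(psdZ c0); congr psd.
by apply: matP => i j; rewrite /opsub /mscale mulrBr.
Qed.

Lemma psd_optr_ge0 I (X : Op R I) : psd X -> 0 <= optr X.
Proof.
move=> p; apply: sumr_ge0 => i _; have := mm_psd_diag (@opid R I) i p.
by rewrite adj_opid mm1l mm1r.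
Qed.

Lemma psd_rtr_ge0 I (X : Op R I) : psd X -> 0 <= rtr X.
Proof. by move/psd_optr_ge0/Re_ge0. Qed.

Lemma psd_optrE I (X : Op R I) : psd X -> optr X = (rtr X)%:C.
Proof. by move/psd_optr_ge0/ge0_ReE. Qed.

Lemma rtr_mm_ge0 I (X Y : Op R I) : psd X -> psd Y -> 0 <= rtr (mm X Y).
Proof.
move=> pX /psdP[S ->]; rewrite mmA rtrC -[X in mm _ (mm X S)]adjK.
by rewrite -{2}[S]adjK; apply/psd_rtr_ge0; rewrite adjK; apply: psd_congr.
Qed.

Lemma rtr_ople I (X Y T : Op R I) : ople X Y -> psd T ->
  rtr (mm X T) <= rtr (mm Y T).
Proof. by move=> h /(rtr_mm_ge0 h); rewrite mmBl rtrB subr_ge0. Qed.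

(** For a state [M] this is the probability of outcome [j] when measuring in the basis of columns of
    [V]. *)
Definition dg I (V M : Op R I) j : R := complex.Re (mm (adj V) (mm M V) j j).

Lemma rtr_sd I (V M : Op R I) l : rtr (mm (sd V l) M) = \sum_j l j * dg V M j.
Proof.
rewrite /sd -!mmA rtrC -mmA /rtr /optr -!mmA Re_sum; apply: eq_bigr => j _.
by rewrite mm_diagl ReZ.
Qed.

Lemma sum_dg I (V M : Op R I) : unitary V -> \sum_j dg V M j = rtr M.
Proof.
move=> uV; have := rtr_sd V M (fun=> 1); rewrite sd1 // mm1l => ->.
by apply: eq_bigr => j _; rewrite mul1r.
Qed.

Lemma rtr_sd_sum I (V : Op R I) (l : I -> R) : unitary V -> rtr (sd V l) = \sum_i l i.
Proof.
move=> uV; rewrite -[sd V l]mm1r rtr_sd; apply: eq_bigr => i _.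
by rewrite /dg mm1l (unitaryl uV) /opid eqxx mulr1.
Qed.

Lemma supp_eigen I (X V : Op R I) (q : I -> R) i : unitary V -> supp_le X (sd V q) ->
  q i = 0 -> forall j, mm X V j i = 0.
Proof.
move=> uV supp qi j.
have e : opapp (sd V q) (fun k => V k i) = fun _ => 0.
  apply/funext => k; rewrite -[LHS]/(mm (sd V q) V k i) /sd -!mmA (unitaryl uV) mm1r.
  by rewrite mm_diagr qi mulr0.
exact: (congr1 (fun u => u j) (supp _ e)).
Qed.

Lemma dg_ge0 I (V M : Op R I) j : psd M -> 0 <= dg V M j.
Proof. by move=> /(mm_psd_diag V j)/Re_ge0. Qed.

(** Equivalent to operator norm at most 1; stated with an arbitrary right factor, it composes at
    once and applies to purifications. *)
Definition contr I J (B : mat R I J) := forall K (X : mat R J K), hs (mm B X) <= hs X.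

Lemma contrM I J K (A : mat R I J) (B : mat R J K) : contr A -> contr B -> contr (mm A B).
Proof. by move=> cA cB L X; rewrite -mmA; apply: le_trans (cA _ _) (cB _ _). Qed.

(** AM-GM for [X] and [B B^+ X] gives [2 hs (B^+ X) <= hs X + hs (B B^+ X)], and the last term is at
    most [hs (B^+ X)]. *)
Lemma contr_adj I J (B : mat R I J) : contr B -> contr (adj B).
Proof.
move=> cB K X; have := hs_amgm 1 X (mm B (mm (adj B) X)).
have := cB _ (mm (adj B) X).
have -> : rtr (mm (adj X) (mm B (mm (adj B) X))) = hs (mm (adj B) X).
  by rewrite /hs adjM adjK !mmA.
rewrite expr1n; lra.
Qed.

Lemma contr_unitary I (V : Op R I) : unitary V -> contr V.
Proof. by move=> uV K X; rewrite /hs adjM -mmA (mmA _ V) (unitaryl uV) mm1l. Qed.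

Lemma contr_diag I (B : Op R I) j : contr B -> complex.Re (B j j) <= 1.
Proof.
move=> cB; pose e : mat R I unit := fun i _ => (i == j)%:R.
have hse : hs e = 1.
  rewrite /hs /rtr /optr (bigD1 tt) //= big1 ?addr0; last by case.
  rewrite /mm (bigD1 j) //= /adj /e eqxx conjc1 mul1r big1 ?addr0 // => i /negbTE ->.
  by rewrite mulr0.
have := hs_amgm 1 e (mm B e); have := cB _ e; rewrite hse.
have -> : rtr (mm (adj e) (mm B e)) = complex.Re (B j j).
  rewrite /rtr /optr (bigD1 tt) //= big1 ?addr0; last by case.
  rewrite {1}/mm (bigD1 j) //= /adj /e eqxx conjc1 mul1r big1 ?addr0; last first.
    by move=> i /negbTE ->; rewrite conjc0 mul0r.
  rewrite /mm (bigD1 j) //= eqxx mulr1 big1 ?addr0 // => i /negbTE ->.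
  by rewrite mulr0.
rewrite expr1n; lra.
Qed.

Lemma rtr_contr I (B P : Op R I) : contr B -> psd P -> rtr (mm B P) <= rtr P.
Proof.
move=> cB /psd_spectral[V [l [uV l0 ->]]].
rewrite rtrC rtr_sd -[X in _ <= rtr X]mm1r rtr_sd; apply: ler_sum => j _.
apply: ler_wpM2l; first exact: l0.
have -> : dg V (@opid R I) j = 1 by rewrite /dg mm1l (unitaryl uV) /opid eqxx.
apply: contr_diag; apply: contrM; last apply: contrM => //.
  exact/contr_adj/contr_unitary.
exact: contr_unitary.
Qed.

Lemma polar I E (M : mat R I E) (P : Op R I) : psd P -> mm M (adj M) = mm P P ->
  exists U : mat R I E, [/\ M = mm P U, mm U (adj M) = P & contr U].
Proof.
move=> /psd_spectral[V [p [uV p0 ->]]] e; rewrite sdM // in e.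
(* Since [0^-1 = 0], [Q] is the pseudo-inverse of [sd V p] and [s] is the indicator of its support.
   The polar factor is [Q M]. *)
pose Q := sd V (fun i => (p i)^-1); pose s i : R := p i * (p i)^-1.
have e1 : mm Q (mm M (adj M)) = sd V p.
  rewrite e sdM //; congr sd; apply/funext => i.
  by have [->|h] := eqVneq (p i) 0; rewrite ?invr0 ?mul0r ?mulr0 // mulKf.
have sE i : s i = 1 \/ s i = 0 /\ p i = 0.
  by rewrite /s; have [->|h] := eqVneq (p i) 0; [right; rewrite mul0r|left; rewrite mulfV].
have eU : mm (mm Q M) (adj (mm Q M)) = sd V s.
  by rewrite adjM adj_sd mmA -(mmA Q) e1 sdM.
exists (mm Q M); split; last 1 first.
- rewrite -[mm Q M]adjK; apply: contr_adj => K X.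
  rewrite /hs adjM adjK -mmA (mmA (mm Q M)) eU rtrC -mmA rtr_sd.
  rewrite [X in _ <= X]rtrC -(sum_dg _ uV); apply: ler_sum => j _.
  have := dg_ge0 V j (psd_gram X); case: (sE j) => [->|[-> _]].
    by rewrite mul1r.
  by rewrite mul0r.
- rewrite mmA /Q sdM // -/s.
  (* [B] is the part of [M] outside the support; its squared norm is the trace of [(1 - s) p^2],
     which is 0. *)
  pose B := mm (msub (@opid R I) (sd V s)) M.
  have -> : mm (sd V s) M = msub M B.
    rewrite /B mmBl mm1l; apply: matP => i j; rewrite /msub; ring.
  have -> : B = fun _ _ => 0.
    apply: hs_eq0; rewrite -hs_adj /hs adjK /B adjM adjB adj_opid adj_sd -mmA (mmA M) e.
    rewrite -(sd1 uV) !sdB sdM // sdM // -[sd _ _]mm1r rtr_sd big1 // => i _.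
    by case: (sE i) => [->|[-> ->]]; rewrite ?(subrr, mul0r, mulr0).
  by apply: matP => i j; rewrite /msub subr0.
- by rewrite -mmA e1.
Qed.

Lemma psd_gram_adj I J (S : mat R I J) : psd (mm (adj S) S).
Proof. by have := psd_gram (adj S); rewrite adjK. Qed.

Lemma sqrtm_psd I (X : Op R I) : psd X -> psd (sqrtm X).
Proof.
move=> /psd_spectral[V [l [uV l0 eX]]]; rewrite /sqrtm (funmE _ uV eX).
by apply: psd_sd => i; apply: sqrtr_ge0.
Qed.

Lemma sqrtm_sqr I (X : Op R I) : psd X -> mm (sqrtm X) (sqrtm X) = X.
Proof.
move=> /psd_spectral[V [l [uV l0 eX]]]; rewrite /sqrtm (funmE _ uV eX) sdM // eX.
by congr sd; apply/funext => i; rewrite /= -expr2 sqr_sqrtr.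
Qed.

Definition root_fidelity I (rho sigma : Op R I) : R :=
  let Y := mm (sqrtm rho) (sqrtm sigma) in rtr (sqrtm (mm (adj Y) Y)).

Lemma fidelityE I (rho sigma : Op R I) : fidelity rho sigma = root_fidelity rho sigma ^+ 2.
Proof. by []. Qed.

Lemma root_fidelity_ge0 I (rho sigma : Op R I) : 0 <= root_fidelity rho sigma.
Proof. exact/psd_rtr_ge0/sqrtm_psd/psd_gram_adj. Qed.

Lemma abs_polar I (Y : Op R I) : exists U : Op R I,
  [/\ Y = mm U (sqrtm (mm (adj Y) Y)), mm (adj U) Y = sqrtm (mm (adj Y) Y) & contr U].
Proof.
have pY : psd (mm (adj Y) Y) by apply: psd_gram_adj.
set P := sqrtm _; have pP : psd P by apply: sqrtm_psd.
have [||U [eY eU cU]] := @polar I I (adj Y) P => //.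
  by rewrite adjK /P sqrtm_sqr.
exists (adj U); split; last exact: contr_adj.
  by rewrite -[Y]adjK eY adjM (psd_herm pP).
by rewrite adjK -eU adjK.
Qed.

(* The easy direction of Uhlmann's theorem: [M] and [L] are purifications. *)
Lemma root_fidelity_gram I E (M L : mat R I E) :
  rtr (mm (adj M) L) <= root_fidelity (mm M (adj M)) (mm L (adj L)).
Proof.
rewrite /root_fidelity; set Y := mm (sqrtm _) _; have [U [eY _ cU]] := abs_polar Y.
have pM := psd_gram M; have pL := psd_gram L.
have [|UM [eM _ cM]] := @polar I E M _ (sqrtm_psd pM); first by rewrite sqrtm_sqr.
have [|UL [eL _ cL]] := @polar I E L _ (sqrtm_psd pL); first by rewrite sqrtm_sqr.
(* Cyclicity gathers the three contractions into one factor next to the positive [Z]. *)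
have c Z : psd Z -> rtr (mm (adj UM) (mm (mm U Z) UL)) <= rtr Z.
  move=> pZ; rewrite mmA rtrC !mmA; apply: rtr_contr => //.
  by apply: contrM => //; apply: contrM => //; apply: contr_adj.
have -> : rtr (mm (adj M) L) = rtr (mm (adj UM) (mm Y UL)).
  by rewrite {1}eM {1}eL adjM (psd_herm (sqrtm_psd pM)) /Y !mmA.
by rewrite {1}eY; apply/c/sqrtm_psd/psd_gram_adj.
Qed.

(** Cauchy-Schwarz for the [T]-weighted inner product, kept in its weighted arithmetic-mean form so
    that no square roots appear. *)
Lemma rtr_amgm I J (T : Op R I) (A B : mat R I J) (x : R) : psd T -> 0 < x ->
  rtr (mm (adj A) (mm T B)) <=
    (x * rtr (mm T (mm A (adj A))) + x^-1 * rtr (mm T (mm B (adj B)))) / 2.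
Proof.
move=> /psdP[S ->] x0; have := hs_amgm x (mm (adj S) A) (mm (adj S) B).
rewrite /hs !adjM !adjK -!mmA.
have e (Z : mat R I J) : rtr (mm (adj Z) (mm S (mm (adj S) Z))) =
    rtr (mm S (mm (adj S) (mm Z (adj Z)))).
  by rewrite rtrC -!mmA.
rewrite !e; set a := rtr _; set b := rtr _; set c := rtr _ => h.
rewrite -(ler_pM2l x0); have xx : x * x^-1 = 1 by rewrite mulfV // gt_eqF.
have -> : x * ((x * b + x^-1 * c) / 2) = (x ^+ 2 * b + (x * x^-1) * c) / 2 by ring.
rewrite xx mul1r; lra.
Qed.

(* Cauchy-Schwarz for the two-outcome test {T, 1 - T}, with the weights of the
   AM-GM inequality chosen to make every error term at most s/4. *)
Lemma fidelity_test I (rho sigma T : Op R I) (s : R) :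
  psd rho -> psd sigma -> rtr sigma <= 1 -> psd T -> psd (msub (@opid R I) T) ->
  0 < s -> s <= root_fidelity rho sigma ->
  rtr rho <= 1 -> rtr rho - rtr (mm T rho) <= s ^+ 2 / 4 ->
  s ^+ 2 / 4 <= rtr (mm T sigma).
Proof.
move=> pr ps ts pT pT' s0 sF tr1 h; move: sF; rewrite /root_fidelity; set Y := mm (sqrtm _) _.
have [U [_ <- cU]] := abs_polar Y.
have hr := psd_herm (sqrtm_psd pr).
have pB : mm (sqrtm sigma) (adj (sqrtm sigma)) = sigma.
  by rewrite (psd_herm (sqrtm_psd ps)) sqrtm_sqr.
have rr := sqrtm_sqr pr.
have eY : mm (adj U) Y = mm (adj (mm (sqrtm rho) U)) (sqrtm sigma).
  by rewrite adjM hr /Y mmA.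
clearbody Y; move: (sqrtm rho) (sqrtm sigma) hr rr pB eY => P B hr rr pB -> sF.
(* [A] is the square root of [rho] turned by the polar factor, so that [rtr (mm (adj A) B)] is the
   root fidelity. As [U] is a contraction, [A A^+ <= rho]; [cA] is this inequality tested against a
   positive [Q]. *)
set A := mm P U in sF *.
have cA (Q : Op R I) : psd Q -> rtr (mm Q (mm A (adj A))) <= rtr (mm Q rho).
  case/psdP => Z ->; have c := contr_adj cU (mm P Z).
  rewrite /hs !adjM adjK hr -!mmA (mmA P P) rr in c.
  have -> : rtr (mm (mm Z (adj Z)) (mm A (adj A))) =
     rtr (mm (adj Z) (mm P (mm U (mm (adj U) (mm P Z))))).
    by rewrite -mmA rtrC /A adjM hr -!mmA.
  by apply: le_trans c _; rewrite -mmA [X in _ <= X]rtrC -!mmA.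
have x0 : 0 < s / 2 by rewrite divr_gt0.
have y0 : 0 < 2 / s by rewrite divr_gt0.
have := rtr_amgm A B pT x0; have := rtr_amgm A B pT' y0.
rewrite pB; have := cA _ pT; have := cA _ pT'; rewrite !mmBl !mm1l !mmBr !rtrB.
move: sF h tr1 (rtr_mm_ge0 pT' pr); rewrite mmBl mm1l rtrB.
move: (rtr_mm_ge0 pT pr) (rtr_mm_ge0 pT ps).
move: (rtr (mm (adj A) B)) (rtr (mm T rho)) (rtr (mm T sigma)) => t p q.
move: (rtr (mm (adj A) (mm T B))) (rtr (mm A (adj A))) (rtr (mm T (mm A (adj A)))).
move=> t1 a b p0 q0 sF h tr1 pr1 c1 c2 a1 a2.
have sn : s != 0 by rewrite gt_eqF.
have h1 : 2 / s * (a - b) <= s / 2.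
  apply: le_trans (_ : 2 / s * (s ^+ 2 / 4) <= _).
    by apply: ler_wpM2l; [apply: ltW | lra].
  by rewrite le_eqVlt; apply/orP; left; apply/eqP; field.
have h2 : (2 / s)^-1 * (rtr sigma - q) <= s / 2.
  have -> : (2 / s)^-1 = s / 2 by rewrite invf_div.
  by rewrite ger_pMr // lerBlDr; lra.
have h3 : s / 2 * b <= s / 2 by rewrite ger_pMr //; lra.
have h4 : s / 2 <= (s / 2)^-1 * q by lra.
have := ler_wpM2l (ltW x0) h4; rewrite mulVKf ?gt_eqF // => h5.
by apply: le_trans h5; rewrite le_eqVlt; apply/orP; left; apply/eqP; field.
Qed.
End Spectral.

(** * Tensor powers and typical projectors *)

Section Relabel.
Variable R : realType.
Local Notation C := R[i].
Local Notation "x %:C" := (real_complex R x).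
Variables (I J : finType) (f : J -> I).
Implicit Types X Y : Op R I.

Lemma psd_relabel X : psd X -> psd (relabel f X).
Proof.
case/psdP => S ->.
by have := psd_gram (fun j i => S (f j) i).
Qed.

Lemma ople_relabel X Y : ople X Y -> ople (relabel f X) (relabel f Y).
Proof. exact: psd_relabel. Qed.

Hypothesis bf : bijective f.

Lemma relabel_mm X Y : relabel f (mm X Y) = mm (relabel f X) (relabel f Y).
Proof.
apply: matP => i j; rewrite /relabel /mm (reindex f) //.
exact: onW_bij.
Qed.

Lemma relabel1 : relabel f (@opid R I) = @opid R J.
Proof. by apply: matP => i j; rewrite /relabel /opid (inj_eq (bij_inj bf)). Qed.

Lemma optr_relabel X : optr (relabel f X) = optr X.
Proof. by rewrite /optr [RHS](reindex f) //; apply: onW_bij. Qed.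

Lemma rtr_relabel X : rtr (relabel f X) = rtr X.
Proof. by rewrite /rtr optr_relabel. Qed.

Lemma relabel_sd (V : Op R I) (l : I -> R) : relabel f (sd V l) = sd (relabel f V) (l \o f).
Proof.
rewrite /sd 2!relabel_mm; congr (mm _ (mm _ _)).
by apply: matP => i j; rewrite /relabel /opdiag (inj_eq (bij_inj bf)).
Qed.

Lemma unitary_relabel X : unitary X -> unitary (relabel f X).
Proof.
move=> uX; rewrite /unitary -relabel1 -(unitaryl uX).
exact/esym/relabel_mm.
Qed.

Lemma funm_relabel g X : adj X = X -> funm g (relabel f X) = relabel f (funm g X).
Proof.
move=> /herm_sd[V [l [uV e]]]; rewrite (funmE g uV e) relabel_sd.
apply: funmE; first exact: unitary_relabel.
by rewrite e relabel_sd.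
Qed.
End Relabel.

Section TensorPower.
Variable R : realType.
Local Notation C := R[i].
Local Notation "x %:C" := (real_complex R x).
Variable n : nat.
Implicit Types I J K : finType.

(** The factors may vary with the site because the symmetry group of the [n]-fold channel acts by an
    independent group element on each copy. *)
Definition tens I J (F : 'I_n -> mat R I J) : mat R {ffun 'I_n -> I} {ffun 'I_n -> J} :=
  fun x y => \prod_(t < n) F t (x t) (y t).

Definition tpow I J (X : mat R I J) := tens (fun=> X).

Lemma mm_tens I J K (F : 'I_n -> mat R I J) (G : 'I_n -> mat R J K) :
  mm (tens F) (tens G) = tens (fun t => mm (F t) (G t)).
Proof.
apply: matP => x z; rewrite /mm /tens bigA_distr_bigA /=.
by apply: eq_bigr => y _; rewrite -big_split.
Qed.

Lemma adj_tens I J (F : 'I_n -> mat R I J) : adj (tens F) = tens (fun t => adj (F t)).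
Proof. by apply: matP => x y; rewrite /adj /tens rmorph_prod. Qed.

Lemma optr_tens I (F : 'I_n -> Op R I) : optr (tens F) = \prod_t optr (F t).
Proof. by rewrite /optr /tens bigA_distr_bigA. Qed.

Lemma ffun_eqE I (x y : {ffun 'I_n -> I}) : (x == y) = [forall t, x t == y t].
Proof.
apply/eqP/forallP => [-> //|h]; apply/ffunP => t; exact/eqP.
Qed.

Lemma prod_eq_nat (V : comNzRingType) I (x y : {ffun 'I_n -> I}) :
  \prod_(t < n) (x t == y t)%:R = (x == y)%:R :> V.
Proof.
rewrite ffun_eqE; case: forallP => [h|/forallP].
  by rewrite big1 // => t _; rewrite h.
rewrite negb_forall => /existsP[t /negbTE ht].
by rewrite (bigD1 t) //= ht mul0r.
Qed.

Lemma tpow1 I : tpow (@opid R I) = @opid R _.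
Proof. by apply: matP => x y; rewrite /tpow /tens /opid prod_eq_nat. Qed.

Lemma tens_unitary I (F : 'I_n -> Op R I) : (forall t, unitary (F t)) -> unitary (tens F).
Proof.
move=> h; rewrite /unitary -tpow1; change (mm (adj (tens F)) (tens F) = tpow (@opid R I)).
rewrite adj_tens mm_tens; congr tens; apply/funext => t; exact: h.
Qed.

Lemma mm_tpow I J K (X : mat R I J) (Y : mat R J K) : mm (tpow X) (tpow Y) = tpow (mm X Y).
Proof. exact: mm_tens. Qed.

Lemma adj_tpow I J (X : mat R I J) : adj (tpow X) = tpow (adj X).
Proof. exact: adj_tens. Qed.

Lemma psd_tpow I (X : Op R I) : psd X -> psd (tpow X).
Proof. by case/psdP => S ->; rewrite -mm_tpow -adj_tpow; apply: psd_gram. Qed.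

Lemma state_tpow I (X : Op R I) : is_state X -> is_state (tpow X).
Proof.
by case=> p t; split; [apply: psd_tpow | rewrite optr_tens big1].
Qed.

Lemma tpow_diag I (l : I -> R) : tpow (opdiag l) = opdiag (fun x : {ffun 'I_n -> I} => \prod_t l
    (x t)).
Proof.
apply: matP => x y; rewrite /tpow /tens /opdiag; case: eqP => [->|/eqP].
  by rewrite rmorph_prod; apply: eq_bigr => t _; rewrite eqxx.
rewrite ffun_eqE negb_forall => /existsP[t /negbTE ht].
by rewrite (bigD1 t) //= ht mul0r.
Qed.

Lemma tpow_sd I (V : Op R I) l : tpow (sd V l) = sd (tpow V) (fun x : {ffun 'I_n -> I} => \prod_t
    l (x t)).
Proof. by rewrite /sd -tpow_diag adj_tpow !mm_tpow. Qed.

Lemma dg_tpow I (V X : Op R I) (x : {ffun 'I_n -> I}) : psd X ->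
  dg (tpow V) (tpow X) x = \prod_t dg V X (x t).
Proof.
move=> pX; rewrite /dg adj_tpow !mm_tpow /tpow /tens.
rewrite (eq_bigr (fun t => (complex.Re (mm (adj V) (mm X V) (x t) (x t)))%:C)).
  by rewrite -rmorph_prod.
by move=> t _; apply/ge0_ReE/mm_psd_diag.
Qed.
End TensorPower.
Arguments tpow {R} n {I J} X _ _.
Arguments psd_tpow {R} n {I X} _ _.
Arguments tpow1 {R} n I.
Arguments tpow_sd {R} n {I} V l.
Arguments dg_tpow {R} n {I} V X x _.

(** * The weak law of large numbers *)

Section Chebyshev.
Variable R : realType.
Variables (I : finType) (P xi : I -> R).
Hypotheses (P0 : forall i, 0 <= P i) (P1 : \sum_i P i = 1).

Let m : R := \sum_i P i * xi i.
Let v : R := \sum_i P i * (xi i - m) ^+ 2.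

(** After expanding the square, each summand factors over the sites; for [s != t] it contains the
    mean of a centred variable, which is 0, and each diagonal one gives [v]. *)
Lemma variance_sum n :
  \sum_(x : {ffun 'I_n -> I}) (\prod_t P (x t)) * (\sum_t (xi (x t) - m)) ^+ 2 = n%:R * v.
Proof.
have c : \sum_i P i * (xi i - m) = 0.
  under eq_bigr => i _ do rewrite mulrBr.
  by rewrite sumrB -mulr_suml P1 mul1r subrr.
transitivity (\sum_(s < n) \sum_(t < n) (if s == t then v else 0)); last first.
  under eq_bigr => s _ do rewrite -big_mkcond (big_pred1 s) //.
  by rewrite sumr_const card_ord mulr_natl.
transitivity (\sum_(x : {ffun 'I_n -> I}) \sum_(s < n) \sum_(t < n)
   \prod_u (P (x u) * ((if u == s then xi (x u) - m else 1) * (if u == t then xi (x u) - m else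
       1)))).
  apply: eq_bigr => x _; rewrite expr2 mulr_suml mulr_sumr; apply: eq_bigr => s _.
  rewrite mulr_sumr mulr_sumr; apply: eq_bigr => t _; rewrite !big_split /=.
  by rewrite -!big_mkcond !big_pred1_eq.
rewrite exchange_big; apply: eq_bigr => s _; rewrite exchange_big; apply: eq_bigr => t _ /=.
rewrite -(bigA_distr_bigA (fun u i => P i * ((if u == s then xi i - m else 1) * (if u == t then xi
    i - m else 1)))).
rewrite (bigD1 s) //= eqxx; case: (eqVneq s t) => [->|st].
  rewrite [X in _ * X]big1 => [|u /negbTE ut].
    by rewrite mulr1; apply: eq_bigr => i _; rewrite expr2.
  by rewrite ut -[RHS]P1; apply: eq_bigr => i _; rewrite !mulr1.
under eq_bigr => i _ do rewrite mulr1.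
by rewrite c mul0r.
Qed.

Lemma chebyshev n (d : R) : (0 < n)%N -> 0 < d ->
  1 - v / (n%:R * d ^+ 2) <=
  \sum_(x : {ffun 'I_n -> I} | `|\sum_t (xi (x t) - m)| <= n%:R * d) \prod_t P (x t).
Proof.
move=> n0 d0; have nR : 0 < n%:R :> R by rewrite ltr0n.
have tot : \sum_(x : {ffun 'I_n -> I}) \prod_t P (x t) = 1.
  by rewrite -(bigA_distr_bigA (fun u i => P i)) big1.
have Pn (x : {ffun 'I_n -> I}) : 0 <= \prod_t P (x t) by apply: prodr_ge0.
rewrite -[X in X - _]tot (bigID (fun x : {ffun 'I_n -> I} => `|\sum_t (xi (x t) - m)| <= n%:R *
    d)) /=.
rewrite -addrA gerDl subr_le0.
rewrite -(ler_pM2l (_ : 0 < (n%:R * d) ^+ 2)); last by rewrite exprn_gt0 // mulr_gt0.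
have -> : (n%:R * d) ^+ 2 * (v / (n%:R * d ^+ 2)) = n%:R * v.
  by field; rewrite !gt_eqF.
rewrite -variance_sum mulr_sumr big_mkcond /=; apply: ler_sum => x _.
case: ifP => [|_]; last by rewrite mulr_ge0 ?sqr_ge0.
rewrite -ltNge => h; rewrite mulrC; apply: ler_wpM2l => //.
by rewrite -[X in _ <= X]real_normK ?num_real // lerXn2r ?nnegrE ?mulr_ge0 // ltW.
Qed.

Lemma variance_ge0 : 0 <= v.
Proof. by apply: sumr_ge0 => i _; rewrite mulr_ge0 ?sqr_ge0. Qed.
End Chebyshev.

Section Pow2.
Variable R : realType.
Implicit Types x y : R.

Definition pow2 x : R := expR (x * ln 2).

Lemma ln2_gt0 : 0 < ln 2 :> R.
Proof. by rewrite ln_gt0 // ltr1n. Qed.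

Lemma pow2_gt0 x : 0 < pow2 x. Proof. exact: expR_gt0. Qed.
Lemma pow2_ge0 x : 0 <= pow2 x. Proof. exact: expR_ge0. Qed.
Lemma pow2D x y : pow2 (x + y) = pow2 x * pow2 y.
Proof. by rewrite /pow2 mulrDl expRD. Qed.
Lemma pow20 : pow2 0 = 1. Proof. by rewrite /pow2 mul0r expR0. Qed.
Lemma pow2N x : pow2 (- x) = (pow2 x)^-1.
Proof. by rewrite /pow2 mulNr expRN. Qed.
Lemma ler_pow2 x y : (pow2 x <= pow2 y) = (x <= y).
Proof. by rewrite /pow2 ler_expR ler_pM2r // ln2_gt0. Qed.
Lemma pow2_log2 x : 0 < x -> pow2 (log2 x) = x.
Proof. by move=> x0; rewrite /pow2 /log2 divfK ?gt_eqF ?ln2_gt0 // lnK. Qed.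
Lemma log2_pow2 x : log2 (pow2 x) = x.
Proof. by rewrite /pow2 /log2 expRK mulfK // gt_eqF ?ln2_gt0. Qed.
Lemma ler_log2 x y : 0 < x -> x <= y -> log2 x <= log2 y.
Proof.
move=> x0 xy; rewrite -ler_pow2 !pow2_log2 //; exact: lt_le_trans xy.
Qed.
Lemma pow2_sum (I : finType) (F : I -> R) : pow2 (\sum_i F i) = \prod_i pow2 (F i).
Proof. by rewrite (big_morph pow2 pow2D pow20). Qed.
Lemma log2M x y : 0 < x -> 0 < y -> log2 (x * y) = log2 x + log2 y.
Proof. by move=> x0 y0; rewrite /log2 lnM // mulrDl. Qed.
End Pow2.

(** * Typical projectors and the asymptotic equipartition property *)

Section Typical.
Variable R : realType.
Local Notation C := R[i].
Local Notation "x %:C" := (real_complex R x).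
Implicit Types I J : finType.

Definition proj I (P : Op R I) := adj P = P /\ mm P P = P.

Lemma proj_psd I (P : Op R I) : proj P -> psd P.
Proof. by case=> h e; rewrite -e -{2}h; apply: psd_gram. Qed.

Lemma projC I (P : Op R I) : proj P -> proj (msub (@opid R I) P).
Proof.
case=> h e; split; first by rewrite adjB adj_opid h.
by rewrite mmBl !mmBr !mm1l mm1r e; apply: matP => i j; rewrite /msub subrr subr0.
Qed.

Lemma psd_sandwich I (P X : Op R I) : adj P = P -> psd X -> psd (mm P (mm X P)).
Proof. by move=> h p; rewrite -{2}h; apply: psd_congr. Qed.

Lemma ople_sandwich I (P X Y : Op R I) : adj P = P -> ople X Y ->
  ople (mm P (mm X P)) (mm P (mm Y P)).
Proof. by move=> h p; rewrite -{2 4}h; apply: ople_congr. Qed.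

Lemma rtr_proj_le I (P X : Op R I) : proj P -> psd X -> rtr (mm P X) <= rtr X.
Proof.
move=> /projC/proj_psd pP pX; have := rtr_mm_ge0 pP pX.
by rewrite mmBl mm1l rtrB subr_ge0.
Qed.

Lemma rtr_proj_sandwich I (P X : Op R I) : proj P -> rtr (mm P (mm X P)) = rtr (mm P X).
Proof. by case=> _ e; rewrite mmA rtrC mmA e. Qed.

(* Gentle measurement: since [P] commutes with [rho], inserting it in front of
   [rho] changes [rtr (Q rho)] by [rtr (Q (1 - P) rho (1 - P))] at most. *)
Lemma gentle I (P Q rho : Op R I) (e : R) : proj P -> proj Q -> psd rho ->
  mm P rho = mm rho P -> rtr rho - e <= rtr (mm P rho) -> rtr rho - e <= rtr (mm Q rho) ->
  rtr rho - 2 * e <= rtr (mm (mm Q P) rho).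
Proof.
move=> pP pQ pr c hP hQ.
have [hc ec] := projC pP; set P' := msub _ _ in hc ec.
have c' : mm P' rho = mm rho P' by rewrite mmBl mmBr c mm1l mm1r.
have := rtr_proj_le pQ (psd_sandwich hc pr).
rewrite -c' (mmA P') ec /P' mmBl mm1l mmBr !rtrB mmA; lra.
Qed.

(** AM-GM between [K^+ S] and [S], where [rho = S S^+]. It turns the overlap of a non-Hermitian
    product of projectors into an acceptance probability. *)
Lemma gentle_test I (K rho : Op R I) (w : R) : psd rho -> w <= rtr (mm K rho) ->
  2 * w - rtr rho <= rtr (mm (mm K (adj K)) rho).
Proof.
move=> /psdP[S ->] h; have := hs_amgm 1 (mm (adj K) S) S.
rewrite /hs !adjM adjK.
have -> : rtr (mm (mm (adj S) K) S) = rtr (mm K (mm S (adj S))) by rewrite -mmA rtrC -mmA.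
have -> : rtr (mm (mm (adj S) K) (mm (adj K) S)) = rtr (mm (mm K (adj K)) (mm S (adj S))).
  by rewrite -mmA rtrC -!mmA.
rewrite [X in _ + X]rtrC expr1n; lra.
Qed.

Lemma proj_test I (P Q : Op R I) : proj P -> proj Q ->
  psd (mm (mm Q P) (adj (mm Q P))) /\ psd (msub (@opid R I) (mm (mm Q P) (adj (mm Q P)))).
Proof.
move=> pP pQ; split; first exact: psd_gram.
have h := ople_sandwich pQ.1 (proj_psd (projC pP) : ople P (@opid R I)).
rewrite mm1l pQ.2 mmA in h.
have := ople_trans h (proj_psd (projC pQ) : ople Q (@opid R I)).
by rewrite adjM pP.1 pQ.1 -!mmA (mmA P P) pP.2.
Qed.

(** The centre [a] and half-width [d] are exponents of the eigenvalue itself, hence of order [n] for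
    an [n]-fold state. Zero eigenvalues always fall outside. *)
Definition window (a d x : R) : R := ((pow2 (a - d) <= x) && (x <= pow2 (a + d)))%:R.
Definition typ I (a d : R) (X : Op R I) : Op R I := funm (window a d) X.

Lemma windowP a d x : window a d x = 0 \/
  [/\ window a d x = 1, pow2 (a - d) <= x & x <= pow2 (a + d)].
Proof. by rewrite /window; case: andP => [[]|]; [right|left]. Qed.

Section Projection.
Variables (I : finType) (a d : R) (X : Op R I).
Hypothesis pX : psd X.
Let P := typ a d X.

Lemma typ_proj : proj P.
Proof.
have [V [l [uV l0 eX]]] := psd_spectral pX.
rewrite /P /typ (funmE _ uV eX); split; first by rewrite adj_sd.
rewrite sdM //; congr sd; apply/funext => i /=.
by case: (windowP a d (l i)) => [->|[-> _ _]]; rewrite ?mul0r ?mul1r.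
Qed.

Lemma typ_comm G : mm X G = mm G X -> mm P G = mm G P.
Proof. exact/funm_comm/psd_herm. Qed.

Lemma typ_le : ople P (mscale (pow2 (d - a))%:C X).
Proof.
have [V [l [uV l0 eX]]] := psd_spectral pX.
rewrite /P /typ (funmE _ uV eX) eX sdZ /ople -[opsub _ _]/(msub _ _) sdB; apply: psd_sd => i /=.
rewrite subr_ge0; case: (windowP a d (l i)) => [->|[-> h _]].
  by rewrite mulr_ge0 ?pow2_ge0.
by rewrite -(opprB a) pow2N -(ler_pM2l (pow2_gt0 (a - d))) mulVKf ?mulr1 // gt_eqF ?pow2_gt0.
Qed.

Lemma typ_ge : ople (mm P (mm X P)) (mscale (pow2 (a + d))%:C P).
Proof.
have [V [l [uV l0 eX]]] := psd_spectral pX.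
rewrite /P /typ (funmE _ uV eX) eX sdZ !sdM // /ople -[opsub _ _]/(msub _ _) sdB; apply: psd_sd =>
    i /=.
rewrite subr_ge0; case: (windowP a d (l i)) => [->|[-> _ h]].
  by rewrite mul0r mulr0.
by rewrite mul1r !mulr1.
Qed.
End Projection.

(** Measuring [rho^n] in the eigenbasis of [tau^n] gives independent outcomes, and the logarithm of
    the eigenvalue found is a sum of independent terms of mean [m]. The number [v] is the variance
    of one term, so it does not depend on [n] or [d]. *)
Lemma typ_prob I (rho tau : Op R I) : is_state rho -> psd tau -> supp_le rho tau ->
  let m := rtr (mm rho (logm tau)) in
  exists2 v : R, 0 <= v & forall n (d : R), (0 < n)%N -> 0 < d ->
    1 - v / (n%:R * d ^+ 2) <=
      rtr (mm (typ (n%:R * m) (n%:R * d) (tpow n tau)) (tpow n rho)).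
Proof.
move=> [pr tr1] pt supp m; have [V [q [uV q0 et]]] := psd_spectral pt.
(* The value 0 at zero eigenvalues agrees with [logm]; by support inclusion these outcomes have
   probability 0. *)
pose P := dg V rho; pose xi i := if 0 < q i then log2 (q i) else 0 : R.
have P0 i : 0 <= P i by apply: dg_ge0.
have P1 : \sum_i P i = 1 by rewrite sum_dg // /rtr tr1.
have Pq i : q i = 0 -> P i = 0.
  rewrite et in supp => qi; rewrite /P /dg {1}/mm big1 // => j _.
  by rewrite (supp_eigen uV supp qi) mulr0.
have mE : m = \sum_i P i * xi i.
  rewrite /m rtrC /logm (funmE _ uV et) rtr_sd; apply: eq_bigr => i _.
  by rewrite mulrC.
exists (\sum_i P i * (xi i - m) ^+ 2).
  by rewrite mE; apply: variance_ge0.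
move=> n d n0 d0; have := chebyshev xi P0 P1 n0 d0; rewrite -mE => /le_trans; apply.
have uVn : unitary (tpow n V) by apply: tens_unitary.
rewrite /typ (funmE _ uVn (etrans (congr1 _ et) (tpow_sd n V q))) rtr_sd.
rewrite big_mkcond; apply: ler_sum => x _ /=.
rewrite dg_tpow // -/P.
have Px : 0 <= \prod_t P (x t) by apply: prodr_ge0.
case: ifP => [h|_]; last by rewrite mulr_ge0 // /window ler0n.
have [/existsP[t /eqP qt]|/existsPn qn] := boolP [exists t, q (x t) == 0].
  by rewrite [\prod_t P (x t)](bigD1 t) //= Pq // mul0r mulr0.
have qp t : 0 < q (x t) by rewrite lt_def qn q0.
have -> : \prod_t q (x t) = pow2 (\sum_t xi (x t)).
  by rewrite pow2_sum; apply: eq_bigr => t _; rewrite /xi qp pow2_log2.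
rewrite /window !ler_pow2.
have -> : (n%:R * m - n%:R * d <= \sum_t xi (x t)) && (\sum_t xi (x t) <= n%:R * m + n%:R * d).
  move: h; rewrite sumrB sumr_const card_ord -mulr_natl ler_norml.
  by move=> /andP[h1 h2]; apply/andP; split; lra.
by rewrite mul1r.
Qed.

Section JointTypicality.
Variables (I : finType) (rho tau : Op R I) (a b d : R).
Hypotheses (pr : psd rho) (pt : psd tau).
Variables P Q : Op R I.
Hypotheses (eP : P = typ a d rho) (eQ : Q = typ b d tau).
Let pP : proj P. Proof. by rewrite eP; apply: typ_proj. Qed.
Let pQ : proj Q. Proof. by rewrite eQ; apply: typ_proj. Qed.
Let P_le : ople P (mscale (pow2 (d - a))%:C rho).
Proof. by rewrite eP; apply: typ_le. Qed.
Let P_ge : ople (mm P (mm rho P)) (mscale (pow2 (a + d))%:C P).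
Proof. by rewrite eP; apply: typ_ge. Qed.
Let Q_le : ople Q (mscale (pow2 (d - b))%:C tau).
Proof. by rewrite eQ; apply: typ_le. Qed.
Let Q_ge : ople (mm Q (mm tau Q)) (mscale (pow2 (b + d))%:C Q).
Proof. by rewrite eQ; apply: typ_ge. Qed.
Let P_comm G : mm rho G = mm G rho -> mm P G = mm G P.
Proof. by rewrite eP; apply: typ_comm. Qed.
Let Q_comm G : mm tau G = mm G tau -> mm Q G = mm G Q.
Proof. by rewrite eQ; apply: typ_comm. Qed.
Let K := mm Q P.

Lemma jtyp_adj : adj K = mm P Q.
Proof. by rewrite adjM pP.1 pQ.1. Qed.

(** As [rho] and [tau] may fail to commute, the projectors are peeled off one at a time:
    [P rho P <= 2^(a + d)], then [Q 1 Q = Q], then [Q <= 2^(d - b) tau]. *)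
Lemma jtyp_le : ople (mm K (mm rho (adj K))) (mscale (pow2 (a - b + 2 * d))%:C tau).
Proof.
rewrite jtyp_adj /K -!mmA (mmA rho) (mmA P).
apply: (@ople_trans _ _ (mscale (pow2 (a + d))%:C Q)).
  have h : ople (mm P (mm rho P)) (mscale (pow2 (a + d))%:C (@opid R I)).
    apply: ople_trans P_ge _; apply: opleZ; first exact: pow2_ge0.
    exact/proj_psd/projC.
  have := ople_sandwich pQ.1 h; congr ople.
  by rewrite mmZl mm1l mmZr pQ.2.
have -> : a - b + 2 * d = (a + d) + (d - b) by ring.
rewrite (pow2D (a + d)) rmorphM /= -mscaleA; apply: opleZ; first exact: pow2_ge0.
exact: Q_le.
Qed.

Lemma jtyp_comm G : mm rho G = mm G rho -> mm tau G = mm G tau -> mm K G = mm G K.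
Proof.
move=> h1 h2; rewrite /K -mmA (P_comm h1) !mmA.
by rewrite (Q_comm h2).
Qed.

(** The trace equals that of [(Q tau Q) P], and [Q tau Q <= 2^(b + d) Q]; what remains is at most
    the trace of [P], that is, at most [2^(d - a)]. *)
Lemma jtyp_test_tau : rtr rho <= 1 ->
  rtr (mm (mm K (adj K)) tau) <= pow2 (b - a + 2 * d).
Proof.
move=> tr.
have -> : rtr (mm (mm K (adj K)) tau) = rtr (mm (mm Q (mm tau Q)) P).
  by rewrite jtyp_adj /K -!mmA (mmA P P) pP.2 rtrC -!mmA rtrC -!mmA.
apply: le_trans (rtr_ople Q_ge (proj_psd pP)) _.
rewrite mmZl rtrZ; have -> : b - a + 2 * d = (b + d) + (d - a) by ring.
rewrite (pow2D (b + d)) ler_pM2l ?pow2_gt0 //; apply: le_trans (rtr_proj_le pQ (proj_psd pP)) _.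
have := rtr_ople P_le (@psd1 R I); rewrite !mm1r rtrZ => /le_trans; apply.
by rewrite ger_pMr ?pow2_gt0.
Qed.

Lemma jtyp_tr : rtr (mm K (mm rho (adj K))) <= rtr rho.
Proof.
have sp := psd_sandwich pP.1 pr.
have -> : rtr (mm K (mm rho (adj K))) = rtr (mm Q (mm P (mm rho P))).
  by rewrite jtyp_adj /K -!mmA (mmA rho) (mmA P) rtr_proj_sandwich.
by apply: le_trans (rtr_proj_le pQ sp) _; rewrite rtr_proj_sandwich ?rtr_proj_le.
Qed.

Lemma jtyp_gentle e : rtr rho = 1 -> 1 - e <= rtr (mm P rho) -> 1 - e <= rtr (mm Q rho) ->
  1 - 2 * e <= rtr (mm K rho) /\ 1 - 4 * e <= rtr (mm (mm K (adj K)) rho).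
Proof.
move=> t1 hP hQ.
have w : 1 - 2 * e <= rtr (mm K rho).
  have := @gentle _ P Q rho e pP pQ pr; rewrite t1; apply=> //.
  exact: P_comm.
split=> //; have := gentle_test pr w; rewrite t1; lra.
Qed.
End JointTypicality.

Definition rel_ent I (rho tau : Op R I) : R :=
  rtr (mm rho (logm rho)) - rtr (mm rho (logm tau)).

Lemma relentE I (rho tau : Op R I) : supp_le rho tau -> relent rho tau = (rel_ent rho tau)%:E.
Proof.
move=> h; rewrite /relent asboolT //; congr (_%:E).
by rewrite /rel_ent -rtrB -mmBr.
Qed.

Lemma nat_large (x : R) : exists n0 : nat, forall n, (n0 <= n)%N -> x <= n%:R.
Proof.
exists (Num.bound `|x|) => n h; apply: le_trans (ler_norm _) _.
apply/ltW/(lt_le_trans (archi_boundP _)) => //; by rewrite ler_nat.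
Qed.

(** Uniform in [u <= V], so that with [V = v + w] one threshold serves two Chebyshev estimates. *)
Lemma chebyshev_large (V d e : R) : 0 <= V -> 0 < d -> 0 < e ->
  exists n0 : nat, forall n, (n0 <= n)%N ->
    (0 < n)%N /\ forall u : R, 0 <= u -> u <= V -> u / (n%:R * d ^+ 2) <= e.
Proof.
move=> V0 d0 e0; have p : 0 < e * d ^+ 2 by rewrite mulr_gt0 ?exprn_gt0.
have [n0 hn0] := nat_large (V / (e * d ^+ 2) + 1).
exists n0 => n /hn0 nh.
have nR : 0 < n%:R :> R.
  by apply: lt_le_trans nh; rewrite ltr_wpDl // divr_ge0 // ltW.
split=> [|u u0 uV]; first by rewrite -(ltr0n R).
rewrite ler_pdivrMr ?mulr_gt0 ?exprn_gt0 //.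
have : V / (e * d ^+ 2) <= n%:R by lra.
rewrite ler_pdivrMr // => h; lra.
Qed.

(* [K] is the product of the typical projectors of [tau] and [rho]; the former keeps the
   eigenvalues of [tau^n] close to [2^(n tr (rho log tau))]. *)
Lemma aep I (rho tau : Op R I) (d e : R) : is_state rho -> psd tau -> supp_le rho tau ->
  0 < d -> 0 < e ->
  exists n0 : nat, forall n, (n0 <= n)%N -> exists K : Op R {ffun 'I_n -> I},
  let D := rel_ent rho tau in let r := tpow n rho in let t := tpow n tau in
  [/\ (ople (mm K (mm r (adj K))) (mscale (pow2 (n%:R * (D + d)))%:C t)
        /\ rtr (mm K (mm r (adj K))) <= 1)%type,
      forall G, mm r G = mm G r -> mm t G = mm G t -> mm K G = mm G K,
      (psd (mm K (adj K)) /\ psd (msub (@opid R _) (mm K (adj K))))%type,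
      rtr (mm (mm K (adj K)) t) <= pow2 (n%:R * (d - D)) &
      (1 - e <= rtr (mm K r) /\ 1 - e <= rtr (mm (mm K (adj K)) r))%type].
Proof.
move=> sr pt supp d0 e0; have supr : supp_le rho rho by [].
have [v v0 hv] := typ_prob sr sr.1 supr; have [w w0 hw] := typ_prob sr pt supp.
(* Two windows enter each exponent, hence half-width [d / 2] per copy; [jtyp_gentle] multiplies the
   error by 4, hence [e / 4]. *)
have d2 : 0 < d / 2 by rewrite divr_gt0.
have e4 : 0 < e / 4 by rewrite divr_gt0.
have [n0 hn0] := chebyshev_large (addr_ge0 v0 w0) d2 e4.
exists n0 => n /hn0[n1 hb].
have [pr tr1] := state_tpow n sr; have prn := psd_tpow n pt.
have tr1' : rtr (tpow n rho) = 1 by rewrite /rtr tr1.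
set a := rtr (mm rho (logm rho)) in hv; set b := rtr (mm rho (logm tau)) in hw.
exists (mm (typ (n%:R * b) (n%:R * (d / 2)) (tpow n tau)) (typ (n%:R * a) (n%:R * (d / 2)) (tpow n
    rho))).
have eA : n%:R * (rel_ent rho tau + d) = n%:R * a - n%:R * b + 2 * (n%:R * (d / 2)).
  by rewrite /rel_ent -/a -/b; field.
have eB : n%:R * (d - rel_ent rho tau) = n%:R * b - n%:R * a + 2 * (n%:R * (d / 2)).
  by rewrite /rel_ent -/a -/b; field.
split.
- by rewrite eA; split; [apply: jtyp_le | rewrite -tr1'; apply: (jtyp_tr pr prn erefl erefl)].
- by move=> G; apply: (jtyp_comm pr prn erefl erefl).
- exact: (proj_test (typ_proj _ _ pr) (typ_proj _ _ prn)).
- by rewrite eB; apply: (jtyp_test_tau pr prn erefl erefl); rewrite tr1'.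
have [||h1 h2] := @jtyp_gentle _ (tpow n rho) (tpow n tau) (n%:R * a) (n%:R * b) (n%:R * (d / 2))
    pr prn _ _ erefl erefl (e / 4) tr1'.
- by have := hv n _ n1 d2; have := hb v v0; lra.
- by have := hw n _ n1 d2; have := hb w w0; lra.
by split; lra.
Qed.
End Typical.

(** * Channels and covariance *)

Section Channels.
Variable R : realType.
Local Notation C := R[i].
Local Notation "x %:C" := (real_complex R x).
Implicit Types I J O T E F : finType.

(** The unnormalised Choi matrix, with the input space as its own reference. *)
Definition kmat I O (K : kern R I O) : Op R (I * O)%type := fun p q => K p.2 q.2 p.1 q.1.
Definition matk I O (X : Op R (I * O)%type) : kern R I O := fun o o' x x' => X (x, o) (x', o').

Lemma matkK I O (X : Op R (I * O)%type) : kmat (matk X) = X.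
Proof. by apply: matP => -[x o] [x' o']. Qed.

Lemma kmatK I O (K : kern R I O) : matk (kmat K) = K.
Proof. by []. Qed.

Lemma sum_pair (V : nmodType) I J (F : I * J -> V) :
  \sum_p F p = \sum_i \sum_j F (i, j).
Proof. by rewrite (pair_bigA _ (fun i j => F (i, j))); apply: eq_bigr => -[]. Qed.

Lemma kappE T I O (K : kern R I O) (X : Op R (T * I)%type) p q :
  kapp (@kext R T _ _ K) X p q =
  \sum_(x : I) \sum_(x' : I) K p.2 q.2 x x' * X (p.1, x) (q.1, x').
Proof.
rewrite /kapp sum_pair (bigD1 p.1) //=.
rewrite [X in _ + X]big1 ?addr0 => [|r /negbTE hr]; last first.
  apply: big1 => x _; apply: big1 => i' _.
  by rewrite /kext /= eq_sym hr mul0r mul0r.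
apply: eq_bigr => x _; rewrite sum_pair (bigD1 q.1) //= [X in _ + X]big1 ?addr0 => [|r /negbTE
    hr]; last first.
  by apply: big1 => x' _; rewrite /kext /= [_ == r]eq_sym hr andbF mul0r mul0r.
by apply: eq_bigr => x' _; rewrite /kext /= !eqxx mul1r.
Qed.

(* If [K] has Choi matrix [L L'^+] and the input is [S S^+], then [gout] purifies the output. *)
Definition gout T I O E F (L : mat R (I * O)%type E) (S : mat R (T * I)%type F) :
    mat R (T * O)%type (E * F)%type :=
  fun p e => \sum_(x : I) L (x, p.2) e.1 * S (p.1, x) e.2.

Lemma goutE T I O E F (L L' : mat R (I * O)%type E) (S : mat R (T * I)%type F) :
  mm (gout L S) (adj (gout L' S)) =
  kapp (@kext R T _ _ (matk (mm L (adj L')))) (mm S (adj S)).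
Proof.
apply: matP => p q; rewrite kappE /mm /gout /adj /=.
rewrite sum_pair.
transitivity (\sum_(e : E) \sum_(f : F) \sum_(x : I) \sum_(x' : I)
   (L (x, p.2) e * conjc (L' (x', q.2) e)) * (S (p.1, x) f * conjc (S (q.1, x') f))).
  apply: eq_bigr => e _; apply: eq_bigr => f _.
  rewrite rmorph_sum mulr_suml; apply: eq_bigr => x _; rewrite mulr_sumr.
  by apply: eq_bigr => x' _; rewrite rmorphM /=; ring.
rewrite (eq_bigr _ (fun e _ => exchange_big _ _ _ _ _ _)) exchange_big.
apply: eq_bigr => x _ /=.
rewrite (eq_bigr _ (fun e _ => exchange_big _ _ _ _ _ _)) exchange_big.
apply: eq_bigr => x' _ /=.
rewrite /matk mulr_suml; apply: eq_bigr => e _.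
by rewrite mulr_sumr.
Qed.

Lemma kapp_psd T I O (K : kern R I O) (X : Op R (T * I)%type) :
  psd (kmat K) -> psd X -> psd (kapp (@kext R T _ _ K) X).
Proof.
move=> /psdP[L eL] /psdP[S ->]; rewrite -(kmatK K) eL -goutE.
exact: psd_gram.
Qed.

(** A complex [c] is allowed because the lemma also evaluates the overlap of two purified outputs,
    which is the trace of the output of a map that need not be positive. *)
Lemma optr_kapp T I O (K : kern R I O) (X : Op R (T * I)%type) (c : C) :
  (forall x x', \sum_o K o o x x' = (x == x')%:R * c) ->
  optr (kapp (@kext R T _ _ K) X) = c * optr X.
Proof.
move=> h; rewrite /optr !sum_pair mulr_sumr; apply: eq_bigr => r _.
under eq_bigr => o _ do rewrite kappE /=.
rewrite exchange_big /= mulr_sumr; apply: eq_bigr => x _; rewrite exchange_big /=.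
rewrite (bigD1 x) //= [X in _ + X]big1 ?addr0 => [|x' /negbTE hx]; last first.
  by rewrite -mulr_suml h eq_sym hx !mul0r.
by rewrite -mulr_suml h eqxx mul1r.
Qed.

Lemma kapp_diff T I O (K K' : kern R I O) (X : Op R (T * I)%type) (c : R) :
  psd X -> ople (kmat K) (mscale c%:C (kmat K')) ->
  ople (kapp (@kext R T _ _ K) X) (mscale c%:C (kapp (@kext R T _ _ K') X)).
Proof.
move=> pX h; pose K2 := matk (msub (mscale c%:C (kmat K')) (kmat K)).
have := @kapp_psd T I O K2 X; rewrite matkK => /(_ h pX); rewrite /ople; congr psd.
apply: matP => p q; rewrite /opsub /mscale !kappE mulr_sumr -sumrB; apply: eq_bigr => x _.
rewrite mulr_sumr -sumrB; apply: eq_bigr => x' _.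
by rewrite /K2 /matk /msub /mscale /kmat /= mulrBl mulrA.
Qed.

Definition delta I (a b : I) : Op R I := fun x x' => ((x == a) && (x' == b))%:R.

Lemma sum_delta I (a b : I) (F : I -> I -> C) :
  \sum_x \sum_x' F x x' * delta a b x x' = F a b.
Proof.
rewrite (bigD1 a) //= [X in _ + X]big1 ?addr0 => [|x /negbTE hx]; last first.
  by apply: big1 => x' _; rewrite /delta hx mulr0.
rewrite (bigD1 b) //= [X in _ + X]big1 ?addr0 => [|x /negbTE hx]; last first.
  by rewrite /delta hx andbF mulr0.
by rewrite /delta !eqxx mulr1.
Qed.

Definition trace_pres I O (K : kern R I O) := forall x x', \sum_o K o o x x' = (x == x')%:R.

Lemma channel_tp I O (K : kern R I O) : is_channel K -> trace_pres K.
Proof.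
move=> [_ h] a b; have := h (delta a b); rewrite /optr /kapp.
under eq_bigr => o _ do rewrite sum_delta.
move=> ->; rewrite /delta; case: eqVneq => [->|ab].
  by rewrite (bigD1 b) //= eqxx big1 ?addr0 // => x /negbTE ->.
by rewrite big1 // => x _; case: eqP => [->|//]; rewrite (negbTE ab).
Qed.

(* The unnormalised maximally entangled input, with reference ['I_#|I|]. *)
Definition rank_vec I : mat R ('I_#|I| * I)%type unit := fun p _ => (enum_val p.1 == p.2)%:R.
Definition max_in I : Op R ('I_#|I| * I)%type := mm (@rank_vec I) (adj (@rank_vec I)).

Lemma max_inE I p q : @max_in I p q = (enum_val p.1 == p.2)%:R * (enum_val q.1 == q.2)%:R.
Proof.
rewrite /max_in /mm (bigD1 tt) //= big1 ?addr0 /adj /rank_vec; last by case.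
by rewrite conjc_nat.
Qed.

Definition unrank I O (p : 'I_#|I| * O) : I * O := (enum_val p.1, p.2).

Lemma unrank_bij I O : bijective (@unrank I O).
Proof.
exists (fun p => (enum_rank p.1, p.2)) => -[x o]; rewrite /unrank /=.
  by rewrite enum_valK.
by rewrite enum_rankK.
Qed.

Lemma kapp_max_in I O (K : kern R I O) :
  kapp (@kext R 'I_#|I| _ _ K) (@max_in I) = relabel (@unrank I O) (kmat K).
Proof.
apply: matP => p q; rewrite kappE /relabel /unrank /kmat /=.
rewrite -(sum_delta (enum_val p.1) (enum_val q.1) (fun x x' => K p.2 q.2 x x')).
apply: eq_bigr => x _; apply: eq_bigr => x' _.
by rewrite max_inE /= -natrM mulnb /delta [_ == x]eq_sym [_ == x']eq_sym.
Qed.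

Definition max_state I : Op R ('I_#|I| * I)%type := mscale (#|I|%:R^-1) (@max_in I).

Lemma card_invC I : (#|I|%:R^-1 : C) = (#|I|%:R^-1 : R)%:C.
Proof. by rewrite fmorphV rmorph_nat. Qed.

Lemma max_state_state I : (0 < #|I|)%N -> is_state (@max_state I).
Proof.
move=> I0; split; first by rewrite /max_state card_invC; apply: psdZ (psd_gram _); rewrite
    invr_ge0 ler0n.
rewrite /max_state optrZ /optr sum_pair.
transitivity (#|I|%:R^-1 * \sum_(r < #|I|) 1 : C).
  congr (_ * _); apply: eq_bigr => r _; rewrite (bigD1 (enum_val r)) //= max_inE eqxx mulr1.
  by rewrite big1 ?addr0 // => x; rewrite max_inE /= eq_sym => /negbTE ->; rewrite mul0r.
by rewrite sumr_const card_ord mulVf // pnatr_eq0 -lt0n.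
Qed.

Lemma kappZ T I O (K : kern R I O) (c : C) (X : Op R (T * I)%type) :
  kapp (@kext R T _ _ K) (mscale c X) = mscale c (kapp (@kext R T _ _ K) X).
Proof.
apply: matP => p q; rewrite /mscale !kappE mulr_sumr; apply: eq_bigr => x _.
by rewrite mulr_sumr; apply: eq_bigr => x' _; rewrite mulrCA.
Qed.

Definition choi_op I O (K : kern R I O) : Op R (I * O)%type := mscale (#|I|%:R^-1) (kmat K).

Lemma kapp_max_state I O (K : kern R I O) :
  kapp (@kext R 'I_#|I| _ _ K) (@max_state I) = relabel (@unrank I O) (choi_op K).
Proof. by rewrite kappZ kapp_max_in. Qed.

(** Choi's criterion: complete positivity with reference ['I_#|I|], at the maximally entangled
    input, is positivity of the Choi matrix up to relabelling. *)
Lemma channel_psd I O (K : kern R I O) : is_channel K -> psd (kmat K).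
Proof.
move=> [h _]; have := h _ (@max_in I) (psd_gram _); rewrite kapp_max_in.
have [g gK Kg] := unrank_bij I O; move=> /(psd_relabel g); congr psd.
by apply: matP => p q; rewrite /relabel !Kg.
Qed.

Lemma kmat_channel I O (K : kern R I O) : psd (kmat K) -> trace_pres K -> is_channel K.
Proof.
move=> pK tK; split; first by move=> k X; apply: kapp_psd.
move=> X; rewrite /optr /kapp exchange_big /=; apply: eq_bigr => x _.
rewrite exchange_big (bigD1 x) //= [X in _ + X]big1 ?addr0 => [|x' /negbTE hx]; last first.
  by rewrite -mulr_suml tK eq_sym hx mul0r.
by rewrite -mulr_suml tK eqxx mul1r.
Qed.

Lemma channel_state T I O (K : kern R I O) (X : Op R (T * I)%type) :
  is_channel K -> is_state X -> is_state (kapp (@kext R T _ _ K) X).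
Proof.
move=> cK [pX tX]; split; first by apply: kapp_psd => //; apply: channel_psd.
rewrite (@optr_kapp T I O K X 1) ?tX ?mulr1 // => x x'.
by rewrite mulr1 channel_tp.
Qed.

Lemma optr_kmat I O (K : kern R I O) : trace_pres K -> optr (kmat K) = #|I|%:R.
Proof.
move=> tK; rewrite /optr sum_pair.
under eq_bigr => x _ do rewrite /kmat /= tK eqxx.
by rewrite sumr_const.
Qed.

Lemma choi_state I O (K : kern R I O) : (0 < #|I|)%N -> is_channel K -> is_state (choi_op K).
Proof.
move=> I0 cK; split.
  rewrite /choi_op card_invC; apply: psdZ; first by rewrite invr_ge0 ler0n.
  exact: channel_psd.
by rewrite optrZ optr_kmat ?mulVf ?pnatr_eq0 -?lt0n //; apply: channel_tp.
Qed.
End Channels.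

(** * Twirling and unitary designs *)

Section Covariance.
Variable R : realType.
Local Notation C := R[i].
Local Notation "x %:C" := (real_complex R x).
Implicit Types I J O T E F : finType.

Lemma mm_opten I J (A A' : Op R I) (B B' : Op R J) :
  mm (opten A B) (opten A' B') = opten (mm A A') (mm B B').
Proof.
apply: matP => p q; rewrite /mm /opten sum_pair big_distrlr /=.
by apply: eq_bigr => i _; apply: eq_bigr => j _; ring.
Qed.

Lemma adj_opten I J (A : Op R I) (B : Op R J) : adj (opten A B) = opten (adj A) (adj B).
Proof. by apply: matP => p q; rewrite /adj /opten rmorphM. Qed.

Lemma opten1 I J : opten (@opid R I) (@opid R J) = @opid R _.
Proof. by apply: matP => -[i j] [i' j']; rewrite /opten /opid /= -natrM mulnb. Qed.

Lemma unitary_opten I J (A : Op R I) (B : Op R J) :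
  unitary A -> unitary B -> unitary (opten A B).
Proof.
move=> uA uB; rewrite /unitary -opten1 -(unitaryl uA) -(unitaryl uB) -mm_opten.
by rewrite -adj_opten.
Qed.

(** An input symmetry [U] acts on the reference leg of a Choi matrix by its entrywise conjugate. *)
Definition conjm I J (U : mat R I J) : mat R I J := fun i j => conjc (U i j).

Lemma unitary_conjm I (U : Op R I) : unitary U -> unitary (conjm U).
Proof.
move=> uU; apply: matP => i j; have := congr1 (fun Z => conjc (Z i j)) (unitaryl uU).
rewrite /opid conjc_nat => <-; rewrite /opmul /mm rmorph_sum; apply: eq_bigr => k _.
by rewrite rmorphM.
Qed.

Definition ptr2 I O (M : Op R (I * O)%type) : Op R I := fun x x' => \sum_o M (x, o) (x', o).

(** The partial trace is cyclic in the factor traced out, where [B] meets [B']. *)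
Lemma ptr2_sandwich I O (A A' : Op R I) (B B' : Op R O) M : mm B' B = @opid R O ->
  ptr2 (mm (opten A B) (mm M (opten A' B'))) = mm A (mm (ptr2 M) A').
Proof.
move=> e; apply: matP => x x'; rewrite /ptr2.
transitivity (\sum_y \sum_y' A x y * A' y' x' *
    \sum_p \sum_p' (\sum_o B' p' o * B o p) * M (y, p) (y', p')).
  rewrite /mm /opten /=; under eq_bigr => o _ do rewrite sum_pair.
  rewrite exchange_big; apply: eq_bigr => y _ /=.
  under eq_bigr => o _ do under eq_bigr => p _ do rewrite sum_pair mulr_sumr.
  under eq_bigr => o _ do rewrite exchange_big.
  rewrite exchange_big; apply: eq_bigr => y' _ /=.
  rewrite exchange_big mulr_sumr; apply: eq_bigr => p _ /=.
  under eq_bigr => o _ do rewrite mulr_sumr.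
  rewrite exchange_big mulr_sumr; apply: eq_bigr => p' _ /=.
  rewrite mulr_suml mulr_sumr; apply: eq_bigr => o _; ring.
have eB p p' : \sum_o B' p' o * B o p = (p' == p)%:R by rewrite -[LHS]/(mm B' B p' p) e.
rewrite {1}/mm; apply: eq_bigr => y _; rewrite /mm mulr_sumr; apply: eq_bigr => y' _.
rewrite mulr_suml mulr_sumr mulr_sumr; apply: eq_bigr => p _.
under eq_bigr => p' _ do rewrite eB.
rewrite (bigD1 p) //= big1 ?addr0 ?eqxx; last by move=> p' /negbTE ->; rewrite mul0r.
by rewrite mul1r; ring.
Qed.

Definition twirling (G : Type) I O (Gam : G -> Op R (I * O)%type) :=
  (forall g, unitary (Gam g)) /\
  forall M, (forall g, mm (Gam g) M = mm M (Gam g)) ->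
    forall x x', ptr2 M x x' = (x == x')%:R * (optr M / #|I|%:R).

(* Orthogonality relations: averaging over [U] is the completely depolarising map. *)
Definition design (G I : finType) (U : G -> Op R I) :=
  forall x y x' y', \sum_g U g x y * conjc (U g x' y') =
    (x == x')%:R * (y == y')%:R * (#|G|%:R / #|I|%:R).

(** The marginal of an invariant [M] is fixed by every [conjm (U g)], hence equals its own average
    over [G], which the orthogonality relations make a multiple of the identity. *)
Lemma design_twirling (G I O : finType) (U : G -> Op R I) (W : G -> Op R O) :
  (0 < #|G|)%N -> (forall g, unitary (U g)) -> (forall g, unitary (W g)) -> design U ->
  twirling (fun g => opten (conjm (U g)) (W g)).
Proof.
move=> G0 uU uW dU; have uG g := unitary_opten (unitary_conjm (uU g)) (uW g).
split=> // M cM x x'.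
have e g : ptr2 M = mm (conjm (U g)) (mm (ptr2 M) (adj (conjm (U g)))).
  rewrite -(@ptr2_sandwich _ _ _ _ (W g) (adj (W g))) ?unitaryl // -adj_opten mmA cM.
  by rewrite -mmA unitaryr // mm1r.
have Gn : #|G|%:R != 0 :> C by rewrite pnatr_eq0 -lt0n.
apply: (mulfI Gn).
have -> : #|G|%:R * ptr2 M x x' =
    \sum_g mm (conjm (U g)) (mm (ptr2 M) (adj (conjm (U g)))) x x'.
  rewrite (eq_bigr (fun=> ptr2 M x x')) => [|g _]; last by rewrite -e.
  by rewrite sumr_const mulr_natl.
transitivity (\sum_y \sum_y' ptr2 M y y' * conjc (\sum_g U g x y * conjc (U g x' y'))).
  rewrite exchange_big; apply: eq_bigr => y _ /=.
  under eq_bigr => g _ do rewrite mulr_sumr.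
  rewrite exchange_big /=; apply: eq_bigr => y' _.
  rewrite rmorph_sum mulr_sumr; apply: eq_bigr => g _.
  by rewrite rmorphM /= /adj /conjm; ring.
have -> : optr M = \sum_y ptr2 M y y by rewrite /optr sum_pair.
rewrite mulr_suml !mulr_sumr; apply: eq_bigr => y _.
under eq_bigr => y' _ do rewrite dU.
rewrite (bigD1 y) //= big1 ?addr0 ?eqxx; last first.
  by move=> y' /negbTE; rewrite eq_sym => ->; rewrite !(mulr0, mul0r) conjc0 mulr0.
rewrite mulr1 !rmorphM /= !conjc_nat conjc_inv conjc_nat; ring.
Qed.
End Covariance.

(** * Simulating channels from a covariant filter, and [n]-fold channels *)

Section Simulation.
Variable R : realType.
Local Notation C := R[i].
Local Notation "x %:C" := (real_complex R x).
Implicit Types I J O T E F : finType.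

Lemma comm_adj I (U K : Op R I) : unitary U -> mm U K = mm K U ->
  mm U (adj K) = mm (adj K) U.
Proof.
move=> uU /(congr1 (@adj R _ _)); rewrite !adjM => /(congr1 (fun Z => mm U (mm Z U))).
by rewrite -!mmA unitaryl // mm1r (mmA U (adj U)) unitaryr // mm1l.
Qed.

(* Covariance makes the partial trace of [K J] over the output proportional to the identity,
   so the overlap of the purified outputs is the same for every input state. *)
Lemma twirl_simulator (G : Type) I O (Gam : G -> Op R (I * O)%type) (N : kern R I O)
    (K : Op R (I * O)%type) (w : R) :
  (0 < #|I|)%N -> twirling Gam -> is_channel N ->
  (forall g, mm (Gam g) (kmat N) = mm (kmat N) (Gam g)) ->
  (forall g, mm (Gam g) K = mm K (Gam g)) ->
  2^-1 < w -> w <= rtr (mm K (choi_op N)) ->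
  let t := rtr (mm K (mm (choi_op N) (adj K))) in t <= 1 ->
  exists Nt : kern R I O, [/\ is_channel Nt,
    forall T (X : Op R (T * I)%type), is_state X ->
      w ^+ 2 <= fidelity (kapp (@kext R T _ _ N) X) (kapp (@kext R T _ _ Nt) X),
    2 * w - 1 <= t &
    kmat Nt = mscale (t^-1)%:C (mm K (mm (kmat N) (adj K)))].
Proof.
move=> I0 [uG tw] cN cJ cK w2 hw t t1.
have w0 : 0 < w by lra.
have pJ := channel_psd cN; have [ps ts] := choi_state I0 cN.
have In : #|I|%:R != 0 :> C by rewrite pnatr_eq0 -lt0n.
(* Gentle measurement for [adj K]; with [w > 1/2] it makes [t] positive, so dividing by [t] is
   legitimate. *)
have ht : 2 * w - 1 <= t.
  have := @gentle_test R _ (adj K) (choi_op N) w ps.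
  have -> : rtr (mm (adj K) (choi_op N)) = rtr (mm K (choi_op N)).
    by rewrite -rtr_adj adjM adjK (psd_herm ps) rtrC.
  move=> /(_ hw); rewrite adjK {1}/rtr ts /=.
  by have -> : rtr (mm (mm (adj K) K) (choi_op N)) = t by rewrite /t -mmA [LHS]rtrC -mmA.
have t0 : 0 < t by lra.
have cKJ g : mm (Gam g) (mm K (kmat N)) = mm (mm K (kmat N)) (Gam g).
  by rewrite mmA cK -mmA cJ mmA.
have cKJK g : mm (Gam g) (mm K (mm (kmat N) (adj K))) = mm (mm K (mm (kmat N) (adj K))) (Gam g).
  rewrite (mmA K); move: (mm K _) cKJ => Z cZ.
  by rewrite mmA cZ -!mmA (comm_adj (uG g) (cK g)).
have tE : optr (mm K (mm (kmat N) (adj K))) / #|I|%:R = t%:C.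
  have p : psd (mm K (mm (choi_op N) (adj K))) by apply: psd_congr.
  by rewrite /t -psd_optrE // /choi_op mmZl mmZr optrZ mulrC.
set X := mm K (mm (kmat N) (adj K)) in tE cKJK *.
have ptX : psd (mscale (t^-1)%:C X).
  by apply: psdZ; [rewrite invr_ge0 ltW | apply: psd_congr].
(* By twirling the reference marginal of [X] is [t] times the identity, so [X / t] is trace
   preserving. *)
exists (matk (mscale (t^-1)%:C X)); rewrite matkK; split=> //.
  apply: kmat_channel; rewrite ?matkK // => x x'.
  transitivity ((t^-1)%:C * ptr2 X x x'); first by rewrite mulr_sumr.
  by rewrite tw // tE mulrCA -rmorphM /= mulVf ?gt_eqF // mulr1.
move=> T Y [pY tY]; rewrite fidelityE.
have [L eL] := psdP pJ; have [S eS] := psdP pY.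
(* [L2] factors the Choi matrix of the simulator with the same inner index as [L], so both outputs
   have purifications on one environment. *)
pose c := (Num.sqrt t)^-1; pose L2 := mscale c%:C (mm K L).
have c0 : 0 <= c by rewrite invr_ge0 sqrtr_ge0.
have e1 : kapp (@kext R T _ _ N) Y = mm (gout L S) (adj (gout L S)).
  by rewrite goutE -eL -eS.
have e2 : kapp (@kext R T _ _ (matk (mscale (t^-1)%:C X))) Y = mm (gout L2 S) (adj (gout L2 S)).
  rewrite goutE -eS; congr (kapp (kext (matk _)) _).
  rewrite /L2 adjZ conjc_real mmZl mmZr mscaleA -rmorphM /= adjM -!mmA (mmA L) -eL.
  by congr mscale; rewrite /c -invfM -expr2 sqr_sqrtr // ltW.
rewrite e1 e2; suff h : w <= root_fidelity (mm (gout L S) (adj (gout L S)))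
    (mm (gout L2 S) (adj (gout L2 S))).
  by apply: lerXn2r; rewrite ?nnegrE ?root_fidelity_ge0 // ltW.
apply: le_trans (root_fidelity_gram _ _); rewrite rtrC goutE -eS /rtr.
rewrite (@optr_kapp _ _ _ _ _ _ (c%:C * (optr (mm K (choi_op N))))); last first.
  move=> x x'; transitivity (c%:C * ptr2 (mm K (kmat N)) x x').
    by rewrite mulr_sumr; apply: eq_bigr => o _; rewrite /matk /L2 mmZl -mmA -eL.
  by rewrite tw // /choi_op mmZr optrZ; ring.
(* As [t <= 1], the factor [c] is at least 1 and normalisation can only increase the overlap. *)
rewrite tY mulr1 ReZ -/(rtr _); apply: (le_trans hw); rewrite ler_peMl //.
  by apply: le_trans (ltW w0) hw.
by rewrite invf_ge1 ?sqrtr_gt0 // -sqrtr1 ler_wsqrtr.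
Qed.

Section Powers.
Variable n : nat.
Variables (In On I O : finType) (f : In -> 'I_n -> I) (g : On -> 'I_n -> O).

(** The index types are abstract, with coordinate maps [f] and [g], because [kpow] uses pairs of
    sequences while [tpow] uses sequences of pairs. The instances are [zipf] for the former and [ev]
    for plain sequences. *)
Definition kern_seq (K : kern R I O) : kern R In On :=
  fun o o' x x' => \prod_(t < n) K (g o t) (g o' t) (f x t) (f x' t).

Definition pair_seq (p : In * On) : {ffun 'I_n -> (I * O)%type} := [ffun t => (f p.1 t, g p.2 t)].

Lemma kmat_kern_seq K : kmat (kern_seq K) = relabel pair_seq (tpow n (kmat K)).
Proof.
apply: matP => p q; rewrite /kmat /kern_seq /relabel /tpow /tens; apply: eq_bigr => t _.
by rewrite !ffunE.
Qed.

Lemma relabel_opten (A : 'I_n -> Op R I) (B : 'I_n -> Op R O) :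
  relabel pair_seq (tens (fun t => opten (A t) (B t))) =
  opten (relabel (fun x => [ffun t => f x t]) (tens A)) (relabel (fun y => [ffun t => g y t])
      (tens B)).
Proof.
apply: matP => p q; rewrite /relabel /opten /tens -big_split /=; apply: eq_bigr => t _.
by rewrite !ffunE.
Qed.

Hypotheses (bf : bijective (fun x => [ffun t => f x t])) (bg : bijective (fun y => [ffun t => g y
    t])).

Lemma pair_seq_bij : bijective pair_seq.
Proof.
have [f' fK Kf] := bf; have [g' gK Kg] := bg.
exists (fun z : {ffun 'I_n -> (I * O)%type} =>
   (f' [ffun t => (z t).1], g' [ffun t => (z t).2])).
  move=> [x y]; rewrite -[x in RHS]fK -[y in RHS]gK; congr (f' _, g' _);
    by apply/ffunP => t; rewrite !ffunE.
move=> z; apply/ffunP => t; rewrite ffunE /=.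
have := congr1 (fun h : {ffun _} => h t) (Kf [ffun t => (z t).1]).
have := congr1 (fun h : {ffun _} => h t) (Kg [ffun t => (z t).2]).
by rewrite !ffunE => -> ->; case: (z t).
Qed.

Lemma card_pow : #|In| = (#|I| ^ n)%N.
Proof. by rewrite (bij_eq_card bf) card_ffun card_ord. Qed.

Lemma design_kern_seq (G : finType) (U : G -> Op R I) : design U ->
  design (fun gs : {ffun 'I_n -> G} =>
    relabel (fun x => [ffun t => f x t]) (tens (fun t => U (gs t)))).
Proof.
move=> dU x y x' y'; rewrite /relabel /tens.
transitivity (\sum_(gs : {ffun 'I_n -> G}) \prod_(t < n)
    (U (gs t) (f x t) (f y t) * conjc (U (gs t) (f x' t) (f y' t)))).
  apply: eq_bigr => gs _; rewrite rmorph_prod -big_split; apply: eq_bigr => t _ /=.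
  by rewrite !ffunE.
rewrite -(bigA_distr_bigA (fun t h => U h (f x t) (f y t) * conjc (U h (f x' t) (f y' t)))).
under eq_bigr => t _ do rewrite dU.
rewrite !big_split /= prodfV !prodr_const card_ord card_pow card_ffun card_ord !natrX.
congr (_ * _ * _).
  rewrite -(inj_eq (bij_inj bf)) -prod_eq_nat; apply: eq_bigr => t _.
  by rewrite !ffunE.
rewrite -(inj_eq (bij_inj bf)) -prod_eq_nat; apply: eq_bigr => t _.
by rewrite !ffunE.
Qed.

Lemma kern_seq_channel K : is_channel K -> is_channel (kern_seq K).
Proof.
move=> cK; apply: kmat_channel.
  rewrite kmat_kern_seq; exact/psd_relabel/psd_tpow/channel_psd.
move=> x x'; have tK := channel_tp cK.
rewrite -(inj_eq (bij_inj bf)) -prod_eq_nat.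
transitivity (\prod_(t < n) \sum_o K o o (f x t) (f x' t)); last first.
  by apply: eq_bigr => t _; rewrite tK !ffunE.
rewrite bigA_distr_bigA [RHS](reindex _ (onW_bij _ bg)); apply: eq_bigr => y _ /=.
by apply: eq_bigr => t _; rewrite !ffunE.
Qed.

Lemma choi_kern_seq K : choi_op (kern_seq K) = relabel pair_seq (tpow n (choi_op K)).
Proof.
rewrite /choi_op kmat_kern_seq card_pow; apply: matP => p q.
rewrite /mscale /relabel /tpow /tens big_split /= prodr_const card_ord.
by rewrite natrX exprVn.
Qed.
End Powers.

End Simulation.

(** * The approximating channel for large [n] *)

Section Asymptotics.
Variable R : realType.
Local Notation C := R[i].
Local Notation "x %:C" := (real_complex R x).
Implicit Types I J O T E F : finType.

Lemma ople_scale I (X : Op R I) (a b : R) : psd X -> a <= b ->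
  ople (mscale a%:C X) (mscale b%:C X).
Proof.
move=> pX ab; have := @psdZ R I X (b - a); rewrite subr_ge0 => /(_ ab pX); congr psd.
by apply: matP => i j; rewrite /mscale /opsub rmorphB mulrBl.
Qed.

(** If [Y v = 0], the form of [X = S S^+] at [v] is at most 0, so [S^+ v = 0]. *)
Lemma supp_dom I (X Y : Op R I) (c : R) : psd X -> ople X (mscale c%:C Y) -> supp_le X Y.
Proof.
move=> /psdP[S ->] h v hv; pose w : mat R I unit := fun i _ => v i.
have e : mm Y w = fun _ _ => 0.
  by apply: matP => i j; have := congr1 (fun u => u i) hv.
have z : hs (mm (adj S) w) = 0.
  apply/eqP; rewrite eq_le hs_ge0 andbT.
  have := rtr_ople h (psd_gram w).
  rewrite mmZl (mmA Y) e rtrZ.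
  have -> : mm (fun _ _ => 0) (adj w) = (fun _ _ => 0) :> Op R I.
    by apply: matP => i j; rewrite /mm big1 // => k _; rewrite mul0r.
  have -> : rtr (fun _ _ : I => 0 : C) = 0 by rewrite /rtr /optr big1.
  rewrite mulr0 /hs adjM adjK; congr (_ <= _).
  by rewrite mmA rtrC -!mmA.
have := congr1 (mm S) (hs_eq0 z); rewrite mmA => hz.
apply/funext => i; have := congr1 (fun M => M i tt) hz.
rewrite -[LHS]/(opapp _ _ _) => ->.
by rewrite /mm big1 // => k _; rewrite mulr0.
Qed.

Definition covariant (G I O : finType) (U : G -> Op R I) (W : G -> Op R O) (K : kern R I O) :=
  forall g, mm (opten (conjm (U g)) (W g)) (kmat K) = mm (kmat K) (opten (conjm (U g)) (W g)).

Lemma mm_choi_comm I O (K : kern R I O) (X : Op R (I * O)%type) :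
  mm X (kmat K) = mm (kmat K) X -> mm (choi_op K) X = mm X (choi_op K).
Proof. by move=> h; rewrite /choi_op mmZl mmZr h. Qed.

Lemma choi_dom I O (N E : kern R I O) (c : R) : ople (kmat N) (mscale c%:C (kmat E)) ->
  ople (choi_op N) (mscale c%:C (choi_op E)).
Proof.
move=> h; rewrite /choi_op mscaleA mulrC -mscaleA card_invC.
by apply: opleZ => //; rewrite invr_ge0 ler0n.
Qed.

Lemma choi_op_psd I O (K : kern R I O) : psd (kmat K) -> psd (choi_op K).
Proof. by move=> p; rewrite /choi_op card_invC; apply: psdZ => //; rewrite invr_ge0 ler0n. Qed.

Section Covariant.
Variables (G I O : finType) (U : G -> Op R I) (W : G -> Op R O) (N E : kern R I O) (c : R).
Hypotheses (I0 : (0 < #|I|)%N) (G0 : (0 < #|G|)%N).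
Hypotheses (uU : forall g, unitary (U g)) (uW : forall g, unitary (W g)) (dU : design U).
Hypotheses (cN : is_channel N) (pE : psd (kmat E)).
Hypotheses (covN : covariant U W N) (covE : covariant U W E).
Hypothesis dom : ople (kmat N) (mscale c%:C (kmat E)).

(** The coordinate maps are quantified after the threshold, so that the rate bound can use [zipf]
    and the relative entropy bound [ev]. *)
Lemma covariant_simulator (d e : R) : 0 < d -> 0 < e ->
  exists n0 : nat, forall n, (n0 <= n)%N ->
  forall (In On : finType) (f : In -> 'I_n -> I) (g : On -> 'I_n -> O),
    bijective (fun x => [ffun t => f x t]) -> bijective (fun y => [ffun t => g y t]) ->
  exists Nt : kern R In On, [/\ is_channel Nt,
    forall T (X : Op R (T * In)%type), is_state X ->
      1 - e <= fidelity (kapp (@kext R T _ _ (kern_seq f g N)) X) (kapp (@kext R T _ _ Nt) X) &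
    ople (kmat Nt) (mscale (pow2 (n%:R * (rel_ent (choi_op N) (choi_op E) + d)))%:C
                           (kmat (kern_seq f g E)))].
Proof.
move=> d0 e0; set D := rel_ent _ _.
have sN := choi_state I0 cN; have pcE := choi_op_psd pE.
(* With [w = 1 - e'] the fidelity is at least [w^2 >= 1 - 2 e' >= 1 - e], while [4 e' <= 1] gives
   [w > 1/2] and [t >= 2 w - 1 >= 1/2]. *)
pose e' := Num.min e 1 / 4.
have e'0 : 0 < e' by rewrite divr_gt0 // lt_min e0 ltr01.
have [e'e e'1] : 4 * e' <= e /\ 4 * e' <= 1.
  by rewrite /e' mulrC divfK // !ge_min !lexx orbT.
have d2 : 0 < d / 2 by rewrite divr_gt0.
have [n1 hn1] := aep sN pcE (supp_dom sN.1 (choi_dom dom)) d2 e'0.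
(* Half of [d] is spent in [aep]; for these [n] the other half gives [2^(n d / 2) >= 2 >= 1 / t]. *)
have [n2 hn2] := nat_large (2 / d).
exists (maxn n1 n2) => n; rewrite geq_max => /andP[/hn1[K] /=].
rewrite -/D; set r := tpow n _; set s := tpow n _.
move=> [[K_le K_tr] K_comm _ _ [K_w _]] /hn2 nd In On f g bf bg.
have bpair := pair_seq_bij bf bg.
have In0 : (0 < #|In|)%N by rewrite (card_pow bf) expn_gt0 I0.
pose Un (gs : {ffun 'I_n -> G}) := relabel (fun x => [ffun t => f x t]) (tens (fun t => U (gs t))).
pose Wn (gs : {ffun 'I_n -> G}) := relabel (fun y => [ffun t => g y t]) (tens (fun t => W (gs t))).
pose Gt (gs : {ffun 'I_n -> G}) := tens (fun t => opten (conjm (U (gs t))) (W (gs t))).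
have Gam gs : opten (conjm (Un gs)) (Wn gs) = relabel (pair_seq f g) (Gt gs).
  rewrite /Gt relabel_opten; congr opten; apply: matP => x y.
  by rewrite /conjm /Un /relabel /tens rmorph_prod.
have comm (K0 : kern R I O) gs : covariant U W K0 ->
    mm (tpow n (choi_op K0)) (Gt gs) = mm (Gt gs) (tpow n (choi_op K0)).
  by move=> h; rewrite /Gt /tpow !mm_tens; congr tens; apply/funext => t; apply/mm_choi_comm.
have tw : twirling (fun gs => opten (conjm (Un gs)) (Wn gs)).
  apply: design_twirling; last exact: design_kern_seq.
  - by rewrite card_ffun card_ord expn_gt0 G0.
  - by move=> gs; apply: unitary_relabel => //; apply: tens_unitary.
  - by move=> gs; apply: unitary_relabel => //; apply: tens_unitary.
pose K1 := relabel (pair_seq f g) K.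
have K1r : mm K1 (mm (choi_op (kern_seq f g N)) (adj K1)) = relabel (pair_seq f g) (mm K (mm r
    (adj K))).
  by rewrite (choi_kern_seq _ bf) 2!(relabel_mm bpair).
have kE (K0 : kern R I O) : kmat (kern_seq f g K0) = mscale #|In|%:R (choi_op (kern_seq f g K0)).
  by rewrite /choi_op mscaleA mulfV ?mscale1 // pnatr_eq0 -lt0n.
have [||||||Nt [cNt fid ht eNt]] := @twirl_simulator R _ _ _ _ (kern_seq f g N) K1 (1 - e') In0 tw.
- exact: kern_seq_channel.
- move=> gs; rewrite kE mmZl mmZr Gam (choi_kern_seq _ bf) -!(relabel_mm bpair).
  by rewrite comm.
- by move=> gs; rewrite Gam -!(relabel_mm bpair) K_comm // comm.
- lra.
- by rewrite (choi_kern_seq _ bf) -(relabel_mm bpair) rtr_relabel.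
- by rewrite K1r rtr_relabel.
exists Nt; split=> //.
  move=> T X sX; apply: le_trans (fid T X sX).
  have : 0 <= e' ^+ 2 by apply: sqr_ge0.
  rewrite sqrrB expr1n; lra.
set t := rtr _ in ht eNt.
have t2 : 2^-1 <= t by lra.
rewrite eNt kE mmZl mmZr K1r.
have t0 : 0 < t by lra.
have -> : n%:R * (D + d) = n%:R * (d / 2) + n%:R * (D + d / 2) by field.
rewrite (pow2D (n%:R * (d / 2))) rmorphM /= -mscaleA.
have pk : psd (mscale (pow2 (n%:R * (D + d / 2)))%:C (kmat (kern_seq f g E))).
  by apply: psdZ; rewrite ?pow2_ge0 // kmat_kern_seq; apply/psd_relabel/psd_tpow.
apply: ople_trans (ople_scale pk (_ : t^-1 <= _)); last first.
  rewrite -[X in X <= _](pow2_log2 (_ : 0 < t^-1)) ?invr_gt0 // ler_pow2.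
  apply: (@le_trans _ _ 1); last first.
    by move: nd; rewrite ler_pdivrMr // => nd; lra.
  rewrite -[X in _ <= X]log2_pow2 ler_log2 ?invr_gt0 //.
  by rewrite -[pow2 1]invrK lef_pV2 ?posrE ?invr_gt0 ?pow2_gt0 // /pow2 mul1r lnK ?posrE.
apply: opleZ; first by rewrite invr_ge0 ltW.
rewrite (kE E) mscaleA mulrC -mscaleA.
have -> : (#|In|%:R : C) = (#|In|%:R : R)%:C by rewrite rmorph_nat.
apply: opleZ; first by rewrite ler0n.
rewrite (choi_kern_seq _ bf); exact: (ople_relabel (pair_seq f g) K_le).
Qed.
End Covariant.
End Asymptotics.

(** * Relative entropy of covariant outputs *)

Section RelativeEntropyBound.
Variable R : realType.
Local Notation C := R[i].
Local Notation "x %:C" := (real_complex R x).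
Implicit Types I J O T E F : finType.

Definition ev n I (x : {ffun 'I_n -> I}) (t : 'I_n) : I := x t.

Lemma ev_bij n I : bijective (fun x => [ffun t => @ev n I x t]).
Proof.
by exists id => x; apply/ffunP => t; rewrite ffunE.
Qed.

Lemma kapp_tpow n T I O (K : kern R I O) (X : Op R (T * I)%type) :
  kapp (@kext R {ffun 'I_n -> T} _ _ (kern_seq (@ev n I) (@ev n O) K))
    (relabel (pair_seq (@ev n T) (@ev n I)) (tpow n X)) =
  relabel (pair_seq (@ev n T) (@ev n O)) (tpow n (kapp (@kext R T _ _ K) X)).
Proof.
apply: matP => p q; rewrite kappE /relabel /tpow /tens.
transitivity (\prod_(t < n) \sum_x \sum_x'
   (K (p.2 t) (q.2 t) x x' * X (p.1 t, x) (q.1 t, x'))); last first.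
  by apply: eq_bigr => t _; rewrite kappE !ffunE.
rewrite bigA_distr_bigA /=; apply: eq_bigr => x _.
rewrite bigA_distr_bigA /=; apply: eq_bigr => x' _.
rewrite /kern_seq -big_split; apply: eq_bigr => t _.
by rewrite !ffunE.
Qed.

Lemma root_fidelity_half I (X Y : Op R I) : 1 - 2^-1 <= fidelity X Y ->
  2^-1 <= root_fidelity X Y.
Proof.
move=> h; rewrite leNgt; apply/negP => l.
have := root_fidelity_ge0 X Y; move: h l; rewrite fidelityE.
move: (root_fidelity X Y) => r h l r0.
have : r ^+ 2 <= 2^-1 * 2^-1 by rewrite expr2 ler_pM // ltW.
lra.
Qed.

Section Covariant.
Variables (G I O : finType) (U : G -> Op R I) (W : G -> Op R O) (N E : kern R I O) (c : R).
Hypotheses (I0 : (0 < #|I|)%N) (G0 : (0 < #|G|)%N).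
Hypotheses (uU : forall g, unitary (U g)) (uW : forall g, unitary (W g)) (dU : design U).
Hypotheses (cN : is_channel N) (pE : psd (kmat E)).
Hypotheses (covN : covariant U W N) (covE : covariant U W E).
Hypothesis dom : ople (kmat N) (mscale c%:C (kmat E)).

(* Data processing for the teleportation-simulated pair, obtained operationally: the test that
   separates [N(X)^n] from [E(X)^n] also acts on the simulator, which is dominated by [E^n]
   with exponent [D] and close to [N^n]. *)
Lemma covariant_relent T (X : Op R (T * I)%type) : is_state X ->
  (relent (kapp (@kext R T _ _ N) X) (kapp (@kext R T _ _ E) X) <=
     (rel_ent (choi_op N) (choi_op E))%:E)%E.
Proof.
move=> sX; set rho := kapp _ X; set tau := kapp _ X; set D := rel_ent _ _.
have sr : is_state rho by apply: channel_state.
have pt : psd tau by apply: kapp_psd => //; apply: sX.1.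
have supp : supp_le rho tau by apply: (supp_dom sr.1 (kapp_diff sX.1 dom)).
rewrite (relentE supp) lee_fin leNgt; apply/negP => lt.
set D1 := rel_ent rho tau in lt.
(* The exponents [D + d] and [d - D1] then add up to [-2 d]. For [n >= 3 / d] at most [2^-6 = 1/64]
   is left, against the acceptance probability [(1/2)^2 / 4 = 1/16] that root fidelity [1/2]
   guarantees. *)
pose d := (D1 - D) / 4; have d0 : 0 < d by rewrite divr_gt0 // subr_gt0.
have e0 : 0 < 16^-1 :> R by rewrite invr_gt0.
have f0 : 0 < 2^-1 :> R by rewrite invr_gt0.
have [n1 hn1] := aep sr pt supp d0 e0.
have [n2 hn2] := covariant_simulator I0 G0 uU uW dU cN pE covN covE dom d0 f0.
have [n3 hn3] := nat_large (3 / d).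
pose n := maxn n1 (maxn n2 n3).
have l1 : (n1 <= n)%N by rewrite leq_max leqnn.
have l2 : (n2 <= n)%N by rewrite !leq_max leqnn orbT.
have l3 : (n3 <= n)%N by rewrite !leq_max leqnn !orbT.
have [K [_ _ [pK pK'] hK [_ hK']]] := hn1 n l1.
have [Nt [cNt fid Nt_le]] := hn2 n l2 _ _ _ _ (@ev_bij n I) (@ev_bij n O).
have := hn3 n l3.
have bpair J : bijective (pair_seq (@ev n T) (@ev n J)) by apply: pair_seq_bij; apply: ev_bij.
set Xn := relabel (pair_seq (@ev n T) (@ev n I)) (tpow n X).
have sXn : is_state Xn.
  have [pX tX] := state_tpow n sX; split; first exact: (psd_relabel _ pX).
  by rewrite (optr_relabel (bpair I)).
have := root_fidelity_half (fid _ _ sXn); rewrite kapp_tpow -/rho.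
set P := relabel _ (tpow n rho) => hF.
have sNt := channel_state cNt sXn.
have sP : is_state P.
  have [pX tX] := state_tpow n sr; split; first exact: (psd_relabel _ pX).
  by rewrite (optr_relabel (bpair O)).
set Sg := kapp _ Xn in hF sNt.
pose Q := relabel (pair_seq (@ev n T) (@ev n O)) (mm K (adj K)).
have hT : 2^-1 ^+ 2 / 4 <= rtr (mm Q Sg).
  apply: (@fidelity_test _ _ P Sg Q (2^-1)) => //.
  - exact: sP.1.
  - exact: sNt.1.
  - by rewrite /rtr sNt.2.
  - exact: (psd_relabel _ pK).
  - have := psd_relabel (pair_seq (@ev n T) (@ev n O)) pK'.
    by rewrite -[relabel _ _]/(msub (relabel _ (@opid R _)) Q) (relabel1 _ (bpair O)).
  - by rewrite /rtr sP.2.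
  - rewrite /P /Q -(relabel_mm (bpair O)) !(rtr_relabel (bpair O)) {1}/rtr (state_tpow n sr).2 /=.
    move: hK'; lra.
have := kapp_diff sXn.1 Nt_le; rewrite kapp_tpow -/tau -/D -/Sg => hS.
have := rtr_ople hS (psd_relabel (pair_seq (@ev n T) (@ev n O)) pK).
rewrite mmZl rtrZ [X in X <= _]rtrC -/Q.
rewrite [X in _ * X]rtrC /Q -(relabel_mm (bpair O)) (rtr_relabel (bpair O)) => h.
have := ler_wpM2l (pow2_ge0 (n%:R * (D + d))) hK.
rewrite -/D1 -pow2D => h2 hn.
have : n%:R * (D + d) + n%:R * (d - D1) <= - (6%:R).
  move: hn; rewrite ler_pdivrMr // => hn.
  have -> : n%:R * (D + d) + n%:R * (d - D1) = - (2 * (n%:R * d)) by rewrite /d; field.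
  lra.
rewrite -ler_pow2 pow2N => h3.
have h6 : pow2 6%:R = 64 :> R.
  by rewrite /pow2 mulr_natl -lnXn // lnK ?posrE ?exprn_gt0 // -natrX.
rewrite h6 in h3.
move: hT h h2 h3; rewrite /Q; lra.
Qed.
End Covariant.
End RelativeEntropyBound.

(** * Conditional entropy *)

Section Conditional.
Variable R : realType.
Local Notation C := R[i].
Local Notation "x %:C" := (real_complex R x).
Implicit Types I J X Y : finType.

Lemma rtr_ptr1 X Y (M : Op R (X * Y)%type) (S : Op R Y) :
  rtr (mm M (opten (@opid R X) S)) = rtr (mm (ptr1 M) S).
Proof.
rewrite /rtr; congr complex.Re; rewrite /optr sum_pair exchange_big /=.
apply: eq_bigr => y _; rewrite /mm /ptr1.
under [RHS]eq_bigr => y' _ do rewrite mulr_suml.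
rewrite [RHS]exchange_big /=; apply: eq_bigr => x _; rewrite sum_pair (bigD1 x) //=.
rewrite [X in _ + X]big1 ?addr0 => [|x' /negbTE hx]; last first.
  by apply: big1 => y' _; rewrite /opten /opid /= hx mul0r mulr0.
by apply: eq_bigr => y' _; rewrite /opten /opid /= eqxx mul1r.
Qed.

Lemma ptr1_psd X Y (M : Op R (X * Y)%type) : psd M -> psd (ptr1 M).
Proof.
case/psdP => S ->.
have -> : ptr1 (mm S (adj S)) = mm (fun y (e : X * (X * Y)) => S (e.1, y) e.2)
    (adj (fun y (e : X * (X * Y)) => S (e.1, y) e.2)).
  by apply: matP => y y'; rewrite /ptr1 /mm sum_pair.
exact: psd_gram.
Qed.

Lemma optr_ptr1 X Y (M : Op R (X * Y)%type) : optr (ptr1 M) = optr M.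
Proof. by rewrite /optr /ptr1 sum_pair exchange_big. Qed.

Lemma ptr1_state X Y (M : Op R (X * Y)%type) : is_state M -> is_state (ptr1 M).
Proof. by case=> p t; split; [apply: ptr1_psd | rewrite optr_ptr1]. Qed.

Lemma ptr1_sandwich X Y (A A' : Op R X) (B B' : Op R Y) M : mm A' A = @opid R X ->
  ptr1 (mm (opten A B) (mm M (opten A' B'))) = mm B (mm (ptr1 M) B').
Proof.
move=> e; pose sw (p : Y * X) := (p.2, p.1).
have bsw : bijective sw by exists (fun p : X * Y => (p.2, p.1)) => -[].
have swE (Z : Op R (X * Y)%type) : ptr1 Z = ptr2 (relabel sw Z) by [].
have swT (A0 : Op R X) (B0 : Op R Y) : relabel sw (opten A0 B0) = opten B0 A0.
  by apply: matP => p q; rewrite /relabel /opten /= mulrC.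
by rewrite !swE !(relabel_mm bsw) !swT ptr2_sandwich.
Qed.

Lemma opdiag_opten Y X (l : Y -> R) :
  opten (@opid R X) (opdiag l) = opdiag (fun p : X * Y => l p.2).
Proof.
apply: matP => -[x y] [x' y']; rewrite /opten /opid /opdiag /= xpair_eqE.
by case: eqP => /= _; rewrite ?mul1r ?mul0r.
Qed.

Lemma sd_opten Y X (V : Op R Y) l :
  opten (@opid R X) (sd V l) = sd (opten (@opid R X) V) (fun p : X * Y => l p.2).
Proof.
by rewrite /sd -opdiag_opten adj_opten adj_opid !mm_opten !mm1l.
Qed.

Lemma unitary1 X : unitary (@opid R X).
Proof. by rewrite /unitary -[LHS]/(mm (adj _) _) adj_opid mm1l. Qed.

Lemma funm_opten X Y f (S : Op R Y) : adj S = S ->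
  funm f (opten (@opid R X) S) = opten (@opid R X) (funm f S).
Proof.
move=> /herm_sd[V [l [uV e]]]; rewrite (funmE f uV e) sd_opten.
apply: funmE; first by apply: unitary_opten => //; apply: unitary1.
by rewrite e sd_opten.
Qed.

Lemma psd_opten X Y (S : Op R Y) : psd S -> psd (opten (@opid R X) S).
Proof.
case/psdP => L ->; rewrite -{1}[@opid R X]mm1l -mm_opten -{2}[@opid R X]adj_opid -adj_opten.
exact: psd_gram.
Qed.

Lemma proj_opten X Y (S : Op R Y) : proj S -> proj (opten (@opid R X) S).
Proof. by case=> h e; split; rewrite ?adj_opten ?mm_opten ?adj_opid ?mm1l ?h ?e. Qed.

Lemma sqr_sum_le X (a : X -> C) :
  (\sum_x a x) * conjc (\sum_x a x) <= #|X|%:R * \sum_x a x * conjc (a x).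
Proof.
set s := \sum_x a x; set q := \sum_x _.
have : 0 <= \sum_x \sum_y (a x - a y) * conjc (a x - a y).
  by apply: sumr_ge0 => x _; apply: sumr_ge0 => y _; apply: mulcJ_ge0.
have -> : \sum_x \sum_y (a x - a y) * conjc (a x - a y) = 2 * (#|X|%:R * q - s * conjc s).
  transitivity (\sum_x \sum_y (a x * conjc (a x) + a y * conjc (a y)
      - a x * conjc (a y) - a y * conjc (a x))).
    by apply: eq_bigr => x _; apply: eq_bigr => y _; rewrite rmorphB /=; ring.
  transitivity (\sum_x (#|X|%:R * (a x * conjc (a x)) + q - a x * conjc s - s * conjc (a x))).
    apply: eq_bigr => x _; rewrite !sumrB big_split /= sumr_const mulr_natl.
    by rewrite /s rmorph_sum mulr_sumr mulr_suml.
  rewrite !sumrB big_split /= sumr_const -mulr_natl -mulr_sumr -mulr_suml -mulr_sumr.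
  rewrite -/q -/s -[X in _ - _ - _ * X]rmorph_sum /= -/s; ring.
by rewrite pmulr_rge0 ?subr_ge0 // ltr0n.
Qed.

(** With [M = S S^+] the left form is a sum over [k] of [|sum_x b x x k|^2]. Cauchy-Schwarz costs
    the factor [#|X|], and adding the terms with [x' != x] yields the form of [1 (x) ptr1 M]. *)
Lemma ptr1_dom X Y (M : Op R (X * Y)%type) : psd M ->
  ople M (mscale #|X|%:R (opten (@opid R X) (ptr1 M))).
Proof.
case/psdP => S eM v.
pose b x x' k : C := \sum_y conjc (v (x, y)) * S (x', y) k.
have q1 : qf M v = \sum_k (\sum_x b x x k) * conjc (\sum_x b x x k).
  rewrite eM qfE mmA mmA -mmA.
  transitivity (\sum_k (\sum_p conjc (v p) * S p k) * conjc (\sum_p conjc (v p) * S p k)).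
    rewrite {1}/mm; apply: eq_bigr => k _; congr (_ * _).
    rewrite /mm /adj rmorph_sum; apply: eq_bigr => p _.
    by rewrite rmorphM /= conjcK mulrC.
  by apply: eq_bigr => k _; rewrite sum_pair.
have q2 : qf (opten (@opid R X) (ptr1 M)) v =
    \sum_k \sum_x \sum_x' b x x' k * conjc (b x x' k).
  transitivity (\sum_x \sum_x' \sum_k b x x' k * conjc (b x x' k)); last first.
    by under eq_bigr => x _ do rewrite exchange_big; rewrite exchange_big.
  rewrite /qf sum_pair; apply: eq_bigr => x _.
  transitivity (\sum_y \sum_y' conjc (v (x, y)) * ptr1 M y y' * v (x, y')).
    apply: eq_bigr => y _; rewrite sum_pair (bigD1 x) //= [X in _ + X]big1 ?addr0 => [|x' /negbTE
        hx].
      by apply: eq_bigr => y' _; rewrite /opten /opid /= eqxx mul1r.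
    by apply: big1 => y' _; rewrite /opten /opid /= eq_sym hx mul0r mulr0 mul0r.
  transitivity (\sum_y \sum_y' \sum_x' \sum_k
      (conjc (v (x, y)) * S (x', y) k) * (conjc (S (x', y') k) * v (x, y'))).
    apply: eq_bigr => y _; apply: eq_bigr => y' _.
    rewrite /ptr1 mulr_sumr mulr_suml; apply: eq_bigr => x' _.
    rewrite eM /mm mulr_sumr mulr_suml; apply: eq_bigr => k _.
    by rewrite /adj !mulrA.
  rewrite (eq_bigr _ (fun y _ => exchange_big _ _ _ _ _ _)) exchange_big.
  apply: eq_bigr => x' _ /=.
  rewrite (eq_bigr _ (fun y _ => exchange_big _ _ _ _ _ _)) exchange_big.
  apply: eq_bigr => k _ /=.
  rewrite /b rmorph_sum mulr_suml; apply: eq_bigr => y _; rewrite mulr_sumr.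
  by apply: eq_bigr => y' _; rewrite rmorphM /= conjcK [_ * v _]mulrC.
rewrite -/(qf _ v).
have -> : qf (opsub (mscale #|X|%:R (opten (@opid R X) (ptr1 M))) M) v =
    #|X|%:R * qf (opten (@opid R X) (ptr1 M)) v - qf M v.
  rewrite /qf mulr_sumr -sumrB; apply: eq_bigr => p _.
  rewrite mulr_sumr -sumrB; apply: eq_bigr => p' _.
  by rewrite /opsub /mscale; ring.
rewrite subr_ge0 q1 q2 mulr_sumr; apply: ler_sum => k _.
apply: le_trans (sqr_sum_le _) _; apply: ler_wpM2l; first exact: ler0n.
apply: ler_sum => x _; rewrite (bigD1 x) //= lerDl.
by apply: sumr_ge0 => x' _; apply: mulcJ_ge0.
Qed.

Lemma supp_ptr1 X Y (M : Op R (X * Y)%type) (S : Op R Y) :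
  supp_le M (opten (@opid R X) S) -> supp_le (ptr1 M) S.
Proof.
move=> h v hv; apply/funext => y; rewrite /opapp /ptr1.
under eq_bigr => y' _ do rewrite mulr_suml.
rewrite exchange_big big1 //= => x _.
have := h (fun p => (p.1 == x)%:R * v p.2).
have -> : opapp (opten (@opid R X) S) (fun p => (p.1 == x)%:R * v p.2) = fun=> 0.
  apply/funext => -[x1 y1]; rewrite /opapp sum_pair big1 // => x2 _.
  transitivity ((x1 == x2)%:R * (x2 == x)%:R * opapp S v y1).
    by rewrite /opapp mulr_sumr; apply: eq_bigr => y' _; rewrite /opten /opid /=; ring.
  by rewrite hv mulr0.
move=> /(_ erefl)/(congr1 (fun u => u (x, y))); rewrite /opapp sum_pair (bigD1 x) //=.
rewrite [X in _ + X]big1 ?addr0 => [|x' /negbTE hx]; last first.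
  by apply: big1 => y' _; rewrite hx mul0r mulr0.
by under eq_bigr => y' _ do rewrite eqxx mul1r.
Qed.

Lemma log2_le (x y : R) : 0 < x -> 0 < y -> x * (log2 y - log2 x) <= (y - x) / ln 2.
Proof.
move=> x0 y0; rewrite /log2 -mulrBl mulrA ler_pM2r ?invr_gt0 ?ln2_gt0 //.
rewrite -ln_div ?posrE //; apply: (@le_trans _ _ (x * (y / x - 1))).
  apply: ler_wpM2l; first exact: ltW.
  have := @le_ln1Dx R (y / x - 1); rewrite addrCA subrr addr0; apply.
  by rewrite ltrBrDr addNr divr_gt0.
by rewrite mulrBr mulr1 mulrC divfK // gt_eqF.
Qed.

(* Klein's inequality: expand both operators in eigenbases and use [ln x <= x - 1]. *)
Lemma klein I (rho sigma : Op R I) (s : R) : is_state rho -> psd sigma -> supp_le rho sigma ->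
  0 < s -> rtr sigma <= s ->
  rtr (mm rho (logm sigma)) <= rtr (mm rho (logm rho)) + log2 s.
Proof.
move=> [pr tr1] ps supp s0 tr.
have [V [p [uV p0 er]]] := psd_spectral pr; have [W [q [uW q0 es]]] := psd_spectral ps.
(* Squared overlaps of the two eigenbases, a doubly stochastic matrix: [sumj] and [sumi] express its
   row and column sums. *)
pose w i j : R := complex.Re (mm (adj V) W i j) ^+ 2 + complex.Im (mm (adj V) W i j) ^+ 2.
have w0 i j : 0 <= w i j by rewrite addr_ge0 ?sqr_ge0.
pose lg x : R := if 0 < x then log2 x else 0.
have sdw l l' : rtr (mm (sd V l) (sd W l')) = \sum_i \sum_j l i * l' j * w i j.
  rewrite rtr_sd; apply: eq_bigr => i _; rewrite /dg /sd -!mmA.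
  rewrite mmA {1}/mm Re_sum mulr_sumr; apply: eq_bigr => j _.
  rewrite mm_diagl -[V]adjK -adjM adjK /adj /w mulrCA.
  rewrite [_ * conjc _]mulrC.
  by case: (mm (adj V) W i j) => a b; rewrite ReZ /=; ring.
have sumj l : \sum_i \sum_j l i * w i j = \sum_i l i.
  have := sdw l (fun=> 1); rewrite (sd1 uW) mm1r.
  rewrite rtr_sd_sum // => ->.
  by apply: eq_bigr => i _; apply: eq_bigr => j _; rewrite mulr1.
have sumi l : \sum_i \sum_j l j * w i j = \sum_j l j.
  have := sdw (fun=> 1) l; rewrite (sd1 uV) mm1l.
  rewrite rtr_sd_sum // => ->.
  by apply: eq_bigr => i _; apply: eq_bigr => j _; rewrite mul1r.
have trs : \sum_j q j = rtr sigma by rewrite es rtr_sd_sum.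
have trr : \sum_i p i = 1.
  by rewrite -(rtr_sd_sum _ uV) -er /rtr tr1.
(* Support inclusion: the terms in which [logm sigma] replaces the logarithm of 0 by 0 carry no
   weight. *)
have pw0 j : q j = 0 -> forall i, p i * w i j = 0.
  rewrite es in supp => qj i.
  have : mm (adj V) (mm rho W) i j = 0.
    by rewrite {1}/mm big1 // => k _; rewrite (supp_eigen uW supp qj) mulr0.
  rewrite er /sd -!mmA mmA (unitaryl uV) mm1l mm_diagl /w.
  case: (mm (adj V) W i j) => a b /eqP; rewrite eq_complex /= !mul0r subr0 addr0.
  move=> /andP[/eqP h1 /eqP h2]; rewrite mulrDr !expr2 !mulrA.
  by rewrite h1 h2 !mul0r addr0.
rewrite /logm (funmE _ uW es) (funmE _ uV er).
have -> : rtr (mm rho (sd V (lg \o p))) = \sum_i \sum_j p i * lg (p i) * w i j.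
  by rewrite (sumj (fun i => p i * lg (p i))) er sdM // rtr_sd_sum.
rewrite {1}er sdw -subr_le0 opprD addrA -sumrB.
have -> : log2 s = \sum_i \sum_j p i * log2 s * w i j.
  by rewrite (sumj (fun i => p i * log2 s)) -mulr_suml trr mul1r.
rewrite -sumrB.
apply: (@le_trans _ _ (\sum_i \sum_j (q j / s - p i) / ln 2 * w i j)).
  apply: ler_sum => i _; rewrite -!sumrB; apply: ler_sum => j _.
  have [qj|qj] := eqVneq (q j) 0.
    have := pw0 j qj i; have [-> _|pi] := eqVneq (p i) 0.
      by rewrite !mul0r !subr0 qj mul0r !mul0r.
    move=> /eqP; rewrite mulf_eq0 (negbTE pi) /= => /eqP ->.
    by rewrite !mulr0 !subr0.
  have qp : 0 < q j by rewrite lt_def qj q0.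
  rewrite -!mulrBl; apply: ler_wpM2r => //.
  have [->|pi] := eqVneq (p i) 0.
    by rewrite !mul0r !subr0 !divr_ge0 // ltW // ln2_gt0.
  have pp : 0 < p i by rewrite lt_def pi p0.
  rewrite /= /lg qp pp -!mulrBr.
  have := log2_le pp (divr_gt0 qp s0).
  have -> : log2 (q j / s) = log2 (q j) - log2 s.
    by rewrite /log2 ln_div ?posrE // mulrBl.
  by rewrite addrAC.
have -> : \sum_i \sum_j (q j / s - p i) / ln 2 * w i j =
   (\sum_i \sum_j q j * w i j / s - \sum_i \sum_j p i * w i j) / ln 2.
  rewrite -sumrB mulr_suml; apply: eq_bigr => i _.
  rewrite -sumrB mulr_suml; apply: eq_bigr => j _; ring.
rewrite (sumj p) trr pmulr_lle0 ?invr_gt0 ?ln2_gt0 // subr_le0.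
under eq_bigr => i _ do rewrite -mulr_suml.
by rewrite -mulr_suml (sumi q) trs ler_pdivrMr // mul1r.
Qed.

Lemma rel_ent_opten X Y (rho : Op R (X * Y)%type) (sigma : Op R Y) : psd sigma ->
  rel_ent rho (opten (@opid R X) sigma) =
    rtr (mm rho (logm rho)) - rtr (mm (ptr1 rho) (logm sigma)).
Proof.
by move=> /psd_herm h; rewrite /rel_ent /logm funm_opten // rtr_ptr1.
Qed.

(** The logarithm of [1 (x) sigma] acts on [Y] alone, so Klein's inequality for the marginal
    suffices. The trace bound [s] is later [1 / #|A'|]. *)
Lemma rel_ent_opten_ge X Y (rho : Op R (X * Y)%type) (sigma : Op R Y) (s : R) :
  is_state rho -> psd sigma -> supp_le rho (opten (@opid R X) sigma) ->
  0 < s -> rtr sigma <= s ->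
  - condS rho - log2 s <= rel_ent rho (opten (@opid R X) sigma).
Proof.
move=> sr ps supp s0 ts; rewrite rel_ent_opten //.
have := klein (ptr1_state sr) ps (supp_ptr1 supp) s0 ts.
rewrite /condS /vN -!/(rtr (mm _ _)); lra.
Qed.

Lemma rel_ent_opten_eq X Y (rho : Op R (X * Y)%type) (s : R) : is_state rho -> 0 < s ->
  rel_ent rho (opten (@opid R X) (mscale s%:C (ptr1 rho))) = - condS rho - log2 s.
Proof.
move=> sr s0; have [pY tY] := ptr1_state sr.
rewrite rel_ent_opten; last by apply: psdZ => //; apply: ltW.
suff -> : rtr (mm (ptr1 rho) (logm (mscale s%:C (ptr1 rho)))) =
    rtr (mm (ptr1 rho) (logm (ptr1 rho))) + log2 s.
  rewrite /condS /vN -!/(rtr (mm _ _)); ring.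
have [V [p [uV p0 er]]] := psd_spectral pY.
have es : mscale s%:C (ptr1 rho) = sd V (fun i => s * p i) by rewrite er sdZ.
have trE l := rtr_sd_sum l uV.
rewrite /logm (funmE _ uV es) (funmE _ uV er) {1 2}er !sdM // !trE.
have trr : \sum_i p i = 1 by rewrite -trE -er /rtr tY.
rewrite -[log2 s]mul1r -trr mulr_suml -big_split; apply: eq_bigr => i _ /=.
have [->|pi] := eqVneq (p i) 0; first by rewrite !mul0r addr0.
have pp : 0 < p i by rewrite lt_def pi p0.
by rewrite mulr_gt0 // pp log2M //; ring.
Qed.

Lemma rel_ent_relabel I J (f : J -> I) (rho sigma : Op R I) : bijective f ->
  psd rho -> psd sigma -> rel_ent (relabel f rho) (relabel f sigma) = rel_ent rho sigma.
Proof.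
move=> bf /psd_herm hr /psd_herm hs; rewrite /rel_ent /logm.
by rewrite (funm_relabel bf _ hr) (funm_relabel bf _ hs) -!(relabel_mm bf) !(rtr_relabel bf).
Qed.
End Conditional.

(** * Choi operators of bipartite channels and of [R^1 (x) Q] *)

Section Bipartite.
Variable R : realType.
Local Notation C := R[i].
Local Notation "x %:C" := (real_complex R x).

Lemma relabel_can (I J : finType) (f : J -> I) g (X : Op R I) : cancel g f -> relabel g (relabel f
    X) = X.
Proof. by move=> gK; apply: matP => i j; rewrite /relabel !gK. Qed.

Lemma relabel_inj (I J : finType) (f : J -> I) (X Y : Op R I) : bijective f ->
  relabel f X = relabel f Y -> X = Y.
Proof.
by case=> g _ gK /(congr1 (relabel g)); rewrite !(relabel_can _ gK).
Qed.

Lemma psd_unrelabel (I J : finType) (f : J -> I) (X : Op R I) : bijective f ->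
  psd (relabel f X) -> psd X.
Proof. by case=> g _ gK /(psd_relabel g); rewrite (relabel_can _ gK). Qed.

Section Fixed.
Variables A' B' A B : finType.
Local Notation I := (A' * B')%type.
Local Notation O := (A * B)%type.
Local Notation X := (A' * A)%type.
Local Notation Y := (B' * B)%type.

Definition regroup (p : X * Y) : I * O := ((p.1.1, p.2.1), (p.1.2, p.2.2)).

Lemma regroup_bij : bijective regroup.
Proof. by exists (fun q : I * O => ((q.1.1, q.2.1), (q.1.2, q.2.2))) => -[[? ?] [? ?]]. Qed.

Lemma card_prod_inv : (#|{: I}|%:R^-1 : C) = #|A'|%:R^-1 * #|B'|%:R^-1.
Proof. by rewrite card_prod natrM invfM. Qed.

Lemma choi_relabel (N : kern R I O) : choi N = relabel regroup (choi_op N).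
Proof.
apply: matP => p q; rewrite /choi {1}/relabel kappE /relabel /choi_op /mscale /kmat /=.
transitivity (\sum_(x : I) \sum_(x' : I) (#|{: I}|%:R^-1 * N (p.1.2, p.2.2) (q.1.2, q.2.2) x x') *
    delta R (p.1.1, p.2.1) (q.1.1, q.2.1) x x'); last by rewrite sum_delta.
apply: eq_bigr => -[x1 x2] _; apply: eq_bigr => -[y1 y2] _.
rewrite card_prod_inv /opten /maxent /delta /= !xpair_eqE -!mulnb !natrM.
rewrite [x1 == _]eq_sym [x2 == _]eq_sym [y1 == _]eq_sym [y2 == _]eq_sym.
ring.
Qed.

Definition rone (Q : kern R B' B) : kern R I O := ktens (@Rone R A' A) Q.

(** The factor [1 / #|A'|], the normalisation of the reference of [A'], is the origin of [log |A'|]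
    in the theorem. *)
Lemma choi_rone (Q : kern R B' B) :
  relabel regroup (choi_op (rone Q)) =
  opten (@opid R X) (mscale (#|A'|%:R^-1)%:C (choi_op Q)).
Proof.
apply: matP => -[[a' a] [b' b]] [[a1' a1] [b1' b1]].
rewrite /relabel /choi_op /mscale /kmat /rone /ktens /Rone /opten /opid /= card_prod_inv.
rewrite -card_invC xpair_eqE andbC; ring.
Qed.

Lemma psd_rone (Q : kern R B' B) : psd (kmat Q) -> psd (kmat (rone Q)).
Proof.
move=> pQ; apply: (psd_unrelabel regroup_bij).
have -> : relabel regroup (kmat (rone Q)) = opten (@opid R X) (kmat Q).
  apply: matP => -[[a' a] [b' b]] [[a1' a1] [b1' b1]].
  by rewrite /relabel /kmat /rone /ktens /Rone /opten /opid /= xpair_eqE andbC.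
exact: psd_opten.
Qed.

Section Channel.
Variable N : kern R I O.
Hypotheses (A'0 : (0 < #|A'|)%N) (B'0 : (0 < #|B'|)%N) (cN : is_channel N).

Let I0 : (0 < #|{: I}|)%N. Proof. by rewrite card_prod muln_gt0 A'0. Qed.
Let An : #|A'|%:R != 0 :> C. Proof. by rewrite pnatr_eq0 -lt0n. Qed.
Let Bn : #|B'|%:R != 0 :> C. Proof. by rewrite pnatr_eq0 -lt0n. Qed.

Lemma choi_is_state : is_state (choi N).
Proof.
have [p t] := choi_state I0 cN; rewrite choi_relabel; split; first exact: psd_relabel.
by rewrite (optr_relabel regroup_bij).
Qed.

(* [reduced] has Choi state [ptr1 (choi N)]: it feeds the maximally mixed state to [A']
   and discards [A]. *)
Definition reduced : kern R B' B := matk (mscale #|B'|%:R (ptr1 (choi N))).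

Lemma choi_reduced : choi_op reduced = ptr1 (choi N).
Proof. by rewrite /choi_op /reduced matkK mscaleA mulVf // mscale1. Qed.

Lemma reduced_channel : is_channel reduced.
Proof.
have [pY tY] := ptr1_state choi_is_state.
apply: kmat_channel.
  rewrite matkK; have -> : (#|B'|%:R : C) = (#|B'|%:R : R)%:C by rewrite rmorph_nat.
  by apply: psdZ => //; rewrite ler0n.
move=> b b'; rewrite /reduced /matk /mscale -mulr_sumr.
transitivity (#|B'|%:R * \sum_(a' : A') #|{: I}|%:R^-1 * ((a', b) == (a', b'))%:R : C).
  congr (_ * _); rewrite /ptr1; under eq_bigr => o _ do rewrite sum_pair.
  rewrite exchange_big; apply: eq_bigr => a' _ /=.
  rewrite exchange_big /= -(channel_tp cN) mulr_sumr sum_pair; apply: eq_bigr => a _.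
  by apply: eq_bigr => o _; rewrite choi_relabel.
under eq_bigr => a' _ do rewrite xpair_eqE eqxx.
rewrite sumr_const -mulr_natl card_prod_inv /=.
by rewrite -[in LHS]mulrA -[RHS]mul1r; field; rewrite An Bn.
Qed.

Lemma choi_rone_reduced : relabel regroup (choi_op (rone reduced)) =
  opten (@opid R X) (mscale (#|A'|%:R^-1)%:C (ptr1 (choi N))).
Proof. by rewrite choi_rone choi_reduced. Qed.

Lemma reduced_dom : exists c : R, ople (kmat N) (mscale c%:C (kmat (rone reduced))).
Proof.
exists (#|{: X}|%:R * #|A'|%:R).
have h : ople (choi_op N) (mscale (#|{: X}|%:R * #|A'|%:R)%:C (choi_op (rone reduced))).
  apply: (psd_unrelabel regroup_bij).
  have := ptr1_dom choi_is_state.1.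
  rewrite /ople; congr psd; apply: matP => p q.
  rewrite -[RHS]/((#|{: X}|%:R * #|A'|%:R)%:C * relabel regroup (choi_op (rone reduced)) p q
     - relabel regroup (choi_op N) p q) choi_rone_reduced -choi_relabel.
  rewrite /opsub /mscale /opten rmorphM /= !rmorph_nat -card_invC; congr (_ - _).
  by field.
have := opleZ (ler0n R #|{: I}|) h; rewrite rmorph_nat /choi_op !mscaleA.
have In : #|{: I}|%:R != 0 :> C by rewrite pnatr_eq0 -lt0n.
by rewrite mulrCA !mulfV // mulr1 mscale1.
Qed.

Lemma rel_ent_reduced :
  rel_ent (choi_op N) (choi_op (rone reduced)) = log2 #|A'|%:R - condS (choi N).
Proof.
have A0 : 0 < #|A'|%:R :> R by rewrite ltr0n.
rewrite -(rel_ent_relabel regroup_bij); first last.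
- exact/choi_op_psd/psd_rone/channel_psd/reduced_channel.
- exact/choi_op_psd/channel_psd.
rewrite choi_rone_reduced -choi_relabel rel_ent_opten_eq ?invr_gt0 //; last exact: choi_is_state.
by rewrite /log2 lnV ?posrE //; ring.
Qed.

Lemma rel_ent_rone_ge (Q : kern R B' B) : is_channel Q ->
  supp_le (choi_op N) (choi_op (rone Q)) ->
  log2 #|A'|%:R - condS (choi N) <= rel_ent (choi_op N) (choi_op (rone Q)).
Proof.
move=> cQ supp; have A0 : 0 < #|A'|%:R :> R by rewrite ltr0n.
have [pQ tQ] := choi_state B'0 cQ.
have pRQ := choi_op_psd (psd_rone (channel_psd cQ)).
rewrite -(rel_ent_relabel regroup_bij (choi_op_psd (channel_psd cN)) pRQ).
rewrite choi_rone -choi_relabel.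
have -> : log2 #|A'|%:R - condS (choi N) = - condS (choi N) - log2 (#|A'|%:R^-1).
  by rewrite /log2 lnV ?posrE //; ring.
apply: rel_ent_opten_ge; rewrite ?invr_gt0 //.
- exact: choi_is_state.
- by apply: psdZ => //; rewrite invr_ge0 ler0n.
- rewrite -choi_rone choi_relabel => v hv.
  have [h hK Kh] := regroup_bij.
  have rel (Z : Op R (I * O)%type) (w : X * Y -> C) :
      opapp (relabel regroup Z) w = opapp Z (w \o h) \o regroup.
    apply/funext => p; rewrite /opapp /relabel /= [RHS](reindex _ (onW_bij _ regroup_bij)).
    by apply: eq_bigr => q _; rewrite /= hK.
  rewrite !rel in hv *; rewrite (supp (v \o h)) //; apply/funext => q.
  by have := congr1 (fun u => u (h q)) hv; rewrite /= Kh.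
- by rewrite rtrZ /rtr tQ /= mulr1.
Qed.
End Channel.
End Fixed.
End Bipartite.

(** * From tele-covariance to designs and commuting Choi matrices *)

Section TeleCovariance.
Variable R : realType.
Local Notation C := R[i].
Local Notation "x %:C" := (real_complex R x).

(** On the pure state along [v] the functional is, up to a positive factor, a quadratic form in [v],
    so [qf_eq0] applies. Tele-covariance speaks of states only; this carries its identities over to
    matrix entries. *)
Lemma states_separate (I : finType) (c : I -> I -> C) :
  (forall X : Op R I, is_state X -> \sum_a \sum_b c a b * X a b = 0) ->
  forall a b, c a b = 0.
Proof.
move=> h a b; suff /(congr1 (fun Z => Z b a)) : (fun b a => c a b) = (fun _ _ => 0) :> Op R I by [].
apply: qf_eq0 => v; pose w : mat R I unit := fun i _ => v i.
have sE : qf (fun b a => c a b) v = \sum_a \sum_b c a b * mm w (adj w) a b.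
  rewrite /qf exchange_big; apply: eq_bigr => i _; apply: eq_bigr => j _ /=.
  rewrite /mm (bigD1 tt) //= big1 ?addr0 /adj /w; last by case.
  ring.
have [w0|w0] := eqVneq (hs w) 0.
  rewrite sE (hs_eq0 w0) big1 // => i _; rewrite big1 // => j _.
  by rewrite /mm big1 ?mulr0 // => k _; rewrite mul0r.
have wp : 0 < hs w by rewrite lt_def w0 hs_ge0.
have sX : is_state (mscale ((hs w)^-1)%:C (mm w (adj w))).
  split; first by apply: psdZ (psd_gram _); rewrite invr_ge0 ltW.
  rewrite optrZ (psd_optrE (psd_gram w)) -rmorphM /= rtrC.
  by rewrite -/(hs w) mulVf // rmorph1.
have := h _ sX; rewrite sE.
under eq_bigr => i _ do under eq_bigr => j _ do rewrite /mscale mulrCA.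
under eq_bigr => i _ do rewrite -mulr_sumr.
rewrite -mulr_sumr => /eqP; rewrite mulf_eq0 => /orP[|/eqP //].
by rewrite fmorph_eq0 invr_eq0 (negbTE w0).
Qed.

Lemma conjopE (I : finType) (U X : Op R I) i j :
  conjop U X i j = \sum_a \sum_b (U i a * conjc (U j b)) * X a b.
Proof.
rewrite /conjop /opmul; apply: eq_bigr => a _; rewrite mulr_sumr.
by apply: eq_bigr => b _; rewrite /opadj; ring.
Qed.

Lemma avg_design (G I : finType) (U : G -> Op R I) : (0 < #|G|)%N ->
  (forall rho : Op R I, is_state rho ->
    (fun i j => #|G|%:R^-1 * \sum_(g : G) conjop (U g) rho i j)
      = opscale (#|I|%:R^-1) (@opid R I)) ->
  design U.
Proof.
move=> G0 h x y x' y'; have Gn : #|G|%:R != 0 :> C by rewrite pnatr_eq0 -lt0n.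
pose c a b : C := #|G|%:R^-1 * (\sum_g U g x a * conjc (U g x' b)) -
   (x == x')%:R * (a == b)%:R / #|I|%:R.
have := @states_separate I c _ y y'; rewrite /c => e.
have {}e := (fun H => congr1 (fun z => #|G|%:R * z) (e H)).
have /e : forall X : Op R I, is_state X -> \sum_a \sum_b c a b * X a b = 0.
  move=> X sX; have := congr1 (fun Z => Z x x') (h X sX).
  rewrite /opscale /opid => eX.
  transitivity (#|G|%:R^-1 * (\sum_g conjop (U g) X x x') - #|I|%:R^-1 * (x == x')%:R * optr X).
    rewrite mulr_sumr /optr mulr_sumr -[X in X - _]/(\sum_g _).
    transitivity (\sum_a \sum_b (\sum_g #|G|%:R^-1 * (U g x a * conjc (U g x' b) * X a b)) -
       \sum_a \sum_b (x == x')%:R * (a == b)%:R / #|I|%:R * X a b).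
      rewrite -sumrB; apply: eq_bigr => a _; rewrite -sumrB; apply: eq_bigr => b _.
      rewrite /c mulrBl; congr (_ - _); rewrite -mulr_sumr -mulr_suml; ring.
    congr (_ - _).
      rewrite (eq_bigr _ (fun a _ => exchange_big _ _ _ _ _ _)) exchange_big.
      apply: eq_bigr => g _; rewrite conjopE mulr_sumr; apply: eq_bigr => a _.
      by rewrite mulr_sumr.
    apply: eq_bigr => a _; rewrite (bigD1 a) //= big1 ?addr0 ?eqxx; last first.
      by move=> b /negbTE; rewrite eq_sym => ->; rewrite mulr0 !mul0r.
    by rewrite mulr1; ring.
  by rewrite eX sX.2 mulr1 subrr.
rewrite mulr0 mulrBr mulVKf // => /eqP; rewrite subr_eq0 => /eqP ->.
ring.
Qed.

Lemma design_opten (G H I J : finType) (U : G -> Op R I) (V : H -> Op R J) :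
  design U -> design V -> design (fun gh : G * H => opten (U gh.1) (V gh.2)).
Proof.
move=> dU dV [x1 x2] [y1 y2] [x1' x2'] [y1' y2'] /=.
transitivity ((\sum_g U g x1 y1 * conjc (U g x1' y1')) * (\sum_h V h x2 y2 * conjc (V h x2' y2'))).
  rewrite sum_pair big_distrlr /=; apply: eq_bigr => g _; apply: eq_bigr => h _.
  by rewrite /opten /= rmorphM /=; ring.
rewrite dU dV !xpair_eqE -!mulnb !natrM !card_prod !natrM invfM; ring.
Qed.

Lemma states_covariant (I O : finType) (U : Op R I) (W : Op R O) (N : kern R I O) :
  unitary U -> unitary W ->
  (forall rho, is_state rho -> kapp N (conjop U rho) = conjop W (kapp N rho)) ->
  mm (opten (conjm U) W) (kmat N) = mm (kmat N) (opten (conjm U) W).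
Proof.
move=> uU uW h; have uC := unitary_conjm uU.
(* The two sides are the Choi matrices of [X -> N (U X U^+)] and of [X -> W N(X) W^+]. *)
have e : mm (opten (adj (conjm U)) (@opid R O)) (mm (kmat N) (opten (conjm U) (@opid R O))) =
         mm (opten (@opid R I) W) (mm (kmat N) (opten (@opid R I) (adj W))).
  apply: matP => -[a o] [b o']; apply/eqP; rewrite -subr_eq0; apply/eqP.
  pose c a b := mm (opten (adj (conjm U)) (@opid R O)) (mm (kmat N) (opten (conjm U) (@opid R O)))
      (a, o) (b, o')
     - mm (opten (@opid R I) W) (mm (kmat N) (opten (@opid R I) (adj W))) (a, o) (b, o').
  apply: (@states_separate I c) => X sX; rewrite {}/c.
  have := congr1 (fun Z => Z o o') (h X sX) => eX.
  have e1 a0 b0 : mm (opten (adj (conjm U)) (@opid R O)) (mm (kmat N) (opten (conjm U) (@opid R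
      O))) (a0, o) (b0, o')
      = \sum_x \sum_x' N o o' x x' * (U x a0 * conjc (U x' b0)).
    rewrite /mm sum_pair; apply: eq_bigr => x _.
    rewrite (bigD1 o) //= [X in _ + X]big1 ?addr0 => [|p /negbTE hp]; last first.
      by rewrite /opten /opid /= eq_sym hp mulr0 mul0r.
    rewrite sum_pair mulr_sumr; apply: eq_bigr => x' _.
    rewrite (bigD1 o') //= [X in _ + X]big1 ?addr0 => [|p /negbTE hp]; last first.
      by rewrite /opten /opid /= hp !mulr0.
    by rewrite /opten /opid /kmat /adj /conjm /= !eqxx conjcK !(mul1r, mulr1); ring.
  have e2 a0 b0 : mm (opten (@opid R I) W) (mm (kmat N) (opten (@opid R I) (adj W))) (a0, o) (b0,
      o')
      = \sum_p \sum_p' W o p * conjc (W o' p') * N p p' a0 b0.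
    rewrite /mm sum_pair (bigD1 a0) //= [X in _ + X]big1 ?addr0 => [|x /negbTE hx]; last first.
      by apply: big1 => p _; rewrite /opten /opid /= eq_sym hx !mul0r.
    apply: eq_bigr => p _; rewrite sum_pair (bigD1 b0) //= [X in _ + X]big1 ?addr0 => [|x /negbTE
        hx]; last first.
      by apply: big1 => p' _; rewrite /opten /opid /= hx mul0r mulr0.
    rewrite mulr_sumr; apply: eq_bigr => p' _.
    by rewrite /opten /opid /kmat /adj /= !eqxx !(mul1r, mulr1); ring.
  under eq_bigr => a0 _ do under eq_bigr => b0 _ do rewrite mulrBl.
  under eq_bigr => a0 _ do rewrite sumrB.
  rewrite sumrB; apply/eqP; rewrite subr_eq0; apply/eqP.
  transitivity (kapp N (conjop U X) o o').
    transitivity (\sum_x \sum_x' \sum_a0 \sum_b0 N o o' x x' * (U x a0 * conjc (U x' b0)) * X a0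
        b0).
      under eq_bigr => a0 _ do under eq_bigr => b0 _ do rewrite e1 mulr_suml.
      rewrite (eq_bigr _ (fun y _ => exchange_big _ _ _ _ _ _)) exchange_big.
      apply: eq_bigr => x _.
      under eq_bigr => a0 _ do under eq_bigr => b0 _ do rewrite mulr_suml.
      rewrite (eq_bigr _ (fun y _ => exchange_big _ _ _ _ _ _)) exchange_big.
      by [].
    apply: eq_bigr => x _; apply: eq_bigr => x' _.
    rewrite conjopE mulr_sumr; apply: eq_bigr => a0 _.
    by rewrite mulr_sumr; apply: eq_bigr => b0 _; rewrite !mulrA.
  rewrite eX conjopE.
  transitivity (\sum_p \sum_p' \sum_a0 \sum_b0 W o p * conjc (W o' p') * N p p' a0 b0 * X a0 b0).
    apply: eq_bigr => p _; apply: eq_bigr => p' _.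
    rewrite /kapp mulr_sumr; apply: eq_bigr => a0 _.
    by rewrite mulr_sumr; apply: eq_bigr => b0 _; rewrite !mulrA.
  symmetry.
  under eq_bigr => a0 _ do under eq_bigr => b0 _ do rewrite e2 mulr_suml.
  rewrite (eq_bigr _ (fun y _ => exchange_big _ _ _ _ _ _)) exchange_big.
  apply: eq_bigr => x _.
  under eq_bigr => a0 _ do under eq_bigr => b0 _ do rewrite mulr_suml.
  rewrite (eq_bigr _ (fun y _ => exchange_big _ _ _ _ _ _)) exchange_big.
  by [].
have := congr1 (fun Z => mm (opten (conjm U) (@opid R O)) (mm Z (opten (@opid R I) W))) e.
rewrite -!mmA !mm_opten !mm1l !mm1r (unitaryl uW) opten1 mm1r.
rewrite (mmA (opten (conjm U) _) (opten (adj _) _)) mm_opten (unitaryr uC) mm1l opten1 mm1l.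
rewrite (mmA (opten (conjm U) _) (opten _ W)) mm_opten mm1l mm1r.
by move=> ->.
Qed.
End TeleCovariance.

Section TeleCovariantPair.
Variable R : realType.
Local Notation C := R[i].
Local Notation "x %:C" := (real_complex R x).
Variables A' B' A B : finType.
Local Notation I := (A' * B')%type.
Local Notation O := (A * B)%type.
Local Notation X := (A' * A)%type.
Local Notation Y := (B' * B)%type.
Variable N : kern R I O.
Hypotheses (A'0 : (0 < #|A'|)%N) (B'0 : (0 < #|B'|)%N).

(** After regrouping, the symmetry splits as [p (x) q]. Tracing out the first factor removes [p] by
    unitarity, so [q] commutes with the marginal of the Choi state. *)
Lemma reduced_covariant (U : Op R A') (V : Op R B') (W : Op R A) (Z : Op R B) :
  unitary U -> unitary V -> unitary W -> unitary Z ->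
  mm (opten (conjm (opten U V)) (opten W Z)) (kmat N) =
  mm (kmat N) (opten (conjm (opten U V)) (opten W Z)) ->
  mm (opten (conjm (opten U V)) (opten W Z)) (kmat (rone (reduced N))) =
  mm (kmat (rone (reduced N))) (opten (conjm (opten U V)) (opten W Z)).
Proof.
move=> uU uV uW uZ h; have brg := @regroup_bij A' B' A B.
set Gam := opten (conjm _) _ in h *.
pose p := opten (conjm U) W; pose q := opten (conjm V) Z.
have up : unitary p by apply/unitary_opten/uW/unitary_conjm.
have uq : unitary q by apply/unitary_opten/uZ/unitary_conjm.
have eG : relabel (@regroup A' B' A B) Gam = opten p q.
  apply: matP => -[[a' a] [b' b]] [[a1' a1] [b1' b1]].
  by rewrite /relabel /Gam /opten /conjm /= rmorphM /p /q /opten /conjm /=; ring.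
have hN : mm (opten p q) (choi N) = mm (choi N) (opten p q).
  by rewrite choi_relabel -eG -!(relabel_mm brg) /choi_op mmZl mmZr h.
have hY : mm q (ptr1 (choi N)) = mm (ptr1 (choi N)) q.
  have e : mm q (mm (ptr1 (choi N)) (adj q)) = ptr1 (choi N).
    rewrite -(@ptr1_sandwich R X Y p (adj p)) ?unitaryl // -adj_opten.
    by rewrite mmA hN -mmA unitaryr ?mm1r //; apply: unitary_opten.
  by rewrite -{2}e -(mmA q) -(mmA _ (adj q)) unitaryl // mm1r.
have hE : mm Gam (choi_op (rone (reduced N))) = mm (choi_op (rone (reduced N))) Gam.
  apply: (relabel_inj brg); rewrite !(relabel_mm brg) eG choi_rone_reduced //.
  by rewrite !mm_opten mm1l mm1r mmZl mmZr hY.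
have I0 : #|{: I}|%:R != 0 :> C by rewrite pnatr_eq0 -lt0n card_prod muln_gt0 A'0.
move: hE; rewrite /choi_op mmZl mmZr => /(congr1 (mscale #|{: I}|%:R)).
by rewrite !mscaleA mulfV // !mscale1.
Qed.

Lemma telecov_pair : telecov N -> exists (G : finType) (U : G -> Op R I) (W : G -> Op R O),
  [/\ (0 < #|G|)%N, forall g, unitary (U g), forall g, unitary (W g), design U &
   covariant U W N /\ covariant U W (rone (reduced N))].
Proof.
case=> gT [hT [U [V [W [Z [[[uU _] [uV _]] [uW _] [uZ _] cov [aU aV]]]]]]].
have G0 : (0 < #|gT|)%N by apply/card_gt0P; exists 1%g.
have H0 : (0 < #|hT|)%N by apply/card_gt0P; exists 1%g.
have covN gh : mm (opten (conjm (opten (U gh.1) (V gh.2))) (opten (W gh.1 gh.2) (Z gh.1 gh.2)))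
    (kmat N) =
    mm (kmat N) (opten (conjm (opten (U gh.1) (V gh.2))) (opten (W gh.1 gh.2) (Z gh.1 gh.2))).
  by apply: states_covariant; [exact: unitary_opten|exact: unitary_opten|exact: cov].
exists (gT * hT)%type, (fun gh => opten (U gh.1) (V gh.2)), (fun gh => opten (W gh.1 gh.2) (Z gh.1
    gh.2)).
split.
- by rewrite card_prod muln_gt0 G0.
- by move=> gh; apply: unitary_opten.
- by move=> gh; apply: unitary_opten.
- by apply: design_opten; apply: avg_design.
by split=> gh; [apply: covN | apply: reduced_covariant => //; apply: covN].
Qed.
End TeleCovariantPair.

Section Divergences.
Variable R : realType.
Local Notation C := R[i].
Local Notation "x %:C" := (real_complex R x).
Implicit Types I J O : finType.

Lemma Dmax_ge I (rho sigma : Op R I) (L : R) :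
  (forall l : R, ople rho (mscale l%:C sigma) -> pow2 L <= l) -> (L%:E <= Dmax rho sigma)%E.
Proof.
move=> h; rewrite /Dmax; case: asboolP => [ex|_]; last exact: leey.
rewrite lee_fin -[L]log2_pow2; apply: ler_log2; first exact: pow2_gt0.
by apply: lb_le_inf => [|l]; [exact: ex | exact: h].
Qed.

(** Comparing traces bounds every admissible [l] below by [1 / rtr sigma > 0]; hence the infimum is
    positive and [log2] is monotone there. *)
Lemma Dmax_le I (rho sigma : Op R I) (L : R) : is_state rho -> psd sigma ->
  ople rho (mscale (pow2 L)%:C sigma) -> (Dmax rho sigma <= L%:E)%E.
Proof.
move=> [pr tr] ps h; rewrite /Dmax asboolT; last by exists (pow2 L).
have low l : ople rho (mscale l%:C sigma) -> 1 <= l * rtr sigma.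
  move=> hl; have := rtr_ople hl (@psd1 R I).
  by rewrite !mm1r rtrZ {1}/rtr tr.
have s0 : 0 < rtr sigma.
  rewrite lt_def psd_rtr_ge0 // andbT; apply/eqP => z.
  by have := low _ h; rewrite z mulr0 ler10.
have lb l : ople rho (mscale l%:C sigma) -> (rtr sigma)^-1 <= l.
  by move=> /low; rewrite -ler_pdivrMr // div1r.
rewrite lee_fin -[L]log2_pow2; apply: ler_log2.
  apply: (@lt_le_trans _ _ (rtr sigma)^-1); first by rewrite invr_gt0.
  by apply: lb_le_inf => [|l]; [exists (pow2 L) | exact: lb].
by apply: ge_inf => //; exists (rtr sigma)^-1 => l /lb.
Qed.

Lemma opapp_relabel I J (f : J -> I) (h : I -> J) (X : Op R I) (w : J -> C) :
  cancel f h -> cancel h f -> opapp (relabel f X) w = opapp X (w \o h) \o f.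
Proof.
move=> fh hf; apply/funext => p.
have bf : bijective f by exists h.
rewrite /opapp /relabel /= [RHS](reindex _ (onW_bij _ bf)).
by apply: eq_bigr => q _; rewrite /= fh.
Qed.

Lemma supp_relabel I J (f : J -> I) (X Y : Op R I) : bijective f ->
  supp_le X Y -> supp_le (relabel f X) (relabel f Y).
Proof.
case=> h fh hf s v; rewrite !(opapp_relabel _ _ fh hf) => e.
rewrite s //; apply/funext => i; have := congr1 (fun u => u (h i)) e.
by rewrite /= hf.
Qed.

Lemma supp_unrelabel I J (f : J -> I) (X Y : Op R I) : bijective f ->
  supp_le (relabel f X) (relabel f Y) -> supp_le X Y.
Proof.
case=> h fh hf /(@supp_relabel _ _ h _ _ (Bijective hf fh)).
by rewrite !(relabel_can _ hf).
Qed.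
End Divergences.

(** * A test against all operators [1 (x) omega] *)

Section ConditionalTest.
Variable R : realType.
Local Notation C := R[i].
Local Notation "x %:C" := (real_complex R x).
Implicit Types I J X Y : finType.

Lemma typ_relabel I J (f : J -> I) a d (Z : Op R I) : bijective f -> psd Z ->
  typ a d (relabel f Z) = relabel f (typ a d Z).
Proof. by move=> bf pZ; apply: funm_relabel => //; apply: psd_herm. Qed.

(* [tr_X P <= 2^(d - a) rho_Y] because [P <= 2^(d - a) rho]; this is why a test built from
   the joint and the marginal typical projectors is good against every [1 (x) omega]. *)
Lemma cond_test X Y (rho : Op R (X * Y)%type) (a b d e : R) : is_state rho ->
  1 - e <= rtr (mm (typ a d rho) rho) -> 1 - e <= rtr (mm (typ b d (ptr1 rho)) (ptr1 rho)) ->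
  exists T : Op R (X * Y)%type, [/\ psd T, psd (msub (@opid R _) T), 1 - 4 * e <= rtr (mm T rho) &
    forall w : Op R Y, psd w ->
      rtr (mm T (opten (@opid R X) w)) <= pow2 (b - a + 2 * d) * rtr w].
Proof.
move=> [pr tr] hP hQ; have t1 : rtr rho = 1 by rewrite /rtr tr.
have pY := ptr1_psd pr.
have pP := typ_proj a d pr; have pq := typ_proj b d pY.
have P_le := typ_le a d pr; have q_ge := typ_ge b d pY.
have P_comm := typ_comm a d pr (erefl (mm rho rho)).
move: (typ a d rho) (typ b d (ptr1 rho)) pP pq P_le q_ge P_comm hP hQ.
move=> P q pP pq P_le q_ge P_comm hP hQ.
have pQ := proj_opten X pq; set Q := opten (@opid R X) q in pQ.
have hQ' : 1 - e <= rtr (mm Q rho) by rewrite rtrC rtr_ptr1 rtrC.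
exists (mm (mm Q P) (adj (mm Q P))); have [h1 h2] := proj_test pP pQ.
split=> //.
  have w : 1 - 2 * e <= rtr (mm (mm Q P) rho).
    by have := @gentle _ _ P Q rho e pP pQ pr P_comm; rewrite t1; apply.
  by have := gentle_test pr w; rewrite t1; lra.
move=> w pw.
have pqw : psd (mm q (mm w q)) by apply: psd_sandwich pw; case: pq.
have -> : rtr (mm (mm (mm Q P) (adj (mm Q P))) (opten (@opid R X) w)) =
    rtr (mm P (opten (@opid R X) (mm q (mm w q)))).
  have -> : opten (@opid R X) (mm q (mm w q)) = mm Q (mm (opten (@opid R X) w) Q).
    by rewrite /Q !mm_opten !mm1l.
  by rewrite adjM pP.1 pQ.1 -!mmA (mmA P P) pP.2 rtrC -!mmA.
apply: le_trans (rtr_ople P_le (@psd_opten R X Y _ pqw)) _.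
rewrite mmZl rtrZ rtr_ptr1.
have -> : rtr (mm (ptr1 rho) (mm q (mm w q))) = rtr (mm (mm q (mm (ptr1 rho) q)) w).
  by rewrite !mmA rtrC !mmA.
have := rtr_ople q_ge pw; rewrite mmZl rtrZ => h.
have := rtr_proj_le pq pw => h'.
have -> : b - a + 2 * d = (d - a) + (b + d) by ring.
rewrite (pow2D (d - a)) -mulrA ler_pM2l ?pow2_gt0 //; apply: le_trans h _.
by rewrite ler_pM2l ?pow2_gt0.
Qed.

Section Power.
Variables (n : nat) (Xn Yn X Y : finType) (f : Xn -> 'I_n -> X) (g : Yn -> 'I_n -> Y).
Hypotheses (bf : bijective (fun x => [ffun t => f x t])) (bg : bijective (fun y => [ffun t => g y
    t])).

Lemma ptr1_tpow (rho : Op R (X * Y)%type) :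
  ptr1 (relabel (pair_seq f g) (tpow n rho)) = relabel (fun y => [ffun t => g y t]) (tpow n (ptr1
      rho)).
Proof.
apply: matP => y y'; rewrite /ptr1 /relabel /tpow /tens.
rewrite bigA_distr_bigA [RHS](reindex _ (onW_bij _ bf)); apply: eq_bigr => x _ /=.
by apply: eq_bigr => t _; rewrite !ffunE.
Qed.
End Power.

(** The marginal of the power is the power of the marginal, so the law of large numbers makes both
    typical projectors likely and [cond_test] applies. *)
Lemma cond_aep X Y (rho : Op R (X * Y)%type) (d e : R) : is_state rho -> 0 < d -> 0 < e ->
  exists n0 : nat, forall n, (n0 <= n)%N ->
  forall (Xn Yn : finType) (f : Xn -> 'I_n -> X) (g : Yn -> 'I_n -> Y),
    bijective (fun x => [ffun t => f x t]) -> bijective (fun y => [ffun t => g y t]) ->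
  exists T : Op R (Xn * Yn)%type, [/\ psd T, psd (msub (@opid R _) T),
    1 - e <= rtr (mm T (relabel (pair_seq f g) (tpow n rho))) &
    forall w : Op R Yn, psd w ->
      rtr (mm T (opten (@opid R Xn) w)) <= pow2 (n%:R * (condS rho + d)) * rtr w].
Proof.
move=> sr d0 e0; have sY := ptr1_state sr.
have sup (I : finType) (Z : Op R I) : supp_le Z Z by [].
have [v v0 hv] := typ_prob sr sr.1 (sup _ _); have [w w0 hw] := typ_prob sY sY.1 (sup _ _).
have d2 : 0 < d / 2 by rewrite divr_gt0.
have e4 : 0 < e / 4 by rewrite divr_gt0.
have [n0 hn0] := chebyshev_large (addr_ge0 v0 w0) d2 e4.
exists n0 => n /hn0[n1 hb] Xn Yn f g bf bg.
have [pr tr] := state_tpow n sr; have bpair := pair_seq_bij bf bg.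
have sn : is_state (relabel (pair_seq f g) (tpow n rho)).
  by split; [exact: (psd_relabel _ pr) | rewrite (optr_relabel bpair)].
set a := rtr (mm rho (logm rho)) in hv; set b := rtr (mm (ptr1 rho) (logm (ptr1 rho))) in hw.
have [||T [h1 h2 h3 h4]] := @cond_test _ _ _ (n%:R * a) (n%:R * b) (n%:R * (d / 2)) (e / 4) sn.
- rewrite typ_relabel // -(relabel_mm bpair) (rtr_relabel bpair).
  by have := hv n _ n1 d2; have := hb v v0; lra.
- rewrite (ptr1_tpow _ bf) typ_relabel //; last exact: (psd_tpow n sY.1).
  rewrite -(relabel_mm bg) (rtr_relabel bg).
  by have := hw n _ n1 d2; have := hb w w0; lra.
exists T; split=> //; first by apply: le_trans h3; lra.
move=> om /h4.
have -> // : n%:R * b - n%:R * a + 2 * (n%:R * (d / 2)) = n%:R * (condS rho + d).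
by rewrite /condS /vN -!/(rtr (mm _ _)) -/a -/b; field.
Qed.
End ConditionalTest.

(** * Rates *)

Section Rates.
Variable R : realType.
Local Notation C := R[i].
Local Notation "x %:C" := (real_complex R x).

Lemma rate_le (n : nat) (x : \bar R) (y : R) : (0 < n)%N ->
  (x <= (n%:R * y)%:E)%E -> ((n%:R^-1)%:E * x <= y%:E)%E.
Proof.
move=> n0 h; have nR : n%:R != 0 :> R by rewrite pnatr_eq0 -lt0n.
have -> : y%:E = ((n%:R^-1)%:E * (n%:R * y)%:E)%E by rewrite -EFinM mulKf.
by apply: lee_wpmul2l h; rewrite lee_fin invr_ge0 ler0n.
Qed.

Lemma rate_ge (n : nat) (x : \bar R) (y : R) : (0 < n)%N ->
  ((n%:R * y)%:E <= x)%E -> (y%:E <= (n%:R^-1)%:E * x)%E.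
Proof.
move=> n0 h; have nR : n%:R != 0 :> R by rewrite pnatr_eq0 -lt0n.
have -> : y%:E = ((n%:R^-1)%:E * (n%:R * y)%:E)%E by rewrite -EFinM mulKf.
by apply: lee_wpmul2l h; rewrite lee_fin invr_ge0 ler0n.
Qed.

Section Sequences.
Variables (n : nat) (S T : finType).

Definition zipf (x : {ffun 'I_n -> S} * {ffun 'I_n -> T}) (t : 'I_n) : S * T := (x.1 t, x.2 t).

Lemma zipf_bij : bijective (fun x => [ffun t => zipf x t]).
Proof.
exists (fun z : {ffun 'I_n -> (S * T)%type} => ([ffun t => (z t).1], [ffun t => (z t).2])).
  by move=> [x y]; congr (_, _); apply/ffunP => t; rewrite !ffunE.
by move=> z; apply/ffunP => t; rewrite !ffunE /zipf !ffunE; case: (z t).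
Qed.
End Sequences.

Variables A' B' A B : finType.
Local Notation I := (A' * B')%type.
Local Notation O := (A * B)%type.
Local Notation X := (A' * A)%type.
Local Notation Y := (B' * B)%type.
Variable N : kern R I O.
Hypotheses (A'0 : (0 < #|A'|)%N) (B'0 : (0 < #|B'|)%N) (cN : is_channel N).

Lemma kpowE n : kpow n N = kern_seq (@zipf n A' B') (@zipf n A B) N.
Proof. by []. Qed.

Lemma choi_kpow n : relabel (@regroup _ _ _ _) (choi_op (kpow n N)) =
  relabel (pair_seq (@zipf n A' A) (@zipf n B' B)) (tpow n (choi N)).
Proof.
rewrite kpowE (choi_kern_seq _ (@zipf_bij n A' B')); apply: matP => p q.
rewrite /relabel /tpow /tens; apply: eq_bigr => t _.
by rewrite !ffunE choi_relabel.
Qed.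

Lemma kpow_rone n (Q : kern R B' B) :
  kern_seq (@zipf n A' B') (@zipf n A B) (rone (A' := A') (A := A) Q) = rone (kern_seq (@ev n B')
      (@ev n B) Q).
Proof.
apply/funext => o; apply/funext => o'; apply/funext => x; apply/funext => x'.
rewrite /kern_seq /rone /ktens /Rone big_split /=; congr (_ * _).
rewrite -mulnb natrM -!prod_eq_nat -big_split /=; apply: eq_bigr => t _.
by rewrite -natrM mulnb.
Qed.

(** Channel divergences range over references ['I_k]; this decodes such a reference and sorts the
    legs by party. *)
Definition flat_index (T U S V : finType) (p : 'I_#|{: T * U}| * (S * V)) : (T * S) * (U * V) :=
  (((enum_val p.1).1, p.2.1), ((enum_val p.1).2, p.2.2)).

Lemma flat_index_bij T U S V : bijective (@flat_index T U S V).
Proof.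
exists (fun q : (T * S) * (U * V) => (enum_rank (q.1.1, q.2.1), (q.1.2, q.2.2))).
  by move=> [x [s v]]; rewrite /flat_index /= -surjective_pairing enum_valK.
by move=> [[t s] [u v]]; rewrite /flat_index /= enum_rankK.
Qed.

Lemma relabel_flat (T U S V : finType) (M : Op R ((T * U) * (S * V))%type) :
  relabel (@unrank (T * U)%type (S * V)%type) M =
  relabel (@flat_index T U S V) (relabel (@regroup T U S V) M).
Proof.
apply: matP => -[x [s v]] [x' [s' v']].
by rewrite /relabel /regroup /flat_index /unrank /= -!surjective_pairing.
Qed.

Lemma smin_upper (e d : R) : 0 < e < 1 -> 0 < d ->
  exists n0 : nat, forall n : nat, (n0 <= n)%N ->
    ((n%:R^-1)%:E * Smin_eps e (kpow n N) <= (condS (choi N) - log2 #|A'|%:R + d)%:E)%E.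
Proof.
move=> /andP[e0 e1] d0; have A0 : 0 < #|A'|%:R :> R by rewrite ltr0n.
have e2 : 0 < 1 - e ^+ 2 by rewrite subr_gt0 expr_lt1 // ltW.
(* Purified distance at most [e] means root fidelity at least [s], which is positive for each
   [e < 1]. *)
pose s := Num.sqrt (1 - e ^+ 2); have s0 : 0 < s by rewrite sqrtr_gt0.
have s2 : s ^+ 2 = 1 - e ^+ 2 by rewrite sqr_sqrtr // ltW.
have c0 : 0 < s ^+ 2 / 4 by rewrite divr_gt0 // exprn_gt0.
have d2 : 0 < d / 2 by rewrite divr_gt0.
have [n1 hn1] := cond_aep (choi_is_state A'0 B'0 cN) d2 c0.
(* For these [n], [2^(- n d / 2) <= s^2 / 4]: half of [d] pays for the constant acceptance
   probability, the other half for typicality. *)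
have [n2 hn2] := nat_large (- log2 (s ^+ 2 / 4) / (d / 2)).
exists (maxn 1 (maxn n1 n2)) => n; rewrite !geq_max => /and3P[n0 l1 l2].
apply: rate_le => //; rewrite leeNl; apply: le_ereal_inf_tmp => z [Q [Nt [cQ cNt hP ->]]].
set In := ({ffun 'I_n -> A'} * {ffun 'I_n -> B'})%type in Nt cNt hP *.
set On := ({ffun 'I_n -> A} * {ffun 'I_n -> B})%type in Nt cNt hP *.
have In0 : (0 < #|{: In}|)%N by rewrite card_prod !card_ffun card_ord muln_gt0 !expn_gt0 A'0 B'0.
have An0 : (0 < #|{ffun 'I_n -> A'}|)%N by rewrite card_ffun card_ord expn_gt0 A'0.
have sM := @max_state_state R _ In0.
apply: le_ereal_sup_tmp; exists (Dmax (kapp (@kext R 'I_#|{: In}| _ _ Nt) (@max_state R In))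
    (kapp (@kext R 'I_#|{: In}| _ _ (rone Q)) (@max_state R In))).
  by exists #|{: In}|, (@max_state R In).
have bfl := @flat_index_bij {ffun 'I_n -> A'} {ffun 'I_n -> B'} {ffun 'I_n -> A} {ffun 'I_n -> B}.
set fl := @flat_index _ _ _ _ in bfl.
have [T [pT pT' hT1 hT2]] := hn1 n l1 _ _ _ _ (@zipf_bij n A' A) (@zipf_bij n B' B).
set Sg := relabel (@regroup _ _ _ _) (choi_op Nt).
have sS : is_state Sg.
  have [p t] := choi_state In0 cNt; split; first exact: (psd_relabel _ p).
  by rewrite (optr_relabel (@regroup_bij _ _ _ _)).
have hF : s <= root_fidelity (relabel fl (relabel (pair_seq (@zipf n A' A) (@zipf n B' B)) (tpow n
    (choi N))))
    (relabel fl Sg).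
  have : ((Num.sqrt (1 - fidelity (kapp (@kext R 'I_#|{: In}| _ _ (kpow n N)) (@max_state R In))
       (kapp (@kext R 'I_#|{: In}| _ _ Nt) (@max_state R In))))%:E <= e%:E)%E.
    apply: le_trans hP; apply: ereal_sup_ubound.
    by exists #|{: In}|, (@max_state R In).
  rewrite !kapp_max_state !relabel_flat choi_kpow -/Sg lee_fin fidelityE.
  set r := root_fidelity _ _; have r0 : 0 <= r by apply: root_fidelity_ge0.
  move=> h; rewrite leNgt; apply/negP => rs.
  have rs2 : r ^+ 2 < s ^+ 2 by rewrite ltr_pXn2r // nnegrE // ltW.
  have p : 0 <= 1 - r ^+ 2 by have := sqr_ge0 e; lra.
  have : Num.sqrt (1 - r ^+ 2) ^+ 2 <= e ^+ 2 by apply: lerXn2r; rewrite ?nnegrE ?sqrtr_ge0 // ltW.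
  rewrite sqr_sqrtr //; lra.
have [pr tr] : is_state (relabel (pair_seq (@zipf n A' A) (@zipf n B' B)) (tpow n (choi N))).
  have [p t] := state_tpow n (choi_is_state A'0 B'0 cN); split; first exact: (psd_relabel _ p).
  by rewrite (optr_relabel (pair_seq_bij (@zipf_bij _ _ _) (@zipf_bij _ _ _))).
have hq : s ^+ 2 / 4 <= rtr (mm T Sg).
  have := @fidelity_test R _ _ _ (relabel fl T) s (psd_relabel fl pr) (psd_relabel fl sS.1).
  rewrite -!(relabel_mm bfl) !(rtr_relabel bfl) {1}/rtr sS.2; apply=> //.
  - exact: psd_relabel.
  - have := psd_relabel fl pT'.
    by rewrite -[relabel _ _]/(msub (relabel fl (@opid R _)) (relabel fl T)) (relabel1 _ bfl).
  - by rewrite /rtr tr.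
  - by rewrite {1}/rtr tr /=; move: hT1; lra.
rewrite !kapp_max_state !relabel_flat choi_rone -/Sg.
set om := mscale _ (choi_op Q).
have Bn0 : (0 < #|{ffun 'I_n -> B'}|)%N by rewrite card_ffun card_ord expn_gt0 B'0.
have [pQ tQ] := choi_state Bn0 cQ.
have pom : psd om by apply: psdZ => //; rewrite invr_ge0 ler0n.
have tom : rtr om = pow2 (- (n%:R * log2 #|A'|%:R)).
  rewrite rtrZ /rtr tQ mulr1 pow2N card_ffun card_ord natrX; congr _^-1.
  by rewrite /pow2 /log2 mulrA divfK ?gt_eqF ?ln2_gt0 // mulr_natl -lnXn // lnK // posrE exprn_gt0.
rewrite -EFinN; apply: Dmax_ge => l hl.
have {}hl : ople Sg (mscale l%:C (opten (@opid R _) om)) by apply: (psd_unrelabel bfl).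
clearbody Sg om; have := rtr_ople hl pT; rewrite mmZl rtrZ rtrC [X in l * X]rtrC => h1.
have := hT2 om pom; rewrite tom -pow2D => h2.
have h3 : 0 <= rtr (mm T (opten (@opid R _) om)) by apply: rtr_mm_ge0 => //; apply: psd_opten.
(* [Dmax] admits negative [l] in its set; they are excluded because the test accepts [Sg] with
   positive probability. *)
have l0 : 0 <= l.
  rewrite leNgt; apply/negP => ln; have := le_trans hq h1.
  have : l * rtr (mm T (opten (@opid R _) om)) <= 0 by rewrite nmulr_rle0.
  lra.
have h4 := le_trans (le_trans hq h1) (ler_wpM2l l0 h2).
have h5 : pow2 (- (n%:R * (d / 2))) <= s ^+ 2 / 4.
  rewrite -[X in _ <= X]pow2_log2 // ler_pow2 lerNl.
  by have := hn2 n l2; rewrite ler_pdivrMr.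
have := le_trans h5 h4; set u := _ + _ => h6.
rewrite -(ler_pM2r (pow2_gt0 u)) -pow2D; apply: le_trans h6.
by rewrite ler_pow2 /u le_eqVlt; apply/orP; left; apply/eqP; field.
Qed.

(** The witnesses are the [n]-fold power of [reduced N] and the simulator, taken with fidelity error
    [e^2] so that the purified distance is at most [e]. *)
Lemma smin_lower (e d : R) : telecov N -> 0 < e < 1 -> 0 < d ->
  exists n0 : nat, forall n : nat, (n0 <= n)%N ->
    ((condS (choi N) - log2 #|A'|%:R - d)%:E <= (n%:R^-1)%:E * Smin_eps e (kpow n N))%E.
Proof.
move=> tN /andP[e0 e1] d0.
have [G [U [W [G0 uU uW dU [cov1 cov2]]]]] := telecov_pair A'0 B'0 tN.
have I0 : (0 < #|{: I}|)%N by rewrite card_prod muln_gt0 A'0.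
have [c dom] := reduced_dom A'0 B'0 cN.
have cQ := reduced_channel A'0 B'0 cN.
have e2 : 0 < e ^+ 2 by rewrite exprn_gt0.
have [n1 hn1] := covariant_simulator I0 G0 uU uW dU cN (psd_rone (channel_psd cQ)) cov1 cov2 dom
    d0 e2.
exists (maxn 1 n1) => n; rewrite geq_max => /andP[n0 /hn1 hn].
have [Nt [cNt fid dNt]] := hn _ _ _ _ (@zipf_bij n A' B') (@zipf_bij n A B).
apply: rate_ge => //; rewrite leeNr; apply: ge_ereal_inf.
have cQn : is_channel (kern_seq (@ev n B') (@ev n B) (reduced N)) by apply: kern_seq_channel =>
    //; apply: ev_bij.
exists (chan_div (@Dmax R) Nt (rone (kern_seq (@ev n B') (@ev n B) (reduced N)))).
  exists (kern_seq (@ev n B') (@ev n B) (reduced N)), Nt; split=> //.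
  apply: ge_ereal_sup => z [k [Z [sZ ->]]]; rewrite lee_fin.
  have := fid _ Z sZ; rewrite -kpowE => h.
  by rewrite -[X in _ <= X](ger0_norm (ltW e0)) -sqrtr_sqr ler_wsqrtr //; lra.
apply: ge_ereal_sup => z [k [Z [sZ ->]]].
rewrite kpow_rone in dNt; rewrite (rel_ent_reduced A'0 B'0 cN) in dNt.
rewrite -EFinN; apply: Dmax_le; first exact: channel_state.
  by apply: kapp_psd sZ.1; apply/psd_rone/channel_psd.
have -> : - (n%:R * (condS (choi N) - log2 #|A'|%:R - d)) =
   n%:R * (log2 #|A'|%:R - condS (choi N) + d) by ring.
exact: kapp_diff sZ.1 dNt.
Qed.

Lemma condS_ch_telecov : telecov N -> condS_ch N = (condS (choi N) - log2 #|A'|%:R)%:E.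
Proof.
move=> tN.
have [G [U [W [G0 uU uW dU [cov1 cov2]]]]] := telecov_pair A'0 B'0 tN.
have I0 : (0 < #|{: I}|)%N by rewrite card_prod muln_gt0 A'0.
have [c dom] := reduced_dom A'0 B'0 cN.
have cQ := reduced_channel A'0 B'0 cN.
have -> : condS (choi N) - log2 #|A'|%:R = - (log2 #|A'|%:R - condS (choi N)) by ring.
rewrite /condS_ch EFinN; congr (- _)%E; apply/eqP; rewrite eq_le; apply/andP; split.
  apply: ge_ereal_inf; exists (chan_div (@relent R) N (rone (reduced N))).
    by exists (reduced N).
  apply: ge_ereal_sup => z [k [Z [sZ ->]]]; rewrite -(rel_ent_reduced A'0 B'0 cN).
  exact: (covariant_relent I0 G0 uU uW dU cN (psd_rone (channel_psd cQ)) cov1 cov2 dom sZ).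
apply: le_ereal_inf_tmp => z [Q [cQ' ->]].
apply: le_ereal_sup_tmp; exists (relent (kapp (@kext R 'I_#|{: I}| _ _ N) (@max_state R I))
    (kapp (@kext R 'I_#|{: I}| _ _ (rone Q)) (@max_state R I))).
  by exists #|{: I}|, (@max_state R I); split=> //; apply: max_state_state.
rewrite !kapp_max_state; have bu := @unrank_bij I O.
(* Without support inclusion the divergence is [+oo] and the bound is trivial. *)
have [supp|nsupp] := pselect (supp_le (relabel (@unrank I O) (choi_op N))
    (relabel (@unrank I O) (choi_op (rone Q)))); last by rewrite /relent asboolF ?leey.
rewrite relentE // lee_fin (rel_ent_relabel bu); first last.
- exact/choi_op_psd/psd_rone/channel_psd.
- exact/choi_op_psd/channel_psd.
by apply: rel_ent_rone_ge => //; apply: (supp_unrelabel bu).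
Qed.
End Rates.

Theorem theorem4 (R : realType) (A' B' A B : finType)
  (N : kern R (prod A' B') (prod A B)) :
  (0 < #|A'|)%N -> (0 < #|B'|)%N -> (0 < #|A|)%N -> (0 < #|B|)%N ->
  is_channel N ->
  (* lim_{eps->0+} lim_n (1/n) S^eps_oo[A^n|B^n] <= S(R_A A|R_B B)_{Phi^N} - log|A'| *)
  (forall d : R, 0 < d -> exists e0 : R, 0 < e0 /\
     forall e : R, 0 < e < e0 -> exists n0 : nat, forall n : nat, (n0 <= n)%N ->
       ((n%:R^-1)%:E * Smin_eps e (kpow n N)
          <= (condS (choi N) - log2 #|A'|%:R + d)%:E)%E)
  /\
  (telecov N ->
   (* lim_{eps->0+} lim_n (1/n) S^eps_oo[A^n|B^n] <= S[A|B]_N *)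
   (forall d : R, 0 < d -> exists e0 : R, 0 < e0 /\
      forall e : R, 0 < e < e0 -> exists n0 : nat, forall n : nat, (n0 <= n)%N ->
        ((n%:R^-1)%:E * Smin_eps e (kpow n N) <= condS_ch N + d%:E)%E)
   /\
   (* for every eps in (0,1): lim_n (1/n) S^eps_oo[A^n|B^n] >= S[A|B]_N *)
   (forall e : R, 0 < e < 1 -> forall d : R, 0 < d ->
      exists n0 : nat, forall n : nat, (n0 <= n)%N ->
        (condS_ch N - d%:E <= (n%:R^-1)%:E * Smin_eps e (kpow n N))%E)).
Proof.
move=> A'0 B'0 _ _ cN; split=> [d d0|tN].
  by exists 1; split=> // e he; apply: smin_upper.
rewrite (condS_ch_telecov A'0 B'0 cN tN); split=> [d d0|e he d d0].
  by exists 1; split=> // e he; apply: smin_upper.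
exact: smin_lower.
Qed.
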